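(* Suppose that the nested fractal $\mathcal K$ satisfies Property (P). Let $p\ge1$ and $\sigma>0$ be given. (1) If $\sigma>d/p$, then $\mathcal P^{1,p}_\sigma(\mathcal K)\subset KS^{1,p}_\sigma(\mathcal K)$. (2) If $\sigma=\frac{d_w}{2}$, then $\mathcal P^{1,2}_\sigma(\mathcal K)=KS^{1,2}_\sigma(\mathcal K)$.
   Context: Nested fractal. Let $\phi_1,\dots,\phi_M$ ($M\ge2$) be similitudes of $\mathbb R^N$ with common scaling factor $L>1$, i.e. $|\phi_i(x)-\phi_i(y)|=L^{-1}|x-y|$. For $A\subset\mathbb R^N$ put $\Phi(A)=\bigcup_{i=1}^M\phi_i(A)$, and let $\Phi^m$ be its $m$-fold iterate. $\mathcal K$ is the unique nonempty compact set with $\mathcal K=\Phi(\mathcal K)$; it is normalized so that $\mathrm{diam}\,\mathcal K=1$. Let $v_i$ be the fixed point of $\phi_i$; $v_i$ is essential if there are another fixed point $v_j\ne v_i$ and $k,l$ with $\phi_k(v_i)=\phi_l(v_j)$. $V^{(0)}$ is the set of essential fixed points, $\#V^{(0)}\ge2$, $V^{(m)}=\Phi^m(V^{(0)})$, $V^{(\infty)}=\bigcup_{m\ge0}V^{(m)}$. $\mathcal W_m=\{1,\dots,M\}^m$; for $w=(w_1,\dots,w_m)\in\mathcal W_m$, $\phi_w=\phi_{w_1}\circ\cdots\circ\phi_{w_m}$ and $\mathcal K_w=\phi_w(\mathcal K)$. The sets $\mathcal K_w$, $w\in\mathcal W_m$, are the $m$-simplices (the $0$-simplex is $\mathcal K$),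 $\mathcal T_m$ is their collection, and $V(\mathcal K_w)=\phi_w(V^{(0)})$. $\mathcal K$ is a nested fractal, meaning: (open set condition) there is a nonempty open $U$ with $\Phi(U)\subset U$ and $\phi_i(U)\cap\phi_j(U)=\emptyset$ for $i\ne j$; (nesting) $S\cap T=V(S)\cap V(T)$ for distinct $S,T\in\mathcal T_m$, $m\ge1$; (connectivity) the graph on $V^{(1)}$ joining points of a common $\phi_i(V^{(0)})$ is connected; (symmetry) for $x\neq y$ in $V^{(0)}$, the reflection $R_{x,y}$ in the hyperplane bisecting $[x,y]$ maps each $\phi_i(V^{(0)})$ onto some $\phi_j(V^{(0)})$. $d=\log M/\log L$ is the Hausdorff dimension of $\mathcal K$, and $\mu$ is the $d$-dimensional Hausdorff measure on $\mathcal K$ normalized by $\mu(\mathcal K)=1$. $\rho(x,y)$ is the Euclidean distance and $B(x,r)=\{y\in\mathcal K:\rho(x,y)\le r\}$. Simplices and Property (P). For $x\in\mathcal K\setminus V^{(\infty)}$, $\Delta_m(x)$ is the unique $m$-simplex containing $x$. For $\Delta\in\mathcal T_m$, $\Delta^*$ is the union of $\Delta$ and all $m$-simplices adjacent to (i.e. intersecting) $\Delta$; $\Delta_m^*(x)=(\Delta_m(x))^*$. Property (P): there exists $\alpha>0$ such that for all $n=1,2,\dots$ and all $x,y\in\mathcal K\setminus V^{(\infty)}$ with $y\in\Delta_n^*(x)\setminus\Delta_{n+1}^*(x)$ one has $\rho(x,y)\ge\alpha L^{-n}$. Harmonic structure and Kusuoka measure. A conductivity matrix is a symmetric real $A=[a_{x,y}]_{x,y\in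 V^{(0)}}$ with nonnegative off-diagonal entries and zero row sums; $\mathcal E^{(0)}_A(f,f)=\frac12\sum_{x,y}a_{x,y}(f(x)-f(y))^2$. It is known that there are a unique number $\varrho>1$ and a unique, up to a multiplicative constant, irreducible $A$ invariant under the group generated by the $R_{x,y}$, $x\ne y\in V^{(0)}$, such that for all $f:V^{(0)}\to\mathbb R$, $\inf\{\sum_{i=1}^M\mathcal E^{(0)}_A(g\circ\phi_i,g\circ\phi_i): g:V^{(1)}\to\mathbb R,\ g|_{V^{(0)}}=f\}=\varrho^{-1}\mathcal E^{(0)}_A(f,f)$. Fix such $A$, write $\mathcal E^{(0)}=\mathcal E^{(0)}_A$. The walk dimension is $d_w=\log(M\varrho)/\log L$. For $f\in C(\mathcal K)$, $\mathcal E^{(m)}(f,f)=\varrho^m\sum_{w\in\mathcal W_m}\mathcal E^{(0)}(f\circ\phi_w,f\circ\phi_w)$ is nondecreasing in $m$; $\mathcal D(\mathcal E)=\{f\in C(\mathcal K):\sup_m\mathcal E^{(m)}(f,f)<\infty\}$ and $\mathcal E(f,f)=\lim_m\mathcal E^{(m)}(f,f)$. A function $h\in\mathcal D(\mathcal E)$ is harmonic if it minimizes $\mathcal E(g,g)$ among $g\in\mathcal D(\mathcal E)$ with $g=h$ on $V^{(0)}$. $\mathcal H$ is the space of harmonic functions with norm $\|h\|_{\mathcal H}^2=\mathcal E(h,h)+(\sum_{x\in V^{(0)}}h(x))^2$; $\widetilde{\mathcal H}$ is the orthogonal complement of the constants in $\mathcal H$, with norm $\|h\|^2=\mathcal E(h,h)$;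 $\widetilde P:\mathcal H\to\widetilde{\mathcal H}$ is the orthogonal projection. $\widetilde M_ih=\widetilde P(h\circ\phi_i)$ for $h\in\widetilde{\mathcal H}$, and $\widetilde M_w=\widetilde M_{w_m}\circ\cdots\circ\widetilde M_{w_1}$. The harmonic structure is assumed nondegenerate: all $\widetilde M_i$ are invertible. The Kusuoka measure $\nu$ is the Borel measure on $\mathcal K$ (without atoms) with $\nu(\mathcal K_w)=\varrho^m\,\mathrm{Tr}(\widetilde M_w^*\widetilde M_w)$, $w\in\mathcal W_m$. Function spaces ($p\ge1$, $\sigma>0$). $\mathcal P^{1,p}_\sigma(\mathcal K)$ is the set of $f\in L^p(\mathcal K,\mu)$ for which there are a nonnegative $g\in L^p(\mathcal K,\nu)$ and $A\ge1$ such that for all $x\in\mathcal K$ and $0<r<\mathrm{diam}\,\mathcal K$, $$\frac1{\mu(B(x,r))}\int_{B(x,r)}|f-f_{B(x,r)}|\,d\mu\le r^\sigma\Big(\frac1{\mu(B(x,Ar))}\int_{B(x,Ar)}g^p\,d\nu\Big)^{1/p},$$ where $f_B=\frac1{\mu(B)}\int_Bf\,d\mu$. $KS^{1,p}_\sigma(\mathcal K)$ is the set of $f\in L^p(\mathcal K,\mu)$ with $$\limsup_{\epsilon\to0}\int_{\mathcal K}\frac1{\mu(B(x,\epsilon))}\int_{B(x,\epsilon)}\frac{|f(x)-f(y)|^p}{\epsilon^{p\sigma}}\,d\mu(y)\,d\mu(x)<\infty.$$ *)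

(* Defs.v *)
From mathcomp Require Export all_boot all_order all_algebra.
From mathcomp Require Export all_classical all_reals all_analysis.
Export Order.TTheory GRing.Theory Num.Theory.
Export numFieldNormedType.Exports.

Set Implicit Arguments.
Unset Strict Implicit.
Unset Printing Implicit Defensive.

Local Open Scope classical_set_scope.
Local Open Scope ring_scope.

(* Subsets of the fractal K, and functions and measures on it, are represented
   in the ambient space 'rV[R]_N. Its library norm is the sup-norm: this gives
   the usual topology, but distances, diameters and balls are taken with respect
   to the Euclidean distance [edist]. *)

Definition borel (R : realType) (N : nat) :=
  g_sigma_algebraType (@open 'rV[R]_N).

Section EuclideanSpace.
Context {R : realType} {N : nat}.
Local Notation X := 'rV[R]_N.

Definition dotp (x y : X) : R := \sum_(i < N) x 0 i * y 0 i.

Definition edist (x y : X) : R := Num.sqrt (dotp (x - y) (x - y)).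

(* The point 0 is added so that the diameter of the empty set is 0, not -oo. *)
Definition ediam (A : set X) : \bar R :=
  ereal_sup (0%E |` [set (edist xy.1 xy.2)%:E | xy in A `*` A]).

Definition eball (K : set X) (x : X) (r : R) : set X :=
  [set y | K y /\ edist x y <= r].

(* The reflection in the hyperplane bisecting the segment [x, y]. *)
Definition reflection (x y : X) (z : X) : X :=
  z - (2 * dotp (z - 2^-1 *: (x + y)) (x - y) / dotp (x - y) (x - y))
        *: (x - y).

Definition hausdorff_pre (s delta : R) (A : set X) : \bar R :=
  ereal_inf [set (\sum_(0 <= k <oo) (ediam (U k) `^ s))%E |
    U in [set U : nat -> set X | A `<=` \bigcup_k U k /\
                                 forall k, (ediam (U k) <= delta%:E)%E]].

Definition hausdorff_measure (s : R) (A : set X) : \bar R :=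
  ereal_sup [set hausdorff_pre s delta A | delta in [set delta | 0 < delta]].

Definition normalized_hausdorff (s : R) (K : set X)
    (mu : set (borel R N) -> \bar R) : Prop :=
  mu K = 1%E /\
  exists2 c : R, 0 < c & forall B : set (borel R N), measurable B ->
    mu B = (c%:E * hausdorff_measure s (B `&` K))%E.

Definition graph_connected (V : set X) (adj : X -> X -> Prop) : Prop :=
  forall x y, V x -> V y ->
    exists s : seq X, path (fun u v => `[< adj u v >]) x s /\ last x s = y.

End EuclideanSpace.

Definition hausdorff_dim (R : realType) (M : nat) (L : R) : R :=
  ln M%:R / ln L.

Definition walk_dim (R : realType) (M : nat) (L varrho : R) : R :=
  ln (M%:R * varrho) / ln L.

Section IteratedFunctionSystem.
Context {R : realType} {N M : nat}.
Local Notation X := 'rV[R]_N.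
Variable phi : 'I_M -> X -> X.

Definition Phi (A : set X) : set X := \bigcup_(i in [set: 'I_M]) (phi i @` A).

Definition phiw (w : seq 'I_M) (x : X) : X := foldr phi x w.

Definition fixed_points : set X := [set x | exists i, phi i x = x].

Definition V0 : set X :=
  [set x | fixed_points x /\
    exists y, [/\ fixed_points y, y <> x & exists k l, phi k x = phi l y]].

Definition Vm (m : nat) : set X := iter m Phi V0.

Definition Vinf : set X := \bigcup_m Vm m.

(* The generators are involutions, so closure under inverses is automatic. *)
Inductive reflection_group : (X -> X) -> Prop :=
| reflection_group_id : reflection_group id
| reflection_group_comp x y g : V0 x -> V0 y -> x <> y ->
    reflection_group g -> reflection_group (reflection x y \o g).

Definition cell (K : set X) (w : seq 'I_M) : set X := phiw w @` K.

Definition simplices (K : set X) (m : nat) : set (set X) :=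
  [set cell K w | w in [set: m.-tuple 'I_M]].

Record nested_fractal (L : R) (K : set X) : Prop := NestedFractal {
  nf_card : (2 <= M)%N ;
  nf_scale : 1 < L ;
  nf_similitude : forall i x y, edist (phi i x) (phi i y) = L^-1 * edist x y ;
  nf_nonempty : K !=set0 ;
  nf_compact : compact K ;
  nf_invariant : K = Phi K ;
  nf_diam : ediam K = 1%E ;
  nf_V0 : exists x y, [/\ V0 x, V0 y & x <> y] ;
  nf_open_set : exists U : set X,
    [/\ U !=set0, open U, Phi U `<=` U &
        forall i j, i <> j -> phi i @` U `&` phi j @` U = set0] ;
  nf_nesting : forall m (w w' : m.-tuple 'I_M), (1 <= m)%N ->
    cell K w <> cell K w' ->
    cell K w `&` cell K w' = (phiw w @` V0) `&` (phiw w' @` V0) ;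
  nf_connectivity : graph_connected (Vm 1)
    (fun x y => exists i, (phi i @` V0) x /\ (phi i @` V0) y) ;
  nf_symmetry : forall x y, V0 x -> V0 y -> x <> y ->
    forall i, exists j, reflection x y @` (phi i @` V0) = phi j @` V0
}.

(* For x in K outside Vinf, "the" m-simplex containing x; set0 is a dummy. *)
Definition Delta (K : set X) (m : nat) (x : X) : set X :=
  xget set0 [set S | simplices K m S /\ S x].

Definition star (K : set X) (m : nat) (D : set X) : set X :=
  D `|` \bigcup_(S in [set S | simplices K m S /\ S `&` D !=set0]) S.

Definition Deltastar (K : set X) (m : nat) (x : X) : set X :=
  star K m (Delta K m x).

Definition property_P (L : R) (K : set X) : Prop :=
  exists2 alpha : R, 0 < alpha &
    forall (n : nat) (x y : X), (1 <= n)%N ->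
      (K `\` Vinf) x -> (K `\` Vinf) y ->
      (Deltastar K n x `\` Deltastar K n.+1 x) y ->
      alpha * L ^- n <= edist x y.

(* Functions on V0, V1 or K are represented by functions on the ambient space;
   only their values on the respective set matter. *)

Definition energy0 (a : X -> X -> R) (f : X -> R) : R :=
  2^-1 * \sum_(x \in V0) \sum_(y \in V0) a x y * (f x - f y) ^+ 2.

Record conductivity_matrix (a : X -> X -> R) : Prop := ConductivityMatrix {
  cm_sym : forall x y, V0 x -> V0 y -> a x y = a y x ;
  cm_ge0 : forall x y, V0 x -> V0 y -> x <> y -> 0 <= a x y ;
  cm_row : forall x, V0 x -> \sum_(y \in V0) a x y = 0
}.

Definition irreducible_matrix (a : X -> X -> R) : Prop :=
  graph_connected V0 (fun x y => [/\ V0 x, V0 y, x <> y & 0 < a x y]).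

(* The guards V0 (g x), V0 (g y) make the condition independent of the
   irrelevant values of a outside V0 x V0. *)
Definition invariant_matrix (a : X -> X -> R) : Prop :=
  forall g, reflection_group g -> forall x y, V0 x -> V0 y ->
    V0 (g x) -> V0 (g y) -> a (g x) (g y) = a x y.

Record harmonic_structure (a : X -> X -> R) (varrho : R) : Prop :=
HarmonicStructure {
  hs_varrho : 1 < varrho ;
  hs_conductivity : conductivity_matrix a ;
  hs_irreducible : irreducible_matrix a ;
  hs_invariant : invariant_matrix a ;
  hs_renormalization : forall f : X -> R,
    inf [set \sum_(i < M) energy0 a (g \o phi i) |
           g in [set g : X -> R | forall x, V0 x -> g x = f x]]
    = varrho^-1 * energy0 a f
}.

Section Energy.
Variables (K : set X) (a : X -> X -> R) (varrho : R).

Definition energym (m : nat) (f : X -> R) : R :=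
  varrho ^+ m * \sum_(w : m.-tuple 'I_M) energy0 a (f \o phiw w).

Definition energy_domain : set (X -> R) :=
  [set f | {within K, continuous f} /\
           has_ubound (range (fun m => energym m f))].

Definition energy (f : X -> R) : R := limn (fun m => energym m f).

Definition harmonic : set (X -> R) :=
  [set h | energy_domain h /\
    forall g, energy_domain g -> (forall x, V0 x -> g x = h x) ->
      energy h <= energy g].

Definition energy_form (f g : X -> R) : R :=
  2^-1 * (energy (f \+ g) - energy f - energy g).

(* The inner product with norm energy h + (\sum_(x \in V0) h x) ^+ 2. *)
Definition innerH (f g : X -> R) : R :=
  energy_form f g + (\sum_(x \in V0) f x) * (\sum_(x \in V0) g x).

Definition Htilde : set (X -> R) :=
  [set h | harmonic h /\ forall c : R, innerH h (cst c) = 0].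

Definition Ptilde (h : X -> R) : X -> R :=
  fun x => h x - innerH h (cst 1) / innerH (cst 1) (cst 1).

Definition Mtilde (i : 'I_M) (h : X -> R) : X -> R := Ptilde (h \o phi i).

(* Mtilde w = Mtilde w_m \o ... \o Mtilde w_1. *)
Definition Mtildew (w : seq 'I_M) (h : X -> R) : X -> R :=
  foldl (fun f i => Mtilde i f) h w.

(* Each Mtilde i is a bijection of Htilde, whose elements are functions on K. *)
Definition nondegenerate : Prop :=
  forall i,
    (forall h1 h2, Htilde h1 -> Htilde h2 ->
       {in K, Mtilde i h1 =1 Mtilde i h2} -> {in K, h1 =1 h2}) /\
    (forall k, Htilde k -> exists2 h, Htilde h & {in K, Mtilde i h =1 k}).

Record orthonormal_basis (n : nat) (e : 'I_n -> X -> R) : Prop :=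
OrthonormalBasis {
  onb_in : forall i, Htilde (e i) ;
  onb_orth : forall i j, energy_form (e i) (e j) = (i == j)%:R ;
  onb_span : forall h, Htilde h -> exists c : 'I_n -> R,
    {in K, h =1 (fun x => \sum_(i < n) c i * e i x)}
}.

Definition op_mx (n : nat) (e : 'I_n -> X -> R)
    (T : (X -> R) -> (X -> R)) : 'M[R]_n :=
  \matrix_(i, j) energy_form (e i) (T (e j)).

(* t is the trace of T^* T on the Euclidean space Htilde: in an orthonormal
   basis the adjoint is the transpose. *)
Definition is_trace_adj (T : (X -> R) -> (X -> R)) (t : R) : Prop :=
  exists (n : nat) (e : 'I_n -> X -> R), orthonormal_basis e /\
    t = \tr ((op_mx e T)^T *m op_mx e T).

Record kusuoka_measure (nu : set (borel R N) -> \bar R) : Prop :=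
KusuokaMeasure {
  km_support : nu (~` K) = 0%E ;
  km_atomless : forall x : borel R N, nu [set x] = 0%E ;
  km_cell : forall m (w : m.-tuple 'I_M), exists2 t : R,
    is_trace_adj (Mtildew w) t & nu (cell K w) = (varrho ^+ m * t)%:E
}.

End Energy.
End IteratedFunctionSystem.

Section FunctionSpaces.
Context {R : realType} {N : nat}.
Local Notation X := 'rV[R]_N.
Variable K : set (borel R N).

Definition Lp (mu : {measure set (borel R N) -> \bar R}) (p : R) :
    set (borel R N -> R) :=
  [set f : borel R N -> R | measurable_fun K f /\
           (\int[mu]_(x in K) (`|f x| `^ p)%:E < +oo)%E].

Variables mu nu : {measure set (borel R N) -> \bar R}.

(* Functions are not identified when mu-a.e. equal; both spaces below are
   saturated under that identification. *)

Definition meanval (f : borel R N -> R) (B : set (borel R N)) : R :=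
  (fine (mu B))^-1 * (\int[mu]_(y in B) f y)%R.

Definition poincare_space (p sigma : R) : set (borel R N -> R) :=
  [set f : borel R N -> R | Lp mu p f /\
    exists (g : borel R N -> R) (A : R),
      [/\ forall x, K x -> 0 <= g x, Lp nu p g, 1 <= A &
        forall (x : X) (r : R), K x -> 0 < r -> (r%:E < ediam K)%E ->
          let B : set (borel R N) := eball K x r in
          let AB : set (borel R N) := eball K x (A * r) in
          ((fine (mu B))^-1%:E * \int[mu]_(y in B) `|f y - meanval f B|%:E
           <= (r `^ sigma)%:E *
              ((fine (mu AB))^-1%:E *
                 \int[nu]_(y in AB) (g y `^ p)%:E) `^ p^-1)%E]].

Definition KS_space (p sigma : R) : set (borel R N -> R) :=
  [set f : borel R N -> R | Lp mu p f /\
    (limf_esup (fun eps : R =>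
       \int[mu]_(x in K)
         (let B : set (borel R N) := eball K x eps in
          (fine (mu B))^-1%:E *
          \int[mu]_(y in B) (`|f x - f y| `^ p / eps `^ (p * sigma))%:E))
       0^'+ < +oo)%E].

End FunctionSpaces.

(* Main.v *)
(* Part (1): chaining the Poincare inequality over a geometric sequence of balls
   around x bounds the distance of f x to its mean over a cell of level m by a
   sum of terms r^sigma (mu(B)^-1 int_B g^p dnu)^(1/p); since sigma > d/p the sum
   is dominated by its first term, and summing the p-th powers over the cells of
   level m gives the Korevaar-Schoen bound because cells overlap boundedly.

   Part (2), the converse inclusion for p = 2 and sigma = d_w/2: at scale L^-m
   the Korevaar-Schoen functional controls the discrete energy of the averages of
   f over the cells of level m, so f agrees almost everywhere with a continuous
   function F of finite energy.  By nondegeneracy the energy measure of F has a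
   density g^2 with respect to nu: for a piecewise harmonic function the energy
   on a cell is bounded by the Kusuoka measure of its preimage, whose image under
   phi_v is absolutely continuous because the inverses of the maps Mtilde_i are
   bounded; F is a rapidly converging sum of such functions.  Finally Property (P)
   puts two points at distance about L^-m into adjacent cells of level m, on which
   the oscillation of F is bounded by the square root of its energy. *)

Require Import Defs.
From HB Require Import structures.
From mathcomp Require Import lra ring measurable_realfun.

Set Implicit Arguments.
Unset Strict Implicit.
Unset Printing Implicit Defensive.

Local Open Scope classical_set_scope.
Local Open Scope ring_scope.

(** * Sequences and Euclidean distance *)

(** The measures mu and nu are never compared directly, although the Poincare inequality mixes them.
    Estimates are therefore made cell by cell; what makes sums over cells work for both measures is
    that distinct cells of one level meet inside the countable set [Vinf], which is null for mu and
    for nu.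

    From one level to the next, r^sigma gains a factor L^-sigma and mu(B)^(-1/p) a factor M^(1/p);
    their product is below 1 exactly when sigma > d/p. Since varrho > 1, d_w/2 exceeds d/2, so one
    inclusion of part (2) is the case p = 2 of part (1).

    For the converse no energy measure is constructed. It suffices to find one function whose
    nu-integral over each cell dominates the rescaled energy on that cell, and such upper bounds can
    be added along a series of piecewise harmonic functions. The exponent d_w is the one for which
    L^(-m d_w) = M^-m varrho^-m, the mass of a cell of level m times the scaling of its energy; this
    is why radii, masses and energies cancel in both directions. *)

Section RealSequences.
Context {R : realType}.
Implicit Types (u : nat -> R) (a b C q l : R).

Lemma expr_arbitrarily_small q e : 0 <= q -> q < 1 -> 0 < e ->
  exists m : nat, forall k, (m <= k)%N -> q ^+ k < e.
Proof.
move=> q0 q1 e0.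
have := @cvg_expr R q; rewrite ger0_norm // => /(_ q1) /cvgrPdist_lt /(_ e e0) [m _ H].
exists m => k mk; have := H k mk.
by rewrite sub0r normrN ger0_norm // exprn_ge0.
Qed.

Lemma le_of_geometric_error a b C q (m : nat) : 0 <= q -> q < 1 ->
  (forall k, (m <= k)%N -> a <= b + C * q ^+ k) -> a <= b.
Proof.
move=> q0 q1 H; apply/ler_addgt0Pr => e e0.
have D0 : 0 < e / (1 + `|C|) by rewrite divr_gt0 // ltr_wpDr.
have [n Hn] := expr_arbitrarily_small q0 q1 D0.
have {Hn} := Hn _ (leq_maxr m n).
have {H} := H _ (leq_maxl m n).
set t := q ^+ _ => H1 H2; have t0 : 0 <= t by exact: exprn_ge0.
have CC : 0 < 1 + `|C| by rewrite ltr_wpDr.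
rewrite (le_trans H1) // lerD2l.
rewrite ltr_pdivlMr // in H2.
apply: le_trans (ltW H2); rewrite mulrC ler_wpM2l //.
by rewrite (le_trans (ler_norm _)) // lerDr.
Qed.

(** The difference [q ^+ m - q ^+ (m + n)] is kept because it says that u k - D q^k is nondecreasing
    and u k + D q^k nonincreasing, with D = C / (1 - q); [geometric_limit] takes the supremum of the
    former as limit. *)
Lemma geometric_dist u C q (m n : nat) : 0 <= q -> q < 1 ->
  (forall k, (m <= k)%N -> `|u k - u k.+1| <= C * q ^+ k) ->
  `|u m - u (m + n)%N| <= C / (1 - q) * (q ^+ m - q ^+ (m + n)).
Proof.
move=> q0 q1 H; have q1' : 1 - q != 0 by rewrite subr_eq0 gt_eqF.
elim: n => [|n IH]; first by rewrite addn0 !subrr mulr0 normr0.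
rewrite addnS.
have -> : C / (1 - q) * (q ^+ m - q ^+ (m + n).+1) =
  C / (1 - q) * (q ^+ m - q ^+ (m + n)) + C * q ^+ (m + n).
  by rewrite exprS; field.
rewrite (le_trans _ (lerD IH (H (m + n)%N (leq_addr _ _)))) //.
exact: ler_distD.
Qed.

(** The constant [D] disappears from the conclusion: a crude global rate of convergence is improved
    to one governed by the increments alone. In [poincare_holder] the increments carry a local
    integral of g^p and [D] only a global one. *)
Lemma geometric_tail u C q l D (m : nat) : 0 <= C -> 0 <= q -> q < 1 ->
  (forall k, (m <= k)%N -> `|u k - u k.+1| <= C * q ^+ k) ->
  (forall k, (m <= k)%N -> `|u k - l| <= D * q ^+ k) ->
  `|u m - l| <= C / (1 - q) * q ^+ m.
Proof.
move=> C0 q0 q1 H Hl; apply: (@le_of_geometric_error _ _ D q m) => // k mk.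
rewrite (le_trans (ler_distD (u k) _ _)) // lerD ?Hl //.
have := geometric_dist (k - m) q0 q1 H; rewrite subnKC // => /le_trans; apply.
apply: ler_wpM2l; first by rewrite divr_ge0 // subr_ge0 ltW.
by rewrite lerBlDr lerDl exprn_ge0.
Qed.

Lemma geometric_limit u C q (m : nat) : 0 <= C -> 0 <= q -> q < 1 ->
  (forall k, (m <= k)%N -> `|u k - u k.+1| <= C * q ^+ k) ->
  exists l, forall k, (m <= k)%N -> `|u k - l| <= C / (1 - q) * q ^+ k.
Proof.
move=> C0 q0 q1 H; set D := C / (1 - q).
have D0 : 0 <= D by rewrite divr_ge0 // subr_ge0 ltW.
have H2 k n : (m <= k)%N -> `|u k - u (k + n)%N| <= D * (q ^+ k - q ^+ (k + n)).
  by move=> mk; apply: geometric_dist => // j kj; apply: H; exact: leq_trans kj.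
pose S := [set u k - D * q ^+ k | k in [set k | (m <= k)%N]].
have ub k : (m <= k)%N -> ubound S (u k + D * q ^+ k).
  move=> mk _ [j /= mj <-]; rewrite lerBlDr -addrA -mulrDr.
  have Dk := mulr_ge0 D0 (exprn_ge0 k q0); have Dj := mulr_ge0 D0 (exprn_ge0 j q0).
  have [jk|kj] := leqP j k.
    have := H2 j (k - j)%N mj; rewrite subnKC // => /ler_normlP[].
    rewrite mulrBr mulrDr; lra.
  have := H2 k (j - k)%N mk; rewrite subnKC 1?ltnW // => /ler_normlP[].
  rewrite mulrBr mulrDr; lra.
have hS : has_sup S.
  by split; [exists (u m - D * q ^+ m), m => //=|exists (u m + D * q ^+ m); exact: ub].
exists (sup S) => k mk.
have H3 : u k - D * q ^+ k <= sup S by apply: sup_upper_bound => //; exists k.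
have H4 : sup S <= u k + D * q ^+ k by apply: ge_sup; [case: hS|exact: ub].
by apply/ler_normlP; split; lra.
Qed.

(* Splitting off one increment at a time with (a + b)^2 <= s/(s-1) a^2 + s b^2
   keeps the geometric weights s^k under control. *)
Lemma telescope_sqr (T : Type) (N : T -> R) (rest inc : nat -> T) (s : R) n :
  1 < s ->
  (forall k, N (rest k) <= s / (s - 1) * N (inc k) + s * N (rest k.+1)) ->
  N (rest 0%N) <= s / (s - 1) * (\sum_(k < n) s ^+ k * N (inc k))
                  + s ^+ n * N (rest n).
Proof.
move=> s1 H; elim: n => [|n IH]; first by rewrite big_ord0 mulr0 add0r expr0 mul1r.
rewrite (le_trans IH) // big_ord_recr /= mulrDr -addrA lerD2l exprSr.
have := ler_wpM2l (exprn_ge0 n (le_trans ler01 (ltW s1))) (H n).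
by rewrite mulrDr [X in _ <= X + _ -> _]mulrCA [X in _ <= _ + X -> _]mulrA.
Qed.

Lemma sqr_addr_le (s a b : R) : 1 < s ->
  (a + b) ^+ 2 <= s / (s - 1) * a ^+ 2 + s * b ^+ 2.
Proof.
move=> s1; have s0 : s - 1 != 0 by rewrite subr_eq0 gt_eqF.
rewrite -subr_ge0.
have -> : s / (s - 1) * a ^+ 2 + s * b ^+ 2 - (a + b) ^+ 2 =
  (s - 1)^-1 * (a - (s - 1) * b) ^+ 2 by field.
by rewrite mulr_ge0 ?sqr_ge0 // invr_ge0 subr_ge0 ltW.
Qed.

End RealSequences.

Lemma cvg_sumR {R : realType} (T : Type) (F : set_system T) (I : Type)
    (r : seq I) (P : pred I) (f : I -> T -> R) (l : I -> R) : Filter F ->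
  (forall i, P i -> f i t @[t --> F] --> l i) ->
  (\sum_(i <- r | P i) f i t) @[t --> F] --> \sum_(i <- r | P i) l i.
Proof.
move=> FF H; elim: r => [|i r IH].
  under eq_cvg do rewrite big_nil.
  by rewrite big_nil; exact: cvg_cst.
under eq_cvg do rewrite big_cons; rewrite big_cons.
by case: ifPn => // Pi; apply: cvgD => //; exact: H.
Qed.

Section EuclideanDistance.
Context {R : realType} {N : nat}.
Local Notation X := 'rV[R]_N.
Implicit Types x y z : X.

Lemma dotp_ge0 x : 0 <= dotp x x.
Proof. by apply: sumr_ge0 => i _; rewrite -expr2 sqr_ge0. Qed.

Lemma dotp_comb_sqr (s t : R) x y :
  dotp (s *: x - t *: y) (s *: x - t *: y) =
  s ^+ 2 * dotp x x - 2 * s * t * dotp x y + t ^+ 2 * dotp y y.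
Proof.
rewrite /dotp !mulr_sumr -sumrB -big_split /=; apply: eq_bigr => i _.
by rewrite !mxE; ring.
Qed.

Lemma dotp_eq0 x : dotp x x = 0 -> x = 0.
Proof.
move=> H; apply/rowP => i; rewrite mxE; apply/eqP.
have /(_ i isT) : forall j, true -> x 0 j * x 0 j = 0.
  by apply: (psumr_eq0P _ H) => j _; rewrite -expr2 sqr_ge0.
by move/eqP; rewrite mulf_eq0 orbb.
Qed.

Lemma dotp_cauchy_schwarz x y : dotp x y ^+ 2 <= dotp x x * dotp y y.
Proof.
have := dotp_ge0 (dotp y y *: x - dotp x y *: y); rewrite dotp_comb_sqr => H.
have := dotp_ge0 y; rewrite le_eqVlt => /predU1P[/esym/dotp_eq0 ->|y0].
  suff -> : dotp x 0 = 0 by rewrite expr0n mulr_ge0 // dotp_ge0.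
  by apply: big1 => i _; rewrite mxE mulr0.
rewrite -subr_ge0 -(pmulr_rge0 _ y0); apply: le_trans H _.
by rewrite le_eqVlt; apply/orP; left; apply/eqP; ring.
Qed.

Lemma edist_ge0 x y : 0 <= edist x y.
Proof. exact: sqrtr_ge0. Qed.

Lemma edistxx x : edist x x = 0.
Proof.
by rewrite /edist subrr [dotp _ _]big1 ?sqrtr0 // => i _; rewrite mxE mulr0.
Qed.

Lemma edistC x y : edist x y = edist y x.
Proof.
by rewrite /edist; congr Num.sqrt; apply: eq_bigr => i _; rewrite !mxE; ring.
Qed.

Lemma edist_eq0 x y : edist x y = 0 -> x = y.
Proof.
move/eqP; rewrite sqrtr_eq0 => H; apply/eqP; rewrite -subr_eq0; apply/eqP.
by apply: dotp_eq0; apply/eqP; rewrite eq_le H dotp_ge0.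
Qed.

Lemma edist_triangle y x z : edist x z <= edist x y + edist y z.
Proof.
rewrite /edist; set u := x - y; set v := y - z.
have -> : x - z = 1 *: u - (-1) *: v by apply/rowP => i; rewrite !mxE; ring.
rewrite -ler_sqr ?nnegrE ?addr_ge0 ?sqrtr_ge0 // sqr_sqrtr ?dotp_ge0 //.
rewrite dotp_comb_sqr sqrrD !sqr_sqrtr ?dotp_ge0 //.
have : dotp u v <= Num.sqrt (dotp u u) * Num.sqrt (dotp v v).
  rewrite -sqrtrM ?dotp_ge0 // (le_trans (ler_norm _)) // -sqrtr_sqr.
  by rewrite ler_wsqrtr // dotp_cauchy_schwarz.
rewrite -mulr_natl; lra.
Qed.

Lemma edist_coord x y i : `|x 0 i - y 0 i| <= edist x y.
Proof.
rewrite -sqrtr_sqr ler_wsqrtr // /dotp (bigD1 i) //= !mxE -expr2 lerDl.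
by apply: sumr_ge0 => j _; rewrite -expr2 sqr_ge0.
Qed.

Lemma continuous_edist x : continuous (edist x : X -> R).
Proof.
move=> y; apply: (@continuous_comp _ _ _ (fun z : X => dotp (x - z) (x - z)) (@Num.sqrt R));
  last exact: sqrt_continuous.
have cc (i : 'I_N) : {for y, continuous (fun z : X => (x - z) 0 i : R)}.
  have -> : (fun z : X => (x - z) 0 i) = (fun z : X => x 0 i - z 0 i).
    by apply/funext => z; rewrite !mxE.
  apply: (@continuousB _ _ _ (fun=> x 0 i) (fun z : X => z 0 i)).
    exact: cst_continuous.
  exact: coord_continuous.
by apply: (@cvg_sumR _ _ (nbhs y)) => i _; apply: continuousM; exact: cc.
Qed.

(** Link between the topology of the sup-norm and Euclidean balls: coordinates are 1-Lipschitz for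
    [edist], and conversely [edist x] is continuous. *)
Lemma nbhs_edist x (A : set X) :
  nbhs x A <-> exists2 e, 0 < e & forall y, edist x y < e -> A y.
Proof.
split.
  move=> /nbhs_ballP[e /= e0 H]; exists e => // y xy; apply: H.
  split=> // i j; rewrite ord1; exact: le_lt_trans (edist_coord _ _ _) xy.
move=> [e e0 H]; have : nbhs x (edist x @^-1` [set r | r < e]).
  apply: continuous_edist; apply: open_nbhs_nbhs; split; first exact: open_lt.
  by rewrite /= edistxx.
by apply: filterS => y; exact: H.
Qed.

Lemma closed_edist_le x r : closed [set y | edist x y <= r].
Proof.
have -> : [set y | edist x y <= r] = edist x @^-1` [set t | t <= r] by [].
by apply: preimage_closed; [move=> y _; exact: continuous_edist|exact: closed_le].
Qed.

Lemma edist_continuousP (T : topologicalType) (f : X -> T) (K : set X) :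
  {within K, continuous f} <-> forall x, K x -> forall A, nbhs (f x) A ->
    exists2 e, 0 < e & forall y, K y -> edist x y < e -> A (f y).
Proof.
split.
  move=> /subspace_continuousP H x Kx A /(H x Kx); rewrite /= nbhs_simpl /within /=.
  move=> /nbhs_edist[e e0 He]; exists e => // y Ky xy.
  by apply: He.
move=> H; apply/subspace_continuousP => x Kx A /(H x Kx)[e e0 He].
by rewrite /= nbhs_simpl /within /=; apply/nbhs_edist; exists e => // y xy Ky; apply: He.
Qed.

Lemma ediam_le (A : set X) (r : R) : 0 <= r ->
  (forall x y, A x -> A y -> edist x y <= r) -> (ediam A <= r%:E)%E.
Proof.
move=> r0 H; apply: ge_ereal_sup => _ [->|[[x y] /= [Ax Ay] <-]].
  by rewrite lee_fin.
by rewrite lee_fin H.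
Qed.

Lemma ediam_ge0 (A : set X) : (0 <= ediam A)%E.
Proof. by apply: ereal_sup_ubound; left. Qed.

Lemma edist_ediam (A : set X) x y : A x -> A y -> ((edist x y)%:E <= ediam A)%E.
Proof. by move=> Ax Ay; apply: ereal_sup_ubound; right; exists (x, y). Qed.

End EuclideanDistance.

(** * Borel measurability of closed sets and continuous maps *)

Section BorelMeasurability.
Context {R : realType} {N : nat}.
Local Notation X := 'rV[R]_N.

Lemma open_borel (A : set X) : open A -> measurable (A : set (borel R N)).
Proof. by move=> oA; exact: sub_sigma_algebra. Qed.

Lemma closed_borel (A : set X) : closed A -> measurable (A : set (borel R N)).
Proof.
by move=> cA; rewrite -(setCK A); apply: measurableC; apply: open_borel; exact: closed_openC.
Qed.

Lemma continuous_within_measurable (K : set X) (f : X -> R) : closed K ->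
  {within K, continuous f} -> measurable_fun (K : set (borel R N)) (f : borel R N -> R).
Proof.
move=> cK /continuousP cf; apply: (measurability _ (measurable_realfun.RGenOpens.measurableE R)).
move=> _ [_ [a [b ->] <-]].
have oab : open (`]a, b[%classic : set R) by exact: interval_open.
have [V oV HV] := (open_subspaceP _ _).1 (cf _ oab).
rewrite setIC -HV; apply: measurableI; [exact: open_borel|exact: closed_borel].
Qed.

Lemma continuous_borel (f : X -> X) : continuous f ->
  measurable_fun (setT : set (borel R N)) (f : borel R N -> borel R N).
Proof.
move=> /continuousP cf; apply: (@measurability _ _ (borel R N) (borel R N) _ _ (@open X)) => //.
move=> _ [A oA <-]; rewrite setTI; apply: open_borel; exact: cf.
Qed.

End BorelMeasurability.

(** * Cells of the fractal *)

Section Cells.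
Context {R : realType} {N M : nat} {L : R} {phi : 'I_M -> 'rV[R]_N -> 'rV[R]_N}
  {K : set 'rV[R]_N}.
Hypothesis nf : nested_fractal phi L K.
Local Notation X := 'rV[R]_N.
Implicit Types (w u : seq 'I_M) (x y : X) (i : 'I_M).

Lemma scale_gt0 : 0 < L.
Proof. exact: lt_trans ltr01 (nf_scale nf). Qed.

Lemma scaleV_ge0 : 0 <= L^-1.
Proof. by rewrite invr_ge0 ltW // scale_gt0. Qed.

Lemma scaleV_lt1 : L^-1 < 1.
Proof. by rewrite invf_lt1 ?scale_gt0 // (nf_scale nf). Qed.

Lemma phiw_cat w u x : phiw phi (w ++ u) x = phiw phi w (phiw phi u x).
Proof. by rewrite /phiw foldr_cat. Qed.

Lemma phiw_rcons w i x : phiw phi (rcons w i) x = phiw phi w (phi i x).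
Proof. by rewrite -cats1 phiw_cat. Qed.

Lemma edist_phiw w x y :
  edist (phiw phi w x) (phiw phi w y) = L^-1 ^+ size w * edist x y.
Proof.
elim: w => [|i w IH] /=; first by rewrite mul1r.
by rewrite (nf_similitude nf) IH exprS mulrA.
Qed.

Lemma phiw_inj w : injective (phiw phi w).
Proof.
move=> x y H; apply: edist_eq0; apply/eqP.
have := edist_phiw w x y; rewrite H edistxx => /esym/eqP.
by rewrite mulf_eq0 expf_eq0 invr_eq0 (gt_eqF scale_gt0) andbF.
Qed.

Lemma continuous_phiw w : continuous (phiw phi w).
Proof.
move=> x A /nbhs_edist[e e0 H]; apply/nbhs_edist; exists e => // y xy; apply: H.
rewrite edist_phiw (le_lt_trans _ xy) // ler_piMl ?edist_ge0 //.
by rewrite exprn_ile1 ?scaleV_ge0 // ltW // scaleV_lt1.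
Qed.

Lemma phi_K i x : K x -> K (phi i x).
Proof. by move=> Kx; rewrite (nf_invariant nf); exists i => //; exists x. Qed.

Lemma phiw_K w x : K x -> K (phiw phi w x).
Proof. by move=> Kx; elim: w => [|i w IH] //=; exact: phi_K. Qed.

Lemma cell_nil : cell phi K [::] = K.
Proof. by apply/seteqP; split=> [_ [x Kx <-]|x Kx] //; exists x. Qed.

Lemma cell_sub_K w : cell phi K w `<=` K.
Proof. by move=> _ [x Kx <-]; exact: phiw_K. Qed.

Lemma cell_cat_sub w u : cell phi K (w ++ u) `<=` cell phi K w.
Proof. by move=> _ [x Kx <-]; rewrite phiw_cat; exists (phiw phi u x) => //; exact: phiw_K. Qed.

Lemma cell_rcons_sub w i : cell phi K (rcons w i) `<=` cell phi K w.
Proof. by rewrite -cats1; exact: cell_cat_sub. Qed.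

Lemma cell_rcons_ex w x : cell phi K w x -> exists i, cell phi K (rcons w i) x.
Proof.
move=> [y Ky <-]; move: Ky; rewrite [in K y](nf_invariant nf) => -[i _ [z Kz <-]].
by exists i, z => //; rewrite phiw_rcons.
Qed.

Lemma cell_ex m x : K x -> exists2 w, size w = m & cell phi K w x.
Proof.
move=> Kx; elim: m => [|m [w sw wx]]; first by exists [::]; rewrite ?cell_nil.
have [i ix] := cell_rcons_ex wx; exists (rcons w i) => //.
by rewrite size_rcons sw.
Qed.

Lemma K_diam x y : K x -> K y -> edist x y <= 1.
Proof. by move=> Kx Ky; rewrite -lee_fin -(nf_diam nf); exact: edist_ediam. Qed.

Lemma cell_diam w x y : cell phi K w x -> cell phi K w y ->
  edist x y <= L^-1 ^+ size w.
Proof.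
move=> [x' Kx <-] [y' Ky <-]; rewrite edist_phiw -[leRHS]mulr1 ler_wpM2l //.
  by rewrite exprn_ge0 // scaleV_ge0.
exact: K_diam.
Qed.

Lemma K_closed : closed K.
Proof. exact: compact_closed (@norm_hausdorff _ _) (nf_compact nf). Qed.

Lemma cell_compact w : compact (cell phi K w).
Proof.
apply: continuous_compact; last exact: nf_compact nf.
by apply: continuous_subspaceT => x; exact: continuous_phiw.
Qed.

Lemma cell_closed w : closed (cell phi K w).
Proof. exact: compact_closed (@norm_hausdorff _ _) (@cell_compact w). Qed.

Lemma measurable_cell w : measurable (cell phi K w : set (borel R N)).
Proof. exact: closed_borel (@cell_closed w). Qed.

Lemma measurable_K : measurable (K : set (borel R N)).
Proof. exact: closed_borel K_closed. Qed.

Lemma fixed_point_unique i x y : phi i x = x -> phi i y = y -> x = y.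
Proof.
move=> Hx Hy; apply: edist_eq0; apply/eqP.
have := nf_similitude nf i x y; rewrite Hx Hy => /eqP.
rewrite -subr_eq0 -{1}[edist x y]mul1r -mulrBl mulf_eq0 subr_eq0.
by rewrite (gt_eqF scaleV_lt1).
Qed.

Lemma phiw_nseq i v k : phi i v = v -> phiw phi (nseq k i) v = v.
Proof. by move=> H; elim: k => //= k ->. Qed.

(** Iterating phi_i from any point of K stays in K and converges to v. *)
Lemma fixed_point_K i v : phi i v = v -> K v.
Proof.
move=> Hv; have [x Kx] := nf_nonempty nf.
apply: K_closed => A /nbhs_edist[e e0 H].
have D0 : 0 < e / (1 + edist v x) by rewrite divr_gt0 // ltr_wpDr // edist_ge0.
have [m /(_ m (leqnn _)) Hm] := expr_arbitrarily_small scaleV_ge0 scaleV_lt1 D0.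
exists (phiw phi (nseq m i) x); split; first exact: phiw_K.
apply: H; rewrite -{1}(phiw_nseq m Hv) edist_phiw size_nseq.
rewrite ltr_pdivlMr ?ltr_wpDr ?edist_ge0 // in Hm.
apply: le_lt_trans Hm; rewrite ler_wpM2l ?exprn_ge0 ?scaleV_ge0 //.
by rewrite lerDr.
Qed.

Lemma V0_fix v : V0 phi v -> exists i, phi i v = v.
Proof. by case. Qed.

Lemma V0_K v : V0 phi v -> K v.
Proof. by move=> /V0_fix[i /fixed_point_K]. Qed.

Lemma V0_finite : finite_set (V0 phi).
Proof.
apply: (@sub_finite_set _ _ (\bigcup_(i in [set: 'I_M]) [set x | phi i x = x])).
  by move=> x [[i Hi] _]; exists i.
apply: bigcup_finite => [|i _]; first exact: finite_finset.
have [[x Hx]|H] := pselect (exists x, phi i x = x).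
  apply: (@sub_finite_set _ _ [set x]) => // y Hy; exact: fixed_point_unique Hy Hx.
by apply: (@sub_finite_set _ _ set0) => // y Hy; apply: H; exists y.
Qed.

Lemma Vinf_ex x : Vinf phi x -> exists w v, V0 phi v /\ x = phiw phi w v.
Proof.
move=> [m _]; elim: m x => [|m IH] x /=; first by exists [::], x.
by move=> [i _ [y /IH[w [v [Vv ->]]] <-]]; exists (i :: w), v.
Qed.

Lemma Vinf_phiw w v : V0 phi v -> Vinf phi (phiw phi w v).
Proof.
move=> Vv; exists (size w) => //; elim: w => [|i w IH] //=.
by exists i => //; exists (phiw phi w v).
Qed.

Lemma Vinf_countable : countable (Vinf phi).
Proof.
have H : Vinf phi `<=` \bigcup_(w in [set: seq 'I_M]) (phiw phi w @` V0 phi).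
  by move=> x /Vinf_ex[w [v [Vv ->]]]; exists w => //; exists v.
apply: sub_countable (subset_card_le H) _.
apply: bigcup_countable => [|w _]; first exact: countableP.
by apply: finite_set_countable; apply: finite_image; exact: V0_finite.
Qed.

Lemma V0_cell w v : V0 phi v -> cell phi K w (phiw phi w v).
Proof. by move=> Vv; exists v => //; exact: V0_K. Qed.

(* Only finitely many cells of level m exist, and they are closed. *)
Lemma close_points_share_cell m x : K x -> exists2 e, 0 < e &
  forall y, K y -> edist x y < e ->
    exists w, [/\ size w = m, cell phi K w x & cell phi K w y].
Proof.
move=> Kx.
pose B := \bigcup_(w in [set w : m.-tuple 'I_M | ~ cell phi K w x]) cell phi K w.
have cB : closed B.
  apply: closed_bigcup => [|w _]; last exact: cell_closed.
  exact: finite_finset.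
have nB : ~ B x by move=> [w].
have /nbhs_edist[e e0 H] : nbhs x (~` B).
  by apply: open_nbhs_nbhs; split; [exact: closed_openC|].
exists e => // y Ky xy; have [w sw wy] := cell_ex m Ky.
exists w; split => //; apply: contrapT => nx; apply: (H y xy).
by exists (tcast sw (in_tuple w)); rewrite /= val_tcast.
Qed.

End Cells.

(** * Continuous functions obtained from values on cells *)

Section CellLimit.
Context {R : realType} {N M : nat} {L : R} {phi : 'I_M -> 'rV[R]_N -> 'rV[R]_N}
  {K : set 'rV[R]_N}.
Hypothesis nf : nested_fractal phi L K.
Local Notation X := 'rV[R]_N.
Implicit Types (w u : seq 'I_M) (x y : X) (i : 'I_M).

Lemma rcons_size_ex (T : Type) (s : seq T) k : size s = k.+1 ->
  exists t a, s = rcons t a /\ size t = k.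
Proof.
case/lastP: s => // t a; rewrite size_rcons => -[<-]; by exists t, a.
Qed.

(** The chosen cells around x need not be nested. So [ww k] is first compared with the parent of
    [ww k.+1], which is another cell of level k containing x, and then the parent with its child;
    hence the factor 2. *)
Lemma cell_steps (c : seq 'I_M -> R) (C q : R) m0 x (ww : nat -> seq 'I_M) :
  (forall w i, (m0 <= size w)%N -> cell phi K (rcons w i) x ->
    `|c w - c (rcons w i)| <= C * q ^+ size w) ->
  (forall w w', (m0 <= size w)%N -> size w = size w' ->
    cell phi K w x -> cell phi K w' x -> `|c w - c w'| <= C * q ^+ size w) ->
  (forall k, size (ww k) = k /\ cell phi K (ww k) x) ->
  forall k, (m0 <= k)%N -> `|c (ww k) - c (ww k.+1)| <= 2 * C * q ^+ k.
Proof.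
move=> H1 H2 Hw k mk; have [sk xk] := Hw k; have [sk1 xk1] := Hw k.+1.
have [u [i [E su]]] := rcons_size_ex sk1.
have xu : cell phi K u x by move: xk1; rewrite E; exact: (cell_rcons_sub nf).
rewrite (le_trans (ler_distD (c u) _ _)) //.
have -> : 2 * C * q ^+ k = C * q ^+ k + C * q ^+ k by ring.
apply: lerD; first by rewrite -[in leRHS]sk H2 // ?sk // su.
by rewrite E -[in leRHS]su H1 ?su // -E.
Qed.

(* A function on cells which varies geometrically little between a cell and its
   children and between cells of the same level that meet determines a
   continuous function on K. *)
Lemma cell_limit (c : seq 'I_M -> R) (C q : R) m0 : 0 <= C -> 0 <= q -> q < 1 ->
  (forall w i, (m0 <= size w)%N -> `|c w - c (rcons w i)| <= C * q ^+ size w) ->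
  (forall w w', (m0 <= size w)%N -> size w = size w' ->
    (cell phi K w `&` cell phi K w') !=set0 -> `|c w - c w'| <= C * q ^+ size w) ->
  exists2 F : X -> R, {within K, continuous F} &
    forall w x, (m0 <= size w)%N -> cell phi K w x ->
      `|c w - F x| <= C * (1 + 2 / (1 - q)) * q ^+ size w.
Proof.
move=> C0 q0 q1 H1 H2.
have /choice[ww Hww] : forall x, exists s : nat -> seq 'I_M,
    K x -> forall k, size (s k) = k /\ cell phi K (s k) x.
  move=> x; have [Kx|nK] := pselect (K x); last by exists (fun=> [::]).
  have /choice[s Hs] : forall k, exists w, size w = k /\ cell phi K w x.
    by move=> k; have [w] := cell_ex nf k Kx; exists w.
  by exists s => _.
have /choice[F HF] : forall x, exists l, K x ->
    forall k, (m0 <= k)%N -> `|c (ww x k) - l| <= 2 * C / (1 - q) * q ^+ k.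
  move=> x; have [Kx|nK] := pselect (K x); last by exists 0.
  have [l Hl] : exists l, forall k, (m0 <= k)%N ->
      `|c (ww x k) - l| <= 2 * C / (1 - q) * q ^+ k.
    apply: (@geometric_limit _ (fun k => c (ww x k))) => //; first by rewrite mulr_ge0.
    apply: (@cell_steps _ _ _ _ x) => [w i mw _|w w' mw ww' xw xw'|]; first exact: H1.
      by apply: H2 => //; exists x.
    exact: Hww.
  by exists l.
have E w x : (m0 <= size w)%N -> cell phi K w x ->
    `|c w - F x| <= C * (1 + 2 / (1 - q)) * q ^+ size w.
  move=> mw wx; have Kx := cell_sub_K nf wx.
  rewrite (le_trans (ler_distD (c (ww x (size w))) _ _)) //.
  have -> : C * (1 + 2 / (1 - q)) * q ^+ size w =
    C * q ^+ size w + 2 * C / (1 - q) * q ^+ size w by ring.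
  rewrite lerD ?HF // H2 //; first by rewrite (Hww x Kx _).1.
  by exists x; split => //; exact: (Hww x Kx _).2.
exists F => //; apply/edist_continuousP => x Kx A /nbhs_ballP[e /= e0 He].
set D := C * (1 + 2 / (1 - q)) in E.
have D0 : 0 <= D by rewrite mulr_ge0 // addr_ge0 // divr_ge0 // subr_ge0 ltW.
clearbody D.
have d0 : 0 < e / (1 + 2 * D) by rewrite divr_gt0 // ltr_wpDr // mulr_ge0.
have [m Hm] := expr_arbitrarily_small q0 q1 d0.
have {}Hm := Hm _ (leq_maxl m m0); set k := maxn m m0 in Hm.
have mk : (m0 <= k)%N by exact: leq_maxr.
have [r r0 Hr] := close_points_share_cell nf k Kx.
exists r => // y Ky xy; apply: He; have [w [sw wx wy]] := Hr y Ky xy.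
rewrite /ball /= (le_lt_trans (ler_distD (c w) _ _)) //.
rewrite ltr_pdivlMr ?ltr_wpDr ?mulr_ge0 // in Hm.
rewrite -sw in mk Hm; have h1 := E w x mk wx; have h2 := E w y mk wy.
rewrite distrC in h1; have := exprn_ge0 (size w) q0; lra.
Qed.

End CellLimit.

(** * The normalized Hausdorff measure *)

Section HausdorffPremeasure.
Context {R : realType} {N : nat}.
Local Notation X := 'rV[R]_N.
Implicit Types (A B : set X) (s delta : R).
Local Open Scope ereal_scope.

Lemma ediam0 : ediam (@set0 X) = 0.
Proof. by apply/eqP; rewrite eq_le ediam_ge0 andbT; apply: ediam_le. Qed.

Lemma ge0_le_poweR (r : R) (x y : \bar R) : (0 <= r)%R -> 0 <= x -> x <= y ->
  x `^ r <= y `^ r.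
Proof.
move=> r0 x0 xy; apply: gt0_ler_poweR => //; rewrite in_itv /= leey andbT //.
exact: le_trans xy.
Qed.

Lemma hausdorff_pre_ge0 s delta A : 0 <= hausdorff_pre s delta A.
Proof.
apply: le_ereal_inf_tmp => _ [U _ <-].
by apply: nneseries_ge0 => k _ _; exact: poweR_ge0.
Qed.

Lemma hausdorff_pre_subset s delta A B : A `<=` B ->
  hausdorff_pre s delta A <= hausdorff_pre s delta B.
Proof.
move=> AB; apply: ereal_inf_le_tmp => _ [U [BU Ud] <-].
by exists U => //; split => //; exact: subset_trans BU.
Qed.

Lemma hausdorff_pre_mesh s delta delta' A : (delta <= delta')%R ->
  hausdorff_pre s delta' A <= hausdorff_pre s delta A.
Proof.
move=> dd; apply: ereal_inf_le_tmp => _ [U [AU Ud] <-].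
by exists U => //; split => // k; rewrite (le_trans (Ud k)) // lee_fin.
Qed.

(** Cost of merging two countable covers into one, by parity of the index. *)
Lemma nneseries_interleave (f g : nat -> \bar R) :
  (forall k, 0 <= f k) -> (forall k, 0 <= g k) ->
  \sum_(0 <= k <oo) (if odd k then g k./2 else f k./2)
  <= \sum_(0 <= k <oo) f k + \sum_(0 <= k <oo) g k.
Proof.
move=> f0 g0; pose h k := if odd k then g k./2 else f k./2.
have h0 k : 0 <= h k by rewrite /h; case: odd.
have E n : \sum_(0 <= k < n.*2) h k = \sum_(0 <= k < n) f k + \sum_(0 <= k < n) g k.
  elim: n => [|n IH]; first by rewrite double0 !big_nil adde0.
  rewrite doubleS !big_nat_recr //= IH /h /= odd_double /= uphalf_double doubleK.
  by rewrite addeACA addeA.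
apply: lime_le; first by apply: is_cvg_nneseries => k _ _; exact: h0.
apply: nearW => n; apply: (@le_trans _ _ (\sum_(0 <= k < n.*2) h k)).
  apply: lee_sum_nneg_natr => // [k _ _|]; first exact: h0.
  by rewrite -addnn leq_addr.
rewrite E; apply: leeD; apply: nneseries_lim_ge => k _ _; by [exact: f0|exact: g0].
Qed.

Lemma hausdorff_preU s delta A B :
  hausdorff_pre s delta (A `|` B)
  <= hausdorff_pre s delta A + hausdorff_pre s delta B.
Proof.
have [->|Afin] := eqVneq (hausdorff_pre s delta A) +oo.
  by rewrite addye ?leey // gt_eqF // (lt_le_trans _ (hausdorff_pre_ge0 _ _ _)) // ltNy0.
have [->|Bfin] := eqVneq (hausdorff_pre s delta B) +oo.
  by rewrite addey ?leey // gt_eqF // (lt_le_trans _ (hausdorff_pre_ge0 _ _ _)) // ltNy0.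
have fin (C : set X) : hausdorff_pre s delta C != +oo -> hausdorff_pre s delta C \is a fin_num.
  move=> C1; rewrite fin_numE C1 andbT gt_eqF //.
  by rewrite (lt_le_trans _ (hausdorff_pre_ge0 _ _ _)) // ltNy0.
apply/lee_addgt0Pr => e e0.
have e2 : (0 < e / 2)%R by rewrite divr_gt0.
have [_ [U [AU Ud] <-] HU] := lb_ereal_inf_adherent e2 (fin _ Afin).
have [_ [V [BV Vd] <-] HV] := lb_ereal_inf_adherent e2 (fin _ Bfin).
have -> : e%:E = (e / 2)%:E + (e / 2)%:E by rewrite -EFinD -splitr.
rewrite addeACA; apply: le_trans (leeD (ltW HU) (ltW HV)).
pose W k := if odd k then V k./2 else U k./2.
apply: (@le_trans _ _ (\sum_(0 <= k <oo) ediam (W k) `^ s)).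
  apply: ereal_inf_lbound; exists W => //; split => [x [/AU|/BV][k _ kx]|k].
  - by exists k.*2 => //; rewrite /W odd_double doubleK.
  - by exists k.*2.+1 => //; rewrite /W /= odd_double /= uphalf_double.
  - by rewrite /W; case: odd.
apply: le_trans (nneseries_interleave _ _); last 2 first.
- by move=> k; exact: poweR_ge0.
- by move=> k; exact: poweR_ge0.
by apply: lee_nneseries => [k _ _|k _]; [exact: poweR_ge0|rewrite /W; case: odd].
Qed.

(** The condition [s != 0] makes an empty set cost 0 in a cover, as 0 to the power 0 is 1. *)
Lemma hausdorff_pre_bigcup s delta (I : finType) (A : I -> set X) (P : set X) :
  (s != 0)%R -> (0 <= delta)%R -> P `<=` \bigcup_(i in [set: I]) A i ->
  hausdorff_pre s delta P <= \sum_(i : I) hausdorff_pre s delta (A i).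
Proof.
move=> s0 d0 HP.
have H (r : seq I) : hausdorff_pre s delta (\big[setU/set0]_(i <- r) A i)
    <= \sum_(i <- r) hausdorff_pre s delta (A i).
  elim: r => [|i r IH].
    rewrite !big_nil; apply: ge_ereal_inf; exists 0 => //; exists (fun=> set0).
      by split=> // k; rewrite ediam0 lee_fin.
    by apply: eseries0 => k _ _; rewrite ediam0 poweR0r.
  rewrite !big_cons; apply: le_trans (hausdorff_preU _ _ _ _) _.
  by rewrite leeD2l.
apply: le_trans (H _); apply: hausdorff_pre_subset => x /HP[i _ Ai].
by rewrite -bigcup_seq; exists i => //=; rewrite mem_index_enum.
Qed.

Lemma hausdorff_pre_diam s delta A : (s != 0)%R -> (0 <= delta)%R ->
  ediam A <= delta%:E -> hausdorff_pre s delta A <= ediam A `^ s.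
Proof.
move=> s0 d0 Ad.
apply: ge_ereal_inf; exists (ediam A `^ s) => //.
exists (fun k => if k == 0%N then A else set0).
  split=> [x Ax|[|k]] //=; first by exists 0%N.
  by rewrite ediam0 lee_fin.
rewrite (@nneseries_split _ _ 0 1) => [|k _]; last exact: poweR_ge0.
rewrite big_nat1 eseries0 ?adde0 // => -[|k] // _ _.
by rewrite ediam0 poweR0r.
Qed.

End HausdorffPremeasure.

(** * Scaling of the Hausdorff measure under the similitudes *)

Section FractalMeasure.
Context {R : realType} {N M : nat} {L : R} {phi : 'I_M -> 'rV[R]_N -> 'rV[R]_N}
  {K : set 'rV[R]_N}.
Hypothesis nf : nested_fractal phi L K.
Local Notation X := 'rV[R]_N.
Local Notation d := (hausdorff_dim M L).
Implicit Types (w u : seq 'I_M) (x y : X) (i : 'I_M).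

Lemma card_gt0 : 0 < M%:R :> R.
Proof. by rewrite ltr0n (leq_trans _ (nf_card nf)). Qed.

Lemma card_neq0 : M%:R != 0 :> R.
Proof. by rewrite gt_eqF // card_gt0. Qed.

Lemma cardV_ge0 : 0 <= M%:R^-1 :> R.
Proof. by rewrite invr_ge0 ltW // card_gt0. Qed.

Lemma lnL_gt0 : 0 < ln L.
Proof. by rewrite ln_gt0 // (nf_scale nf). Qed.

Lemma hausdorff_dim_gt0 : 0 < d.
Proof.
rewrite divr_gt0 ?lnL_gt0 // ln_gt0 // ltr1n.
exact: nf_card nf.
Qed.

Lemma powR_scale (t : R) : (L^-1 `^ t) = expR (- (t * ln L)).
Proof.
rewrite /powR gt_eqF ?invr_gt0 ?(scale_gt0 nf) // lnV ?posrE ?(scale_gt0 nf) //.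
by rewrite mulrN.
Qed.

Lemma powR_scale_dim : L^-1 `^ d = M%:R^-1.
Proof.
rewrite powR_scale /hausdorff_dim divfK; last by rewrite gt_eqF // lnL_gt0.
by rewrite expRN lnK // posrE card_gt0.
Qed.

Local Open Scope ereal_scope.

Lemma ediam_phi i (A : set X) : ediam (phi i @` A) <= L^-1%:E * ediam A.
Proof.
apply: ge_ereal_sup => _ [->|[[_ _] /= [[x Ax <-] [y Ay <-]] <-]].
  by rewrite mule_ge0 ?ediam_ge0 // lee_fin (scaleV_ge0 nf).
rewrite (nf_similitude nf) EFinM lee_wpmul2l ?lee_fin ?(scaleV_ge0 nf) //.
exact: edist_ediam.
Qed.

(** The image of a cover has diameters multiplied by L^-1, and d is the exponent with L^-d = 1/M.
    Consequently the M images of a cover of K cost together no more than that cover. *)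
Lemma hausdorff_pre_phi i delta (A : set X) :
  hausdorff_pre d (L^-1 * delta) (phi i @` A)
  <= M%:R^-1%:E * hausdorff_pre d delta A.
Proof.
rewrite lee_pdivlMl ?card_gt0 //.
apply: le_ereal_inf_tmp => _ [U [AU Ud] <-].
rewrite -lee_pdivlMl ?card_gt0 //.
apply: (@le_trans _ _ (\sum_(0 <= k <oo) ediam (phi i @` U k) `^ d)).
  apply: ereal_inf_lbound; exists (fun k => phi i @` U k) => //; split.
    by move=> _ [x /AU[k _ Ukx] <-]; exists k => //; exists x.
  move=> k; apply: le_trans (ediam_phi _ _) _.
  by rewrite EFinM lee_wpmul2l ?lee_fin ?(scaleV_ge0 nf).
rewrite -nneseriesZl => [|k _]; last exact: poweR_ge0.
apply: lee_nneseries => [k _ _|k _]; first exact: poweR_ge0.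
rewrite -powR_scale_dim -poweR_EFin -poweRM ?ediam_ge0 ?lee_fin ?(scaleV_ge0 nf) //.
apply: ge0_le_poweR; [exact: ltW hausdorff_dim_gt0|exact: ediam_ge0|].
exact: ediam_phi.
Qed.

Lemma hausdorff_pre_K delta : (0 < delta)%R ->
  hausdorff_pre d (L^-1 * delta) K <= hausdorff_pre d delta K.
Proof.
move=> d0.
apply: (@le_trans _ _ (\sum_(i < M) hausdorff_pre d (L^-1 * delta) (phi i @` K))).
  apply: hausdorff_pre_bigcup.
  - by rewrite gt_eqF // hausdorff_dim_gt0.
  - by rewrite mulr_ge0 ?(scaleV_ge0 nf) ?ltW.
  - by rewrite [in X in X `<=` _](nf_invariant nf).
apply: (@le_trans _ _ (\sum_(i < M) M%:R^-1%:E * hausdorff_pre d delta K)).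
  by apply: lee_sum => i _; exact: hausdorff_pre_phi.
rewrite -ge0_sume_distrl; last by move=> i _; rewrite lee_fin cardV_ge0.
have E : (\sum_(i < M) M%:R^-1 = 1 :> R)%R.
  by rewrite sumr_const card_ord -[LHS]mulr_natr mulVf // card_neq0.
by rewrite sumEFin E mul1e.
Qed.

(* Covers of K can be refined to arbitrarily small mesh at no cost by applying
   the similitudes, so the premeasure of K does not depend on the mesh. *)
Lemma hausdorff_measure_K delta : (0 < delta)%R ->
  hausdorff_measure d K <= hausdorff_pre d delta K.
Proof.
move=> d0; apply: ge_ereal_sup => _ [e /= e0 <-].
have H k : hausdorff_pre d (L^-1 ^+ k * delta) K <= hausdorff_pre d delta K.
  elim: k => [|k IH]; first by rewrite mul1r.
  apply: le_trans IH; rewrite exprS -mulrA hausdorff_pre_K //.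
  by rewrite mulr_gt0 // exprn_gt0 // invr_gt0 (scale_gt0 nf).
have D0 : (0 < e / delta)%R by rewrite divr_gt0.
have [m /(_ m (leqnn _))] := expr_arbitrarily_small (scaleV_ge0 nf) (scaleV_lt1 nf) D0.
rewrite ltr_pdivlMr // => Hm; apply: le_trans (H m).
by apply: hausdorff_pre_mesh; exact: ltW.
Qed.

Lemma hausdorff_measure_phi i (A : set X) :
  hausdorff_measure d (phi i @` A) <= M%:R^-1%:E * hausdorff_measure d A.
Proof.
apply: ge_ereal_sup => _ [e /= e0 <-].
have -> : e = (L^-1 * (L * e))%R by rewrite mulKf // gt_eqF // (scale_gt0 nf).
apply: le_trans (hausdorff_pre_phi _ _ _) _.
rewrite lee_wpmul2l ?lee_fin ?cardV_ge0 //; apply: ereal_sup_ubound.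
by exists (L * e)%R => //=; rewrite mulr_gt0 // (scale_gt0 nf).
Qed.

Variable mu : {measure set (borel R N) -> \bar R}.
Hypothesis hmu : normalized_hausdorff d K mu.

Lemma mu_K : mu K = 1.
Proof. by case: hmu. Qed.

Lemma mu_setI (B : set (borel R N)) : measurable B -> mu (B `&` K) = mu B.
Proof.
move=> mB; have [_ [c c0 H]] := hmu; rewrite !H //.
  by rewrite -setIA setIid.
by apply: measurableI => //; exact: (measurable_K nf).
Qed.

Lemma mu_le1 (B : set (borel R N)) : measurable B -> mu B <= 1.
Proof.
move=> mB; rewrite -mu_setI // -mu_K; apply: le_measure; rewrite ?inE //.
  by apply: measurableI => //; exact: (measurable_K nf).
exact: (measurable_K nf).
Qed.

Lemma mu_fin (B : set (borel R N)) : measurable B -> mu B \is a fin_num.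
Proof.
by move=> mB; rewrite ge0_fin_numE // (le_lt_trans (mu_le1 mB)) // ltry.
Qed.

(** By [hausdorff_measure_K] the full measure of K is bounded by a premeasure of coarse mesh, in
    which [B]&[K] may be covered by itself. This gives H(K) <= r^d + H(K \ B); multiplying by c and
    subtracting the mass of the complement of B leaves the bound. *)
Lemma mu_diam : exists2 c : R, (0 < c)%R &
  forall (B : set (borel R N)) (r : R), measurable B -> (0 <= r)%R ->
    (forall x y, (B `&` K) x -> (B `&` K) y -> (edist x y <= r)%R) ->
    mu B <= (c * r `^ d)%:E.
Proof.
have [muK [c c0 H]] := hmu; exists c => // B r mB r0 HB.
have mK := measurable_K nf.
have cH : c%:E * hausdorff_measure d K = 1 by rewrite -mu_K H // setIid.
have hd : hausdorff_measure d K <= (r `^ d)%:E + hausdorff_measure d (~` B `&` K).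
  (* The mesh must be positive and at least r; [1 + r] covers r = 0. *)
  have e0 : (0 < 1 + r)%R by rewrite ltr_wpDr.
  apply: le_trans (hausdorff_measure_K e0) _.
  apply: (@le_trans _ _ (hausdorff_pre d (1 + r) ((B `&` K) `|` (~` B `&` K)))).
    by rewrite -setIUl setUv setTI.
  apply: le_trans (hausdorff_preU _ _ _ _) _; apply: leeD; last first.
    by apply: ereal_sup_ubound; exists (1 + r)%R.
  have Br : ediam (B `&` K) <= r%:E by exact: ediam_le.
  apply: le_trans (hausdorff_pre_diam _ _ _) _.
  - by rewrite gt_eqF // hausdorff_dim_gt0.
  - exact: ltW.
  - by apply: le_trans Br _; rewrite lee_fin lerDr.
  rewrite -poweR_EFin.
  by apply: ge0_le_poweR; [exact: ltW hausdorff_dim_gt0|exact: ediam_ge0|].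
have : 1 <= (c * r `^ d)%:E + mu (~` B).
  rewrite -cH (H (~` B)); last exact: measurableC.
  rewrite EFinM -ge0_muleDr ?lee_fin ?powR_ge0 //; last first.
    apply: le_trans (hausdorff_pre_ge0 d 1 _) _; apply: ereal_sup_ubound.
    by exists 1%R => /=.
  by rewrite lee_wpmul2l // lee_fin ltW.
have mBC := measurableC mB.
have := mu_fin mB; have := mu_fin mBC.
have : mu B + mu (~` B) = 1.
  rewrite -mu_K -[in RHS](setTI K) -(setUv B) mu_setI; last by rewrite setUv.
  by rewrite measureU // setICr.
case: (mu B) => [b||] //; case: (mu (~` B)) => [b'||] //.
rewrite -!EFinD => -[<-] _ _; rewrite !lee_fin; lra.
Qed.

Lemma mu_cell_le w : mu (cell phi K w) <= (M%:R^-1 ^+ size w)%:E.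
Proof.
have [muK [c c0 H]] := hmu.
have cell_w u : mu (cell phi K u) = c%:E * hausdorff_measure d (cell phi K u).
  by rewrite (H _ (measurable_cell nf u)) (setIidl (cell_sub_K nf (w := u))).
elim: w => [|i w IH]; first by rewrite cell_nil mu_K.
apply: (@le_trans _ _ (M%:R^-1%:E * mu (cell phi K w))).
  rewrite !cell_w muleCA lee_wpmul2l ?lee_fin ?(ltW c0) //.
  have -> : cell phi K (i :: w) = phi i @` cell phi K w.
    by rewrite /cell image_comp.
  exact: hausdorff_measure_phi.
by rewrite exprS EFinM lee_wpmul2l // lee_fin cardV_ge0.
Qed.

End FractalMeasure.

Section CountableNull.
Context {R : realType} {N : nat}.

Lemma measurable_point (x : borel R N) : measurable [set x].
Proof.
have -> : [set x] = [set y : 'rV[R]_N | edist x y <= 0].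
  apply/seteqP; split=> y /=; first by move->; rewrite edistxx.
  by move=> xy; apply/esym/edist_eq0/eqP; rewrite eq_le xy edist_ge0.
by apply: closed_borel; exact: closed_edist_le.
Qed.

Lemma countable_borel (A : set (borel R N)) : countable A -> measurable A.
Proof. by apply: countable_measurable => x; exact: measurable_point. Qed.

Lemma countable_null (m : {measure set (borel R N) -> \bar R})
    (A : set (borel R N)) :
  (forall x, m [set x] = 0%E) -> countable A -> m A = 0%E.
Proof.
move=> m1 /countable_injP[f injf].
pose G k := A `&` f @^-1` [set k].
have G1 k : G k = set0 \/ exists x, G k = [set x].
  have [[x [Ax fx]]|nG] := pselect (G k !=set0); last first.
    by left; apply/seteqP; split=> // x Gx; apply: nG; exists x.
  right; exists x; apply/seteqP; split=> [y [Ay fy]|_ ->] //=.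
  by apply: injf; rewrite ?inE // fx fy.
have -> : A = \bigcup_k G k.
  by apply/seteqP; split=> [x Ax|x [k _ []]] //; exists (f x).
rewrite measure_bigcup //; last 2 first.
- move=> k _; have [->|[x ->]] := G1 k; first exact: measurable0.
  exact: measurable_point.
- by move=> i j _ _ [x [[_ <-] [_ <-]]].
by apply: eseries0 => k _ _; have [->|[x ->]] := G1 k; rewrite ?measure0 ?m1.
Qed.

End CountableNull.

(** * The equality case of the union bound *)

Section FiniteCovers.
Context d (T : measurableType d) (R : realType) (mu : {measure set T -> \bar R}).
Context (I : finType) (A : I -> set T).
Hypothesis mA : forall i, measurable (A i).
Local Open Scope ereal_scope.

Lemma measure_setU_le (B C : set T) : measurable B -> measurable C ->
  mu (B `|` C) <= mu B + mu C.
Proof. exact: measureU2. Qed.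

Lemma measurable_big_setU (P : pred I) : measurable (\big[setU/set0]_(i | P i) A i).
Proof. by apply: bigsetU_measurable => i _. Qed.

Lemma measure_big_setU_le (P : pred I) :
  mu (\big[setU/set0]_(i | P i) A i) <= \sum_(i | P i) mu (A i).
Proof.
elim: (index_enum I) => [|i r IH]; first by rewrite !big_nil measure0.
rewrite !big_cons; case: ifPn => // _.
have mr : measurable (\big[setU/set0]_(j <- r | P j) A j) by exact: bigsetU_measurable.
by apply: (le_trans (measure_setU_le (mA i) mr)); rewrite leeD2l.
Qed.

(** The sets other than A i carry at most (#|I| - 1) c, so A i must carry c. Counting A i and A j as
    one set, their union must carry 2c, which leaves no mass for the overlap. Applied to the M^m
    cells of level m, each of mass at most M^-m and together covering mass 1. *)
Lemma measure_tight_cover (c : R) :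
  (forall i, mu (A i) <= c%:E) ->
  (#|I|%:R * c)%:E <= mu (\bigcup_(i in [set: I]) A i) ->
  (forall i, mu (A i) = c%:E) /\ forall i j, i != j -> mu (A i `&` A j) = 0.
Proof.
move=> Ac; have -> : \bigcup_(i in [set: I]) A i = \big[setU/set0]_i A i.
  rewrite -bigcup_seq; congr bigcup; apply/seteqP; split=> i //= _.
  exact: mem_index_enum.
move=> H.
have fA (B : set T) i : measurable B -> B `<=` A i -> mu B \is a fin_num.
  move=> mB BA; rewrite ge0_fin_numE //; apply: le_lt_trans (ltry c).
  by apply: le_trans (Ac i); apply: le_measure; rewrite ?inE.
have sumc (P : pred I) : \sum_(i | P i) mu (A i) <= (#|P|%:R * c)%:E.
  apply: le_trans (lee_sum _ (fun i _ => Ac i)) _.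
  by rewrite sumEFin big_const iter_addr_0 mulr_natl.
have Ai i : mu (A i) = c%:E.
  apply/eqP; rewrite eq_le Ac /=; move: H; rewrite (bigD1 i) //= => H.
  have {}H := le_trans H (le_trans (measure_setU_le (mA i) (measurable_big_setU _)) (leeD2l _ (measure_big_setU_le _))).
  have {}H := le_trans H (leeD2l _ (sumc _)).
  have Af := fA _ i (mA i) (@subset_refl _ _).
  rewrite -(fineK Af) lee_fin.
  have : (#|I|%:R * c <= fine (mu (A i)) + #|(fun k => k != i)|%:R * c)%R.
    by rewrite -lee_fin EFinD (fineK Af).
  rewrite (cardD1 i) inE add1n -natr1 mulrDl mul1r.
  have -> : #|[predD1 I & i]| = #|[pred k | k != i]|.
    by apply: eq_card => k; rewrite !inE andbT.
  by rewrite addrC lerD2r.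
split=> // i j ij; apply/eqP; rewrite eq_le measure_ge0 andbT.
move: H; rewrite (bigD1 i) //= (bigD1 j) 1?eq_sym //= => H.
have mij : measurable (A i `|` A j) by exact: measurableU.
rewrite setUA in H.
have {}H := le_trans H (le_trans (measure_setU_le mij (measurable_big_setU _)) (leeD2l _ (measure_big_setU_le _))).
have {}H := le_trans H (leeD2l _ (sumc _)).
have mI : measurable (A i `&` A j) by exact: measurableI.
have E : mu (A i `|` A j) + mu (A i `&` A j) = c%:E + c%:E.
  rewrite -{1}(Ai i) -(Ai j).
  have mD : measurable (A j `\` A i) by exact: measurableD.
  have -> : A i `|` A j = A i `|` (A j `\` A i).
    apply/seteqP; split=> x; last by move=> [|[]]; [left|right].
    by have [?|?] := pselect (A i x); [left|move=> [|]; [left|right]].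
  have -> : mu (A j) = mu (A j `\` A i) + mu (A i `&` A j).
    rewrite -measureU //; last by apply/seteqP; split=> x // -[[_ ?] []].
    congr (mu _); apply/seteqP; split=> x; last by move=> [[]|[]].
    by have [?|?] := pselect (A i x); [right|left].
  rewrite measureU //; last by apply/seteqP; split=> x // -[? []].
  by rewrite addeA.
have fI : mu (A i `&` A j) \is a fin_num by apply: fA mI _; exact: subIsetl.
have fU : mu (A i `|` A j) \is a fin_num.
  rewrite ge0_fin_numE //; apply: le_lt_trans (measure_setU_le (mA i) (mA j)) _.
  by rewrite (Ai i) (Ai j) ltry.
have {}E : (fine (mu (A i `|` A j)) + fine (mu (A i `&` A j)) = c + c)%R.
  by apply: EFin_inj; rewrite !EFinD (fineK fI) (fineK fU).
have {H} : (#|I|%:R * c <= fine (mu (A i `|` A j))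
    + #|(fun k => (k != i) && (k != j))|%:R * c)%R.
  by rewrite -lee_fin EFinD (fineK fU).
move: E; rewrite -(fineK fI) lee_fin.
rewrite (cardD1 i) (cardD1 j) !inE andbT eq_sym ij /= !add1n -addn2 natrD mulrDl.
have -> : #|[predD1 [predD1 I & i] & j]| = #|[pred k | (k != i) && (k != j)]|.
  by apply: eq_card => k; rewrite !inE andbT andbC.
lra.
Qed.

End FiniteCovers.

(** * Masses and intersections of cells *)

Section FractalMeasureCells.
Context {R : realType} {N M : nat} {L : R} {phi : 'I_M -> 'rV[R]_N -> 'rV[R]_N}
  {K : set 'rV[R]_N} {mu : {measure set (borel R N) -> \bar R}}.
Hypothesis nf : nested_fractal phi L K.
Hypothesis hmu : normalized_hausdorff (hausdorff_dim M L) K mu.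
Local Notation X := 'rV[R]_N.
Local Notation d := (hausdorff_dim M L).
Implicit Types (w u : seq 'I_M) (x y : X) (i : 'I_M).
Local Open Scope ereal_scope.

Lemma K_bigcup_cells m :
  \bigcup_(w in [set: m.-tuple 'I_M]) cell phi K w = K.
Proof.
apply/seteqP; split=> [x [w _]|x Kx]; first exact: (cell_sub_K nf).
have [w sw wx] := cell_ex nf m Kx.
by exists (tcast sw (in_tuple w)) => //; rewrite val_tcast.
Qed.

Lemma mu_cells m :
  (forall w : m.-tuple 'I_M, mu (cell phi K w) = (M%:R^-1 ^+ m)%:E) /\
  (forall w w' : m.-tuple 'I_M, w != w' -> mu (cell phi K w `&` cell phi K w') = 0).
Proof.
apply: measure_tight_cover => [w|w|].
- exact: (measurable_cell nf).
- by have := mu_cell_le nf hmu w; rewrite size_tuple.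
- rewrite K_bigcup_cells (mu_K hmu) card_tuple card_ord natrX -exprMn.
  by rewrite mulfV ?expr1n //; exact: (card_neq0 nf).
Qed.

Lemma mu_cell w : mu (cell phi K w) = (M%:R^-1 ^+ size w)%:E.
Proof. exact: (mu_cells (size w)).1 (in_tuple w). Qed.

(** Equal cells would overlap in positive mass. This is what allows the nesting axiom, which speaks
    of distinct sets, to be applied to distinct words. *)
Lemma cell_neq w w' : size w = size w' -> w <> w' -> cell phi K w <> cell phi K w'.
Proof.
move=> ss ww E; have [_ H] := mu_cells (size w).
have := H (in_tuple w) (tcast (esym ss) (in_tuple w')).
have -> : in_tuple w != tcast (esym ss) (in_tuple w').
  by apply/eqP => /(congr1 val); rewrite /= val_tcast.
rewrite /= val_tcast /= -E setIid mu_cell => /(_ isT) /eqP.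
by rewrite eqe expf_eq0 invr_eq0 (negbTE (card_neq0 nf)) andbF.
Qed.

Lemma cell_meet_vertex w w' x : size w = size w' -> w <> w' ->
  cell phi K w x -> cell phi K w' x ->
  exists v v', [/\ V0 phi v, V0 phi v', x = phiw phi w v & x = phiw phi w' v'].
Proof.
move=> ss ww wx w'x.
have sw : (1 <= size w)%N by case: w ss ww {wx} => // ; case: w' {w'x}.
have := @nf_nesting _ _ _ _ _ _ nf (size w) (in_tuple w) (tcast (esym ss) (in_tuple w')) sw.
rewrite val_tcast /= => /(_ (cell_neq ss ww)) E.
have : (cell phi K w `&` cell phi K w') x by split.
by rewrite E => -[[v Vv <-] [v' Vv' E']]; exists v, v'; rewrite E'; split.
Qed.

Lemma cell_meet_Vinf w w' x : size w = size w' -> w <> w' ->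
  cell phi K w x -> cell phi K w' x -> Vinf phi x.
Proof.
move=> ss ww wx w'x; have [v [v' [Vv _ -> _]]] := cell_meet_vertex ss ww wx w'x.
exact: Vinf_phiw.
Qed.

Lemma mu_ball_le : exists2 c : R, (0 < c)%R & forall (x : X) (r : R), (0 <= r)%R ->
  mu (eball K x r) <= (c * r `^ d)%:E.
Proof.
have [c c0 Hc] := mu_diam nf hmu.
exists (c * 2 `^ d)%R; first by rewrite mulr_gt0 // powR_gt0.
move=> x r r0; rewrite -mulrA -powRM //; apply: Hc.
- apply: measurableI; first exact: (measurable_K nf).
  by apply: closed_borel; exact: closed_edist_le.
- by rewrite mulr_ge0.
- move=> y z [[_ xy] _] [[_ xz] _].
  rewrite (le_trans (edist_triangle x _ _)) // edistC mulr_natl mulr2n.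
  exact: lerD.
Qed.

Lemma measurable_eball x r : measurable (eball K x r : set (borel R N)).
Proof.
apply: measurableI; first exact: (measurable_K nf).
by apply: closed_borel; exact: closed_edist_le.
Qed.

Lemma mu_point x : mu ([set x] : set (borel R N)) = 0.
Proof.
have [c c0 Hc] := mu_diam nf hmu.
have mx := @measurable_point R N x.
apply/eqP; rewrite eq_le measure_ge0 andbT.
apply: le_trans (Hc _ 0%R mx (lexx _) _) _.
  by move=> y z [-> _] [-> _]; rewrite edistxx.
by rewrite powR0 ?mulr0 // gt_eqF // (hausdorff_dim_gt0 nf).
Qed.

End FractalMeasureCells.

(** * Integrals over overlapping pieces *)

Section IntegralComparison.
Context d (T : measurableType d) (R : realType) (m : {measure set T -> \bar R}).
Local Open Scope ereal_scope.

(* No measurability is required: the integral of a nonnegative function is a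
   supremum over the simple functions below it. *)
Lemma ge0_le_integral_nomeas (D : set T) (F G : T -> \bar R) :
  (forall x, D x -> 0 <= F x) -> (forall x, D x -> F x <= G x) ->
  \int[m]_(x in D) F x <= \int[m]_(x in D) G x.
Proof.
move=> F0 FG; rewrite !ge0_integralE => [|x Dx|//]; last first.
  exact: le_trans (F0 _ Dx) (FG _ Dx).
apply: ge_ereal_sup => _ [h hF <-]; apply: ereal_sup_ubound.
exists h => // x; apply: le_trans (hF x) _; rewrite /patch; case: ifPn => // xD.
by apply: FG; rewrite inE in xD.
Qed.

Lemma integral_setD_null (D Z : set T) (F : T -> \bar R) :
  measurable D -> measurable Z -> m Z = 0 -> measurable_fun D F ->
  (forall x, D x -> 0 <= F x) ->
  \int[m]_(x in D `\` Z) F x = \int[m]_(x in D) F x.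
Proof.
move=> mD mZ Z0 mF F0; apply/esym; exact: ge0_negligible_integral.
Qed.

(** [F] is not assumed measurable, so it cannot be modified on Z. Instead G is raised to +oo on Z:
    this dominates F everywhere and has the same integral as G. *)
Lemma ge0_le_integral_ae (D Z : set T) (F G : T -> \bar R) :
  measurable D -> measurable Z -> m Z = 0 -> measurable_fun D G ->
  (forall x, D x -> 0 <= F x) -> (forall x, D x -> 0 <= G x) ->
  (forall x, D x -> ~ Z x -> F x <= G x) ->
  \int[m]_(x in D) F x <= \int[m]_(x in D) G x.
Proof.
move=> mD mZ Z0 mG F0 G0 FG.
pose H x := if x \in Z then +oo else G x.
have HG : \int[m]_(x in D) H x = \int[m]_(x in D) G x.
  apply: ge0_ae_eq_integral => //.
  - apply: measurable_fun_if => //.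
    + apply: (measurable_fun_bool true); apply: measurableI => //.
      have -> : (fun x => x \in Z) @^-1` [set true] = Z.
        by apply/seteqP; split=> x /=; [move=> /set_mem|exact: mem_set].
      by [].
    + exact: measurable_funS mG.
  - by move=> x Dx; rewrite /H; case: ifPn => // _; exact: G0.
  - exists Z; split => // x /= nH; apply: contrapT => nZ; apply: nH => Dx.
    by rewrite /H memNset.
rewrite -HG; apply: ge0_le_integral_nomeas => // x Dx; rewrite /H.
by case: ifPn => [_|/negP]; rewrite ?leey // inE => nZ; exact: FG.
Qed.

Variables (I : finType) (A : I -> set T) (D Z : set T).
Hypotheses (mA : forall i, measurable (A i)) (mD : measurable D)
  (mZ : measurable Z) (Z0 : m Z = 0).

(** Off the null set Z a point lies in at most one piece, so the sum of the restricted integrands is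
    bounded by G pointwise. Each piece has its own integrand, and G may be the inner integral of the
    Korevaar-Schoen functional, for which measurability is not at hand. *)
Lemma sum_integral_le (P : pred I) (F : I -> T -> \bar R) (G : T -> \bar R) :
  (forall i, P i -> A i `<=` D) ->
  (forall i j x, P i -> P j -> A i x -> A j x -> i <> j -> Z x) ->
  (forall i, measurable_fun (A i) (F i)) ->
  (forall i x, A i x -> 0 <= F i x) -> (forall x, D x -> 0 <= G x) ->
  (forall i x, P i -> A i x -> ~ Z x -> F i x <= G x) ->
  \sum_(i | P i) \int[m]_(x in A i) F i x <= \int[m]_(x in D) G x.
Proof.
move=> AD AZ mF F0 G0 FG.
pose H i := (F i) \_ (A i `\` Z).
have mAZ i : measurable (A i `\` Z) by exact: measurableD.
have H0 i x : 0 <= H i x.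
  by rewrite /H /patch; case: ifPn => //; rewrite inE => -[Ax _]; exact: F0.
have mH i : measurable_fun D (H i).
  apply: measurable_funTS; apply/(measurable_restrictT _ _).1 => //.
  by apply: measurable_funS (mF i) => //; exact: subDsetl.
apply: (@le_trans _ _ (\int[m]_(x in D) \sum_(i | P i) H i x)).
  under eq_integral do rewrite -big_filter.
  rewrite ge0_integral_sum // big_filter.
  apply: lee_sum => i Pi; rewrite -(integral_setD_null _ mZ Z0) //; last exact: F0.
  rewrite (integral_mkcond (A i `\` Z)) -/(H i) (integral_mkcond D).
  rewrite le_eqVlt; apply/orP; left; apply/eqP; apply: eq_integral => x _.
  rewrite [RHS]/patch; case: ifPn => //; rewrite /H /patch; case: ifPn => //.
  by rewrite inE => -[Ax _] /negP; rewrite inE => /(_ (AD _ Pi _ Ax)).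
apply: ge0_le_integral_nomeas => x Dx; first by apply: sume_ge0 => i _.
have [[i Pi [Ax nZ]]|n] := pselect (exists2 i, P i & (A i `\` Z) x); last first.
  rewrite big1 ?G0 // => i Pi; rewrite /H /patch; case: ifPn => //.
  by rewrite inE => iZ; exfalso; apply: n; exists i.
rewrite (bigD1 i) //= big1 ?adde0 => [|j /andP[Pj ji]].
  by rewrite /H /patch mem_set //; exact: FG.
rewrite /H /patch; case: ifPn => //; rewrite inE => -[Ajx _].
by exfalso; apply: nZ; apply: (AZ j i) => //; apply/eqP.
Qed.

Lemma integral_le_sum (P : pred I) (F : I -> T -> \bar R) (G : T -> \bar R) :
  (forall x, D x -> exists2 i, P i & A i x) ->
  (forall i, measurable_fun (A i) (F i)) ->
  (forall i x, A i x -> 0 <= F i x) -> (forall x, D x -> 0 <= G x) ->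
  (forall i x, P i -> A i x -> D x -> ~ Z x -> G x <= F i x) ->
  \int[m]_(x in D) G x <= \sum_(i | P i) \int[m]_(x in A i) F i x.
Proof.
move=> DA mF F0 G0 GF.
pose H i := (F i) \_ (A i).
have H0 i x : 0 <= H i x.
  by rewrite /H /patch; case: ifPn => //; rewrite inE => Ax; exact: F0.
have mH i : measurable_fun D (H i).
  by apply: measurable_funTS; apply/(measurable_restrictT _ _).1.
apply: (@le_trans _ _ (\int[m]_(x in D) \sum_(i | P i) H i x)).
  apply: (ge0_le_integral_ae mD mZ Z0) => //.
  - under eq_fun do rewrite -big_filter.
    exact: emeasurable_sum.
  - by move=> x Dx; apply: sume_ge0.
  - move=> x Dx nZ; have [i Pi Ax] := DA x Dx.
    rewrite (bigD1 i) //= /H {1}/patch mem_set //.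
    apply: le_trans (GF i x Pi Ax Dx nZ) _.
    by rewrite leeDl //; apply: sume_ge0 => j _; exact: H0.
under eq_integral do rewrite -big_filter.
rewrite ge0_integral_sum // big_filter; apply: lee_sum => i _.
rewrite (integral_mkcond (A i)) -/(H i) (integral_mkcond D).
apply: ge0_le_integral_nomeas => x _; rewrite /patch; case: ifPn => //.
Qed.

End IntegralComparison.

Lemma integrable_cst_fin d (T : measurableType d) (R : realType)
    (m : {measure set T -> \bar R}) (B : set T) (c : R) :
  measurable B -> (m B < +oo)%E -> m.-integrable B (EFin \o cst c).
Proof.
move=> mB fB; apply/integrableP; split; first exact/measurable_EFinP.
rewrite (eq_integral (cst `|c|%:E)) // integral_cst //.
by rewrite -(fineK (_ : m B \is a fin_num)) ?ge0_fin_numE // -EFinM ltry.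
Qed.

(** * Deviation of means from a constant *)

Section MeanValues.
Context {R : realType} {N : nat} (m : {measure set (borel R N) -> \bar R}).
Context (B : set (borel R N)) (f : borel R N -> R) (b : R).
Hypotheses (mB : measurable B) (mBb : m B = b%:E) (b0 : 0 < b)
  (intf : m.-integrable B (EFin \o f)).
Local Open Scope ereal_scope.

Let mf : measurable_fun B f.
Proof. by move/measurable_int : intf => /measurable_EFinP. Qed.

Lemma integrable_sub_cst c : m.-integrable B (EFin \o (fun y => f y - c)%R).
Proof.
have -> : EFin \o (fun y => f y - c)%R = (EFin \o f) \- (EFin \o cst c).
  by apply/funext => y.
by apply: integrableB => //; apply: integrable_cst_fin => //; rewrite mBb ltry.
Qed.

Lemma mean_dist_le c :
  (`|meanval m f B - c|)%:E <= b^-1%:E * \int[m]_(y in B) (`|f y - c|%R)%:E.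
Proof.
have ic := integrable_sub_cst c.
have -> : (meanval m f B - c)%R = (b^-1 * \int[m]_(y in B) (f y - c))%R.
  rewrite RintegralB //; last first.
    by apply: integrable_cst_fin => //; rewrite mBb ltry.
  rewrite Rintegral_cst // /meanval mBb /= mulrBr mulrCA mulVf ?mulr1 //.
  by rewrite gt_eqF.
rewrite normrM ger0_norm; last by rewrite invr_ge0 ltW.
rewrite EFinM lee_wpmul2l ?lee_fin ?invr_ge0 ?(ltW b0) //.
have := le_normr_Rintegral mB ic; rewrite -lee_fin => /le_trans; apply.
rewrite /Rintegral fineK //; apply: integrable_fin_num => //.
exact: integrable_norm ic.
Qed.

(** Jensen's inequality for the square, obtained from [mean_dist_le] by the bound s <= t/2 +
    s^2/(2t), where t is the deviation of the mean itself. The term t/2 is absorbed on the left; the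
    weight is why t = 0 is treated first. *)
Lemma mean_dist_sqr_le c :
  ((meanval m f B - c) ^+ 2)%:E <= b^-1%:E * \int[m]_(y in B) ((f y - c) ^+ 2)%:E.
Proof.
set t := (meanval m f B - c)%R.
have I0 : 0 <= \int[m]_(y in B) ((f y - c) ^+ 2)%:E.
  by apply: integral_ge0 => y _; rewrite lee_fin sqr_ge0.
have [t0|t0] := eqVneq t 0%R.
  by rewrite t0 expr0n mule_ge0 // lee_fin invr_ge0 ltW.
have mc : measurable_fun B (fun y => (f y - c)%R) by exact: measurable_funB.
have t1 : (0 < `|t|)%R by rewrite normr_gt0.
have H : \int[m]_(y in B) (`|f y - c|%R)%:E <=
    \int[m]_(y in B) ((`|t| / 2)%:E + ((2 * `|t|)^-1 * (f y - c) ^+ 2)%:E).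
  apply: ge0_le_integral => //.
  - by apply/measurable_EFinP; exact: measurableT_comp.
  - apply/measurable_EFinP; apply: measurable_funD => //.
    by apply: measurable_funM => //; exact: measurable_funX.
  - move=> y _; rewrite -EFinD lee_fin -real_normK ?num_real //.
    set s := `|f y - c|%R; set a := `|t|%R.
    rewrite -subr_ge0.
    have -> : (a / 2 + (2 * a)^-1 * s ^+ 2 - s = (2 * a)^-1 * (a - s) ^+ 2)%R.
      by field; rewrite gt_eqF.
    by rewrite mulr_ge0 ?sqr_ge0 // invr_ge0 mulr_ge0 // ltW.
have := le_trans (mean_dist_le c) (lee_wpmul2l _ H).
rewrite lee_fin invr_ge0 (ltW b0) => /(_ isT).
rewrite ge0_integralD //; last 2 first.
- by move=> y _; rewrite lee_fin mulr_ge0 ?sqr_ge0 // invr_ge0 mulr_ge0.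
- by apply/measurable_EFinP; apply: measurable_funM => //; exact: measurable_funX.
rewrite integral_cst // mBb.
under eq_integral do rewrite EFinM.
rewrite ge0_integralZl //; last 2 first.
- by apply/measurable_EFinP; exact: measurable_funX.
- by move=> y _; rewrite lee_fin sqr_ge0.
case: (\int[m]_(y in B) ((f y - c) ^+ 2)%:E) I0 => [q||] // q0 H2; last first.
  by rewrite gt0_muley ?leey // lte_fin invr_gt0.
have {H2} : (`|t| <= b^-1 * (`|t| / 2 * b + (2 * `|t|)^-1 * q))%R by rewrite -lee_fin.
rewrite -EFinM lee_fin mulrDr.
have -> : (b^-1 * (`|t| / 2 * b) = `|t| / 2)%R by field; rewrite gt_eqF.
rewrite -lerBlDl {1}(splitr `|t|) addrK => H2.
rewrite -real_normK ?num_real //.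
have := ler_wpM2l (mulr_ge0 (ler0n R 2) (ltW t1)) H2.
have -> : (2 * `|t| * (`|t| / 2) = `|t| ^+ 2)%R by field.
suff -> : (2 * `|t| * (b^-1 * ((2 * `|t|)^-1 * q)) = b^-1 * q)%R by [].
by field; rewrite !gt_eqF.
Qed.

(** The mean is itself within S of c, so replacing c by the mean at most doubles the deviation. *)
Lemma mean_dist_sup (Z : set (borel R N)) c S : measurable Z -> m Z = 0 -> (0 <= S)%R ->
  (forall y, B y -> ~ Z y -> (`|f y - c| <= S)%R) ->
  (`|meanval m f B - c| <= S)%R /\
  b^-1%:E * \int[m]_(y in B) (`|f y - meanval m f B|%R)%:E <= (2 * S)%:E.
Proof.
move=> mZ Z0 S0 H.
have E c' S' : (0 <= S')%R -> (forall y, B y -> ~ Z y -> (`|f y - c'| <= S')%R) ->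
    b^-1%:E * \int[m]_(y in B) (`|f y - c'|%R)%:E <= S'%:E.
  move=> S'0 H'; rewrite lee_pdivrMl // -mBb.
  apply: le_trans (ge0_le_integral_ae (G := cst S'%:E) mB mZ Z0 _ _ _ _) _ => //.
  by rewrite integral_cst // muleC.
have M1 : (`|meanval m f B - c| <= S)%R.
  by rewrite -lee_fin; apply: le_trans (mean_dist_le c) _; exact: E.
split=> //; apply: E; first by rewrite mulr_ge0.
move=> y By nZ; rewrite (le_trans (ler_distD c _ _)) // mulrC mulr_natr mulr2n.
by rewrite lerD ?H // distrC.
Qed.

End MeanValues.

Lemma measurable_norm_powR d (T : measurableType d) (R : realType) (D : set T)
    (f : T -> R) (p : R) :
  measurable_fun D f -> measurable_fun D (fun x => `|f x| `^ p).
Proof.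
move=> mf; apply: (@measurableT_comp _ _ _ _ _ _ (fun t : R => t `^ p)).
  exact: measurable_powR.
exact: measurableT_comp.
Qed.

Lemma Lp_integrable {R : realType} {N : nat} (K : set (borel R N))
    (m : {measure set (borel R N) -> \bar R}) (p : R) f :
  measurable K -> (m K < +oo)%E -> 1 <= p -> Lp K m p f ->
  m.-integrable K (EFin \o f).
Proof.
move=> mK Kfin p1 [mf fp]; apply/integrableP; split; first exact/measurable_EFinP.
have mfp : measurable_fun K (fun x => (`|f x| `^ p)%:E).
  by apply/measurable_EFinP; exact: measurable_norm_powR.
apply: (@le_lt_trans _ _ (\int[m]_(x in K) (1 + (`|f x| `^ p)%:E)))%E.
  apply: ge0_le_integral => //.
  - apply/measurable_EFinP; exact: measurableT_comp.
  - by apply: emeasurable_funD.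
  - move=> x _ /=; rewrite -EFinD lee_fin.
    have [f1|f1] := leP `|f x| 1; first by rewrite (le_trans f1) // lerDl powR_ge0.
    by rewrite (le_trans (le1r_powR (ltW f1) p1)) // lerDr.
rewrite ge0_integralD //.
by rewrite integral_cst // mul1e lte_add_pinfty.
Qed.

(** * From the Poincare inequality to the Korevaar-Schoen condition *)

Lemma limf_esup_at_right0 (R : realType) (F : R -> \bar R) :
  (limf_esup F 0^'+ < +oo)%E <->
  exists e C : R, 0 < e /\ forall eps, 0 < eps -> eps < e -> (F eps <= C%:E)%E.
Proof.
rewrite limf_esupE; split.
  move=> /ereal_inf_lt[_ [V V0 <-] Vy].
  have /nbhs_ballP[e /= e0 He] : nbhs (0 : R) [set u | 0 < u -> V u] by [].
  have [C HC] : exists C : R, (ereal_sup [set F x | x in V] <= C%:E)%E.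
    case: (ereal_sup _) Vy => [r _||_] //; first by exists r.
    by exists 0; exact: leNye.
  exists e, C; split => // eps eps0 epse; apply: le_trans HC.
  apply: ereal_sup_ubound; exists eps => //; apply: He => //.
  by rewrite /ball /= sub0r normrN gtr0_norm.
move=> [e [C [e0 H]]]; apply: le_lt_trans (ltry C).
apply: ge_ereal_inf; exists (ereal_sup [set F x | x in [set u | 0 < u < e]]).
  exists [set u | 0 < u < e] => //; apply/nbhs_ballP; exists e => //= u.
  by rewrite /ball /= sub0r normrN => ue u0; rewrite u0 -(gtr0_norm u0).
by apply: ge_ereal_sup => _ [u /= /andP[u0 ue] <-]; exact: H.
Qed.

Lemma powR_exprn (R : realType) (a x : R) m : 0 <= a -> (a ^+ m) `^ x = (a `^ x) ^+ m.
Proof.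
by move=> a0; rewrite -(powR_mulrn m a0) -(powR_mulrn m (powR_ge0 a x)) powRAC.
Qed.

(** * Masses of balls and numbers of nearby cells *)

Section BallBounds.
Context {R : realType} {N M : nat} {L : R} {phi : 'I_M -> 'rV[R]_N -> 'rV[R]_N}
  {K : set 'rV[R]_N} {mu : {measure set (borel R N) -> \bar R}}.
Hypothesis nf : nested_fractal phi L K.
Hypothesis hmu : normalized_hausdorff (hausdorff_dim M L) K mu.
Local Notation X := 'rV[R]_N.
Local Notation d := (hausdorff_dim M L).

Lemma tuple_cell_ex m x : K x -> exists u : m.-tuple 'I_M, cell phi K u x.
Proof.
move=> Kx; have [w sw wx] := cell_ex nf m Kx.
by exists (tcast sw (in_tuple w)); rewrite val_tcast.
Qed.

Lemma cell_sub_eball w x r m : cell phi K w x -> (m <= size w)%N ->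
  L^-1 ^+ m <= r -> cell phi K w `<=` eball K x r.
Proof.
move=> wx mw mr y wy; split; first exact: (cell_sub_K nf wy).
rewrite (le_trans (cell_diam nf wx wy)) // (le_trans _ mr) //.
by rewrite ler_wiXn2l ?(scaleV_ge0 nf) // ltW // (scaleV_lt1 nf).
Qed.

Lemma eball_shift x y r s t : edist x y <= t -> t + r <= s ->
  eball K y r `<=` eball K x s.
Proof.
move=> xy trs z [Kz yz]; split=> //.
exact: le_trans (edist_triangle y x z) (le_trans (lerD xy yz) trs).
Qed.

Lemma mu_eball_ge x r m : K x -> L^-1 ^+ m <= r ->
  M%:R^-1 ^+ m <= fine (mu (eball K x r)).
Proof.
move=> Kx mr; have [w sw wx] := cell_ex nf m Kx.
have mB := measurable_eball nf x r.
rewrite -lee_fin fineK; last exact: (mu_fin nf hmu).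
rewrite -sw -(mu_cell nf hmu w).
apply: le_measure; rewrite ?inE //; first exact: (measurable_cell nf).
by apply: cell_sub_eball wx _ mr; rewrite sw.
Qed.

Lemma scale_powR_dim (c : R) m : 0 <= c ->
  (c * L^-1 ^+ m) `^ d = c `^ d * M%:R^-1 ^+ m.
Proof.
move=> c0; rewrite powRM ?exprn_ge0 ?(scaleV_ge0 nf) //; congr (_ * _).
by rewrite -!powR_mulrn ?(scaleV_ge0 nf) ?(cardV_ge0 nf) // powRAC (powR_scale_dim nf).
Qed.

Lemma mu_eball_le : exists2 C : R, 0 < C &
  forall x (c : R) m, 0 <= c -> fine (mu (eball K x (c * L^-1 ^+ m)))
    <= C * c `^ d * M%:R^-1 ^+ m.
Proof.
have [C C0 H] := mu_ball_le nf hmu; exists C => // x c m c0.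
have cm : 0 <= c * L^-1 ^+ m by rewrite mulr_ge0 // exprn_ge0 // (scaleV_ge0 nf).
have mB := measurable_eball nf x (c * L^-1 ^+ m).
have := H x _ cm; rewrite scale_powR_dim // mulrA.
by rewrite -[mu _]fineK ?lee_fin //; exact: (mu_fin nf hmu).
Qed.

Definition near_cells (r : R) (w u : seq 'I_M) : bool :=
  `[< exists x y, [/\ cell phi K w x, cell phi K u y & edist x y <= r] >].

(* Cells of level m near a given one lie in a ball of comparable radius, whose
   mass bounds their number. *)
Lemma near_cells_card (c : R) : 0 <= c -> exists n : nat,
  forall m (w : m.-tuple 'I_M),
    (#|[pred u : m.-tuple 'I_M | near_cells (c * L^-1 ^+ m) w u]| <= n)%N.
Proof.
move=> c0; have [C C0 HC] := mu_eball_le.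
pose k := C * (c + 2) `^ d.
have [n Hn] : exists n : nat, k <= n%:R.
  have k0 : 0 <= k by rewrite mulr_ge0 ?powR_ge0 // ltW.
  by exists (Num.bound k); exact: ltW (archi_boundP k0).
exists n => m w; set P := [pred u | _].
have [x0 wx0] : exists x, cell phi K w x.
  by have [x Kx] := nf_nonempty nf; exists (phiw phi w x), x.
(* The distance c L^-m between the cells plus their two diameters. *)
have sub u : P u -> cell phi K u `<=` eball K x0 ((c + 2) * L^-1 ^+ m).
  move=> /asboolP[x [y [wx uy xy]]] z uz; split; first exact: (cell_sub_K nf uz).
  have h1 := cell_diam nf wx0 wx; have h2 := cell_diam nf uy uz.
  rewrite !size_tuple in h1 h2.
  have h3 := edist_triangle x x0 z; have h4 := edist_triangle y x z.
  rewrite mulrDl; lra.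
have : (\sum_(u | P u) mu (cell phi K u) <= mu (eball K x0 ((c + 2) * L^-1 ^+ m)))%E.
  have mB := measurable_eball nf x0 ((c + 2) * L^-1 ^+ m).
  have mc (u : m.-tuple 'I_M) := measurable_cell nf u.
  have mV := countable_borel (Vinf_countable nf).
  have V0 := countable_null (mu_point nf hmu) (Vinf_countable nf).
  have := @sum_integral_le _ _ _ mu _ _ _ _ mc mB mV V0 P (fun _ => cst 1%E) (cst 1%E).
  rewrite integral_cst // mul1e => H.
  apply: le_trans (H _ _ _ _ _ _) => //.
    by apply: lee_sum => u _; rewrite integral_cst // mul1e.
  move=> u v x _ _ ux vx uv; apply: (cell_meet_Vinf nf hmu _ _ ux vx).
    by rewrite !size_tuple.
  by move=> E; apply: uv; exact: val_inj.
rewrite (eq_bigr (fun=> (M%:R^-1 ^+ m)%:E)); last first.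
  by move=> u _; rewrite (mu_cell nf hmu) size_tuple.
rewrite sumEFin big_const iter_addr_0 -[mu _]fineK; last first.
  by apply: (mu_fin nf hmu); exact: (measurable_eball nf).
rewrite lee_fin => /le_trans/(_ (HC x0 _ m (addr_ge0 c0 (ler0n _ 2)))).
rewrite -[X in X <= _]mulr_natl ler_pM2r; last first.
  by rewrite exprn_gt0 // invr_gt0 (card_gt0 nf).
by move=> /le_trans/(_ Hn); rewrite ler_nat.
Qed.

Lemma scale_floor (e : R) : 0 < e -> e <= 1 ->
  exists m, L^-1 ^+ m.+1 < e /\ e <= L^-1 ^+ m.
Proof.
move=> e0 e1.
have [n Hn] := expr_arbitrarily_small (scaleV_ge0 nf) (scaleV_lt1 nf) e0.
have ex : exists m, (fun m => L^-1 ^+ m < e) m by exists n; apply: Hn.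
have := ex_minnP ex => -[[|m] Hm min].
  by move: Hm; rewrite expr0 ltNge e1.
exists m; split => //; rewrite leNgt; apply/negP => /min.
by rewrite ltnn.
Qed.

End BallBounds.

Section PoincareToKS.
Context {R : realType} {N M : nat} {L : R} {phi : 'I_M -> 'rV[R]_N -> 'rV[R]_N}
  {K : set 'rV[R]_N} {mu nu : {measure set (borel R N) -> \bar R}} {p sigma : R}.
Hypothesis nf : nested_fractal phi L K.
Hypothesis hmu : normalized_hausdorff (hausdorff_dim M L) K mu.
Hypothesis nu1 : forall x : borel R N, nu [set x] = 0%E.
Hypothesis p1 : 1 <= p.
Hypothesis sigma0 : 0 < sigma.
Hypothesis sigma_dim : hausdorff_dim M L / p < sigma.
Local Notation X := 'rV[R]_N.
Local Notation d := (hausdorff_dim M L).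
Let mK : measurable (K : set (borel R N)) := measurable_K nf.
Let p0 : 0 < p := lt_le_trans ltr01 p1.

(** The ratio of consecutive terms in the chain of balls: r^sigma shrinks by L^-sigma and
    mu(B)^(-1/p) grows by M^(1/p). It is below 1 by the hypothesis sigma > d/p. *)
Let q := L^-1 `^ sigma * M%:R `^ p^-1.

Let q_gt0 : 0 < q.
Proof.
by rewrite mulr_gt0 // powR_gt0 // ?invr_gt0 ?(scale_gt0 nf) ?(card_gt0 nf).
Qed.

Let q_lt1 : q < 1.
Proof.
rewrite /q (powR_scale nf) /powR gt_eqF ?(card_gt0 nf) // -expRD -[ltRHS]expR0 ltr_expR.
rewrite addrC subr_lt0.
move: sigma_dim; rewrite /hausdorff_dim mulrAC ltr_pdivrMr ?(lnL_gt0 nf) //.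
by rewrite mulrC.
Qed.

Context {f g : borel R N -> R} {A : R}.
Hypotheses (fLp : Lp K mu p f) (g0 : forall x, K x -> 0 <= g x)
  (gLp : Lp K nu p g) (A1 : 1 <= A).
Hypothesis poincare : forall (x : X) (r : R), K x -> 0 < r -> (r%:E < ediam K)%E ->
  let B : set (borel R N) := eball K x r in
  let AB : set (borel R N) := eball K x (A * r) in
  ((fine (mu B))^-1%:E * \int[mu]_(y in B) `|f y - meanval mu f B|%:E
   <= (r `^ sigma)%:E *
      ((fine (mu AB))^-1%:E *
         \int[nu]_(y in AB) (g y `^ p)%:E) `^ p^-1)%E.

Let intf : mu.-integrable K (EFin \o f).
Proof. by apply: Lp_integrable fLp => //; rewrite (mu_K hmu) ltry. Qed.

Let mgp : measurable_fun (K : set (borel R N)) (fun y => (g y `^ p)%:E).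
Proof.
have [mg _] := gLp; apply/measurable_EFinP.
apply: (eq_measurable_fun (fun y => `|g y| `^ p)) => [x|].
  by rewrite inE => Kx; rewrite ger0_norm // g0.
exact: measurable_norm_powR.
Qed.

Let gp0 (B : set (borel R N)) : (0 <= \int[nu]_(y in B) (g y `^ p)%:E)%E.
Proof. by apply: integral_ge0 => y _; rewrite lee_fin powR_ge0. Qed.

Let gp_fin (B : set (borel R N)) : measurable B -> B `<=` K ->
  (\int[nu]_(y in B) (g y `^ p)%:E \is a fin_num)%E.
Proof.
move=> mB BK; rewrite ge0_fin_numE //; have [_] := gLp; apply: le_lt_trans.
apply: (@le_trans _ _ (\int[nu]_(y in K) (g y `^ p)%:E)%E).
  by apply: ge0_subset_integral => // x Kx; rewrite lee_fin powR_ge0.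
by apply: ge0_le_integral_nomeas => x Kx; rewrite lee_fin ?powR_ge0 // ger0_norm ?g0.
Qed.

Let I x r := fine (\int[nu]_(y in eball K x r) (g y `^ p)%:E)%E.

Let I_ge0 x r : 0 <= I x r.
Proof. exact: fine_ge0. Qed.

Let I_mono x r y s : eball K x r `<=` eball K y s -> I x r <= I y s.
Proof.
move=> H; have mB := measurable_eball nf.
apply: fine_le; [by apply: gp_fin => // z []..|].
apply: ge0_subset_integral => //; first by apply: measurable_funS mgp => // z [].
by move=> z _; rewrite lee_fin powR_ge0.
Qed.

Let ballK x r : eball K x r `<=` K. Proof. by move=> y []. Qed.

Lemma poincare_ball_cells : exists2 C, 0 <= C & forall m x, K x -> 3 * L^-1 ^+ m < 1 ->
  exists c : R,
  (\int[mu]_(y in eball K x (3 * L^-1 ^+ m)) (`|f y - c|)%:E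
     <= (C * M%:R^-1 ^+ m * q ^+ m * I x (A * (3 * L^-1 ^+ m)) `^ p^-1)%:E)%E /\
  forall w, (size w <= m.+1)%N -> cell phi K w `<=` eball K x (3 * L^-1 ^+ m) ->
    `|meanval mu f (cell phi K w) - c| <= C * q ^+ m * I x (A * (3 * L^-1 ^+ m)) `^ p^-1.
Proof.
have [c1 c10 Hc] := mu_eball_le nf hmu.
pose C0 := c1 * 3 `^ d * 3 `^ sigma.
have C00 : 0 <= C0 by rewrite !mulr_ge0 ?powR_ge0 // ltW.
have M1 : 1 <= M%:R :> R by rewrite ler1n (leq_trans _ (nf_card nf)).
exists (C0 * M%:R); first by rewrite mulr_ge0.
move=> m x Kx r1; set r := 3 * L^-1 ^+ m in r1 *; set J := I x (A * r) `^ p^-1.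
have Lm0 : 0 < L^-1 ^+ m by rewrite exprn_gt0 // invr_gt0 (scale_gt0 nf).
have r0 : 0 < r by rewrite mulr_gt0.
have Lr : L^-1 ^+ m <= r by rewrite /r ler_peMl ?(ltW Lm0) // ler1n.
have LAr : L^-1 ^+ m <= A * r by rewrite (le_trans Lr) // ler_peMl // (ltW r0).
have Mm0 : 0 < M%:R^-1 ^+ m :> R by rewrite exprn_gt0 // invr_gt0 (card_gt0 nf).
have mB := measurable_eball nf x r; have mAB := measurable_eball nf x (A * r).
have J0 : 0 <= J by exact: powR_ge0.
set B := eball K x r in mB; exists (meanval mu f B).
have bB := mu_eball_ge nf hmu Kx Lr; have bAB := mu_eball_ge nf hmu Kx LAr.
have uB := Hc x 3 m (ler0n _ 3).
have B0 : 0 < fine (mu B) by exact: lt_le_trans bB.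
have AB0 : 0 < fine (mu (eball K x (A * r))) by exact: lt_le_trans bAB.
have i1 : (\int[mu]_(y in B) (`|f y - meanval mu f B|)%:E
    <= (C0 * M%:R^-1 ^+ m * q ^+ m * J)%:E)%E.
  have r1' : (r%:E < ediam K)%E by rewrite (nf_diam nf) lte_fin.
  have := poincare Kx r0 r1'; rewrite /= -/B -(fineK (gp_fin mAB (@ballK _ _))).
  rewrite -(EFinM (fine (mu (eball K x (A * r))))^-1) poweR_EFin -EFinM -/(I x (A * r)).
  rewrite lee_pdivrMl // => /le_trans; apply; rewrite -EFinM lee_fin.
  apply: (@le_trans _ _ (c1 * 3 `^ d * M%:R^-1 ^+ m *
     (r `^ sigma * (M%:R ^+ m * I x (A * r)) `^ p^-1))).
    apply: ler_pM => //; first by rewrite mulr_ge0 ?powR_ge0.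
    apply: ler_wpM2l; first exact: powR_ge0.
    apply: ge0_ler_powR; rewrite ?nnegrE ?invr_ge0 ?(ltW p0) //.
    - by rewrite mulr_ge0 ?invr_ge0 ?(ltW AB0) ?I_ge0.
    - by rewrite mulr_ge0 ?exprn_ge0 ?I_ge0.
    - apply: ler_wpM2r; first exact: I_ge0.
      rewrite -[leRHS]invrK lef_pV2 ?posrE // -?exprVn //.
  rewrite /r powRM ?(ltW Lm0) // powRM ?exprn_ge0 ?I_ge0 // -/J.
  rewrite -[M%:R ^+ m]powR_mulrn // powRAC powR_mulrn ?powR_ge0 //.
  rewrite -[L^-1 ^+ m]powR_mulrn ?(scaleV_ge0 nf) // powRAC powR_mulrn ?powR_ge0 //.
  by rewrite le_eqVlt; apply/orP; left; apply/eqP; rewrite /C0 /q exprMn; ring.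
clearbody C0; have q0 := ltW q_gt0.
split.
  apply: le_trans i1 _; rewrite lee_fin -!mulrA ler_wpM2l //.
  by apply: ler_peMl => //; rewrite !mulr_ge0 ?exprn_ge0 ?(cardV_ge0 nf).
move=> w sw wB; rewrite -lee_fin.
have mw := measurable_cell nf w.
have b0 : 0 < M%:R^-1 ^+ size w :> R by rewrite exprn_gt0 // invr_gt0 (card_gt0 nf).
have iw : mu.-integrable (cell phi K w) (EFin \o f).
  by apply: integrableS intf => //; exact: (cell_sub_K nf).
apply: le_trans (mean_dist_le mw (mu_cell nf hmu w) b0 iw _) _.
rewrite lee_pdivrMl //.
apply: le_trans (_ : _ <= \int[mu]_(y in B) (`|f y - meanval mu f B|)%:E)%E _.
  apply: ge0_subset_integral => //; apply/measurable_EFinP; apply: measurableT_comp => //.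
  apply: measurable_funB => //; apply: measurable_funS fLp.1 => //; exact: ballK.
apply: le_trans i1 _; rewrite -EFinM lee_fin.
have -> : M%:R^-1 ^+ size w * (C0 * M%:R * q ^+ m * J) =
  M%:R * M%:R^-1 ^+ size w * (C0 * q ^+ m * J) by ring.
have -> : C0 * M%:R^-1 ^+ m * q ^+ m * J = M%:R^-1 ^+ m * (C0 * q ^+ m * J) by ring.
apply: ler_wpM2r; first by rewrite !mulr_ge0 // exprn_ge0.
have : M%:R^-1 ^+ m.+1 <= M%:R^-1 ^+ size w :> R.
  by rewrite ler_wiXn2l ?(cardV_ge0 nf) // invf_le1 // (card_gt0 nf).
have -> : M%:R^-1 ^+ m = M%:R * M%:R^-1 ^+ m.+1 :> R.
  by rewrite exprS mulrA mulfV ?mul1r // (card_neq0 nf).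
by move=> H; rewrite ler_pM2l // (card_gt0 nf).
Qed.

Let G := fine (\int[nu]_(y in K) (g y `^ p)%:E)%E.

Let I_le_G x r : I x r <= G.
Proof.
have mB := measurable_eball nf.
apply: fine_le; [by apply: gp_fin => // z []..|].
by apply: ge0_subset_integral => // z _; rewrite lee_fin powR_ge0.
Qed.

Let powRp_mono a b : 0 <= a -> a <= b -> a `^ p^-1 <= b `^ p^-1.
Proof.
move=> a0 ab; apply: ge0_ler_powR; rewrite ?nnegrE ?invr_ge0 ?(ltW p0) //.
exact: le_trans ab.
Qed.

(** The cell averages of f converge to F in two passes. The first uses the total integral of g^p and
    yields the continuous F and f = F almost everywhere; the second repeats the chain with the
    integral over a ball around x, which is what the sum over cells needs later. *)
Lemma poincare_holder : exists (F : X -> R) (C : R) (m0 : nat) (Z : set (borel R N)),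
  [/\ 0 <= C, measurable Z, mu Z = 0%E, forall x, K x -> ~ Z x -> f x = F x &
    forall m x y, (m0 <= m)%N -> K x -> K y -> edist x y <= L^-1 ^+ m ->
      `|F x - F y| <= C * q ^+ m * I x (4 * A * L^-1 ^+ m) `^ p^-1].
Proof.
pose a w := meanval mu f (cell phi K w).
have [C C0 HC] := poincare_ball_cells.
have q0 := ltW q_gt0.
have third : 0 < 3^-1 :> R by rewrite invr_gt0.
have [m0 Hm0] := expr_arbitrarily_small (scaleV_ge0 nf) (scaleV_lt1 nf) third.
have {}Hm0 k : (m0 <= k)%N -> 3 * L^-1 ^+ k < 1.
  by move=> /Hm0; rewrite -ltr_pdivlMl // mulr1.
have Lk0 k : 0 <= L^-1 ^+ k by rewrite exprn_ge0 // (scaleV_ge0 nf).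
have L3 k : L^-1 ^+ k <= 3 * L^-1 ^+ k by rewrite ler_peMl // ler1n.
have L2 k : L^-1 ^+ k + L^-1 ^+ k <= 3 * L^-1 ^+ k by have := Lk0 k; lra.
have LA k : 0 + A * (3 * L^-1 ^+ k) <= 4 * A * L^-1 ^+ k.
  have := mulr_ge0 (le_trans ler01 A1) (Lk0 k); lra.
have LA' k : L^-1 ^+ k + A * (3 * L^-1 ^+ k) <= 4 * A * L^-1 ^+ k.
  have := ler_wpM2r (Lk0 k) A1; lra.
pose J x k := I x (A * (3 * L^-1 ^+ k)) `^ p^-1.
have J0 x k : 0 <= J x k by exact: powR_ge0.
(* The uniform bound on all local integrals, used in the first pass only. *)
pose GG := G `^ p^-1; have JG x k : J x k <= GG by apply: powRp_mono.
have GG0 : 0 <= GG by exact: powR_ge0.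
have Jdec x k m : (m <= k)%N -> J x k <= J x m.
  move=> mk; apply: powRp_mono => //; apply: I_mono => z [Kz xz]; split=> //.
  rewrite (le_trans xz) // !ler_pM2l ?(lt_le_trans ltr01 A1) //.
  by rewrite ler_wiXn2l ?(scaleV_ge0 nf) // ltW // (scaleV_lt1 nf).
have S1 x k w w' : (m0 <= k)%N -> K x -> (size w <= k.+1)%N -> (size w' <= k.+1)%N ->
    cell phi K w `<=` eball K x (3 * L^-1 ^+ k) ->
    cell phi K w' `<=` eball K x (3 * L^-1 ^+ k) ->
    `|a w - a w'| <= 2 * C * q ^+ k * J x k.
  move=> mk Kx sw sw' wB w'B; have [c [_ Hc]] := HC k x Kx (Hm0 k mk).
  have h1 := Hc w sw wB; have h2 := Hc w' sw' w'B.
  rewrite (le_trans (ler_distD c _ _)) // [`|c - _|]distrC.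
  apply: le_trans (lerD h1 h2) _; rewrite -/(J x k).
  by rewrite le_eqVlt; apply/orP; left; apply/eqP; ring.
have S2 x k w w' : (m0 <= k)%N -> (size w <= k.+1)%N -> (size w' <= k.+1)%N ->
    (k <= size w)%N -> (k <= size w')%N ->
    cell phi K w x -> cell phi K w' x -> `|a w - a w'| <= 2 * C * q ^+ k * J x k.
  move=> mk sw sw' kw kw' wx w'x; apply: S1 => //; first exact: (cell_sub_K nf wx).
    exact: (cell_sub_eball nf wx kw).
  exact: (cell_sub_eball nf w'x kw').
pose C1 := 2 * C * GG; have C10 : 0 <= C1 by rewrite !mulr_ge0.
have S3 x k : 2 * C * q ^+ k * J x k <= C1 * q ^+ k.
  rewrite /C1 mulrAC; apply: ler_wpM2r; first exact: exprn_ge0.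
  by rewrite ler_wpM2l // mulr_ge0.
have [F Fcont HF] : exists2 F : X -> R, {within K, continuous F} &
    forall w x, (m0 <= size w)%N -> cell phi K w x ->
      `|a w - F x| <= C1 * (1 + 2 / (1 - q)) * q ^+ size w.
  apply: (cell_limit nf) => // [w i mw|w w' mw ww' [x [wx w'x]]].
    have [x Kx] := nf_nonempty nf.
    have ix : cell phi K (rcons w i) (phiw phi (rcons w i) x) by exists x.
    have wx := cell_rcons_sub nf ix.
    by apply: le_trans (S3 _ _); apply: S2 wx ix; rewrite // size_rcons.
  by apply: le_trans (S3 x _); apply: S2 wx w'x; rewrite // -ww'.
set D := C1 * _ in HF.
have D0 : 0 <= D by rewrite mulr_ge0 // addr_ge0 // divr_ge0 // subr_ge0 ltW.
clearbody D.
have mF := continuous_within_measurable (K_closed nf) Fcont.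
have mf : measurable_fun (K : set (borel R N)) f by case: fLp.
have mfF : measurable_fun (K : set (borel R N)) (fun y => f y - F y).
  exact: measurable_funB.
have mV := countable_borel (Vinf_countable nf).
have V0 := countable_null (mu_point nf hmu) (Vinf_countable nf).
pose C2 := C * M%:R^-1 ^+ 0 * GG + (C * GG + D).
(* On each cell of level k, f is compared with the mean c over a ball around a point of the cell, c
   with the cell average, and the average with F. The M^k cells have mass M^-k, so the factor q^k
   survives the summation. *)
have small k : (m0 <= k)%N ->
    (\int[mu]_(y in K) `|(f y - F y)%:E| <= (C2 * q ^+ k)%:E)%E.
  move=> mk; have mc (u : k.-tuple 'I_M) := measurable_cell nf u.
  have qk0 : 0 <= q ^+ k by exact: exprn_ge0.
  have E0 : 0 <= C * q ^+ k * GG + D * q ^+ k.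
    exact: addr_ge0 (mulr_ge0 (mulr_ge0 C0 qk0) GG0) (mulr_ge0 D0 qk0).
  have subK (u : k.-tuple 'I_M) : cell phi K u `<=` K by exact: (cell_sub_K nf).
  have IS := @integral_le_sum _ _ _ mu _ _ _ _ mc mK mV V0 predT
    (fun _ y => `|(f y - F y)%:E|%E) (fun y => `|(f y - F y)%:E|%E).
  apply: le_trans (IS _ _ _ _ _) _ => //.
  - by move=> x Kx; have [u] := tuple_cell_ex nf k Kx; exists u.
  - move=> u; apply: measurableT_comp => //; apply/measurable_EFinP.
    exact: measurable_funS mfF.
  apply: (@le_trans _ _ (\sum_(u : k.-tuple 'I_M) (M%:R^-1 ^+ k * (C2 * q ^+ k))%:E)%E).
    apply: lee_sum => u _.
    have [x Kx] := nf_nonempty nf.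
    have ux : cell phi K u (phiw phi u x) by exists x.
    have Kux := cell_sub_K nf ux; set z := phiw phi u x in ux Kux.
    have [c [Hc1 Hc2]] := HC k z Kux (Hm0 k mk).
    have uB : cell phi K u `<=` eball K z (3 * L^-1 ^+ k).
      by apply: (cell_sub_eball nf (m := k) ux) => //; rewrite size_tuple.
    have ac := Hc2 u _ uB; rewrite size_tuple leqnSn in ac; have {}ac := ac isT.
    have mfc : measurable_fun (cell phi K u : set (borel R N)) (fun y => f y - c).
      by apply: measurable_funB => //; exact: measurable_funS mf.
    apply: (@le_trans _ _ (\int[mu]_(y in cell phi K u)
       ((`|f y - c|)%:E + (C * q ^+ k * GG + D * q ^+ k)%:E))%E).
      apply: ge0_le_integral_nomeas => // y uy; rewrite /= -EFinD lee_fin.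
      rewrite (le_trans (ler_distD c _ _)) // lerD2l.
      rewrite (le_trans (ler_distD (a u) _ _)) // [`|c - _|]distrC; apply: lerD.
        apply: le_trans ac _; apply: ler_wpM2l; last exact: JG.
        exact: mulr_ge0.
      by have := HF u y; rewrite size_tuple; apply.
    rewrite ge0_integralD //; last first.
      by apply/measurable_EFinP; exact: measurableT_comp.
    rewrite integral_cst // (mu_cell nf hmu) size_tuple.
    have H : (\int[mu]_(y in cell phi K u) (`|f y - c|)%:E
      <= (C * M%:R^-1 ^+ k * q ^+ k * GG)%:E)%E.
      apply: (@le_trans _ _ (\int[mu]_(y in eball K z (3 * L^-1 ^+ k)) (`|f y - c|)%:E)%E).
        apply: ge0_subset_integral => //; first exact: (measurable_eball nf).
        apply/measurable_EFinP; apply: measurableT_comp => //.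
        by apply: measurable_funB => //; apply: measurable_funS mf => // ? [].
      apply: le_trans Hc1 _; rewrite lee_fin; apply: ler_wpM2l; last exact: JG.
      apply: mulr_ge0 => //; apply: mulr_ge0 => //; exact: exprn_ge0 (cardV_ge0 nf).
    apply: le_trans (leeD H (lexx _)) _.
    rewrite -EFinM -EFinD lee_fin /C2 expr0.
    by rewrite le_eqVlt; apply/orP; left; apply/eqP; ring.
  rewrite sumEFin sumr_const card_tuple card_ord lee_fin -[leLHS]mulr_natl natrX mulrA -exprMn.
  by rewrite mulfV ?expr1n ?mul1r // (card_neq0 nf).
have zero : (\int[mu]_(y in K) `|(f y - F y)%:E| = 0)%E.
  have I0 : (0 <= \int[mu]_(y in K) `|(f y - F y)%:E|)%E by exact: integral_ge0.
  have fin : (\int[mu]_(y in K) `|(f y - F y)%:E|)%E \is a fin_num.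
    by rewrite ge0_fin_numE // (le_lt_trans (small m0 _)) // ltry.
  apply/eqP; rewrite eq_le I0 andbT -(fineK fin) lee_fin.
  apply: (@le_of_geometric_error _ _ _ C2 q m0) => // k mk.
  by rewrite add0r -lee_fin (fineK fin) small.
have [Z [mZ Z0 HZ]] : exists Z : set (borel R N),
    [/\ measurable Z, mu Z = 0%E & forall x, K x -> ~ Z x -> f x = F x].
  have mE : measurable_fun (K : set (borel R N)) (fun y => (f y - F y)%:E).
    exact/measurable_EFinP.
  have [Z [mZ Z0 HZ]] := (ae_eq_integral_abs mu mK mE).1 zero.
  exists Z; split => // x Kx nZ; apply: contrapT => fF; apply: nZ; apply: HZ => /=.
  move=> /(_ Kx) [] /eqP; rewrite subr_eq0 => /eqP; exact: fF.
clear small zero mfF mf mF Fcont intf; clearbody a C1.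
exists F, (2 * C / (1 - q) * 2 + 2 * C), m0, Z.
have q1' : 0 <= (1 - q)^-1 by rewrite invr_ge0 subr_ge0 ltW.
have C20 : 0 <= 2 * C := mulr_ge0 (ler0n _ 2) C0.
have CQ : 0 <= 2 * C / (1 - q) := mulr_ge0 C20 q1'.
split; [exact: addr_ge0 (mulr_ge0 CQ (ler0n _ 2)) C20|exact: mZ|exact: Z0|exact: HZ|].
(* Second pass: by [Jdec] the integrals over all smaller balls are at most [J x m], and
   [geometric_tail] removes the global constant [D]. *)
have loc x m : (m0 <= m)%N -> K x -> exists w, [/\ size w = m, cell phi K w x &
    `|a w - F x| <= 2 * C * J x m / (1 - q) * q ^+ m].
  move=> mm Kx; have /choice[ww Hww] : forall k, exists w, size w = k /\ cell phi K w x.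
    by move=> k; have [w] := cell_ex nf k Kx; exists w.
  exists (ww m); split; [exact: (Hww m).1|exact: (Hww m).2|].
  apply: (@geometric_tail _ (a \o ww) (2 * C * J x m) q (F x) D m
    (mulr_ge0 C20 (J0 _ _)) q0 q_lt1) => k mk.
  - have [sk xk] := Hww k; have [sk1 xk1] := Hww k.+1.
    have kw : (k <= size (ww k) <= k.+1)%N by rewrite sk leqnn leqnSn.
    have kw1 : (k <= size (ww k.+1) <= k.+1)%N by rewrite sk1 leqnn leqnSn.
    have [/andP[k1 k2] /andP[k3 k4]] := (kw, kw1).
    apply: le_trans (S2 x k _ _ (leq_trans mm mk) k2 k4 k1 k3 xk xk1) _.
    rewrite mulrAC; apply: ler_wpM2r; first exact: exprn_ge0.
    exact: ler_wpM2l C20 _ _ (Jdec _ _ _ mk).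
  - have [sk xk] := Hww k; have := HF (ww k) x; rewrite sk => H; exact: H (leq_trans mm mk) xk.
move=> m x y mm Kx Ky xy.
have [w [sw wx awx]] := loc x m mm Kx; have [w' [sw' w'y awy]] := loc y m mm Ky.
have wB : cell phi K w `<=` eball K x (3 * L^-1 ^+ m).
  by apply: (cell_sub_eball nf (m := m) wx) => //; rewrite sw.
have w'B : cell phi K w' `<=` eball K x (3 * L^-1 ^+ m).
  apply: subset_trans (eball_shift xy (L2 m)).
  by apply: (cell_sub_eball nf (m := m) w'y) => //; rewrite sw'.
have sm : (m <= m.+1)%N by exact: leqnSn.
have aww : `|a w - a w'| <= 2 * C * q ^+ m * J x m.
  by apply: (S1 x m w w' mm Kx) => //; rewrite ?sw ?sw'.
set J4 := I x _ `^ p^-1.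
have Jx : J x m <= J4.
  apply: powRp_mono; [exact: I_ge0|apply: I_mono; apply: eball_shift (LA m)].
  by rewrite edistxx.
have Jy : J y m <= J4.
  by apply: powRp_mono; [exact: I_ge0|apply: I_mono; exact: eball_shift xy (LA' m)].
have J40 : 0 <= J4 by exact: powR_ge0.
have qm0 : 0 <= q ^+ m by exact: exprn_ge0.
have bx : `|F x - a w| <= 2 * C / (1 - q) * q ^+ m * J4.
  rewrite distrC; apply: le_trans awx _.
  have -> : 2 * C * J x m / (1 - q) * q ^+ m = 2 * C / (1 - q) * q ^+ m * J x m by ring.
  exact: ler_wpM2l (mulr_ge0 CQ qm0) _ _ Jx.
have by_ : `|a w' - F y| <= 2 * C / (1 - q) * q ^+ m * J4.
  apply: le_trans awy _.
  have -> : 2 * C * J y m / (1 - q) * q ^+ m = 2 * C / (1 - q) * q ^+ m * J y m by ring.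
  exact: ler_wpM2l (mulr_ge0 CQ qm0) _ _ Jy.
have bw : `|a w - a w'| <= 2 * C * q ^+ m * J4.
  by apply: le_trans aww _; exact: ler_wpM2l (mulr_ge0 C20 qm0) _ _ Jx.
have -> : F x - F y = (F x - a w) + (a w - a w') + (a w' - F y) by ring.
apply: le_trans (ler_normD _ _) _.
apply: le_trans (lerD (ler_normD _ _) (lexx _)) _.
apply: le_trans (lerD (lerD bx bw) by_) _.
by rewrite le_eqVlt; apply/orP; left; apply/eqP; ring.
Qed.

Let near m := near_cells (phi := phi) (K := K) (4 * A * L^-1 ^+ m).

Let Ic w := fine (\int[nu]_(y in cell phi K w) (g y `^ p)%:E)%E.

Let Ic_ge0 w : 0 <= Ic w.
Proof. exact: fine_ge0. Qed.

Let IcE w : (\int[nu]_(y in cell phi K w) (g y `^ p)%:E)%E = (Ic w)%:E.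
Proof.
by rewrite fineK //; apply: gp_fin; [exact: (measurable_cell nf)|exact: (cell_sub_K nf)].
Qed.

Let mV := countable_borel (Vinf_countable nf).
Let nuV := countable_null nu1 (Vinf_countable nf).
Let gpK w : measurable_fun (cell phi K w : set (borel R N)) (fun y => (g y `^ p)%:E).
Proof. by apply: measurable_funS mgp => //; exact: (cell_sub_K nf). Qed.

Lemma sum_cell_integrals_le m : \sum_(u : m.-tuple 'I_M) Ic u <= G.
Proof.
have mc (u : m.-tuple 'I_M) := measurable_cell nf u.
have H := @sum_integral_le _ _ _ nu _ _ _ _ mc mK mV nuV predT
  (fun _ y => (g y `^ p)%:E) (fun y => (g y `^ p)%:E).
have GE : (\int[nu]_(y in K) (g y `^ p)%:E)%E = G%:E.
  by rewrite fineK //; apply: gp_fin.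
rewrite -lee_fin -sumEFin -GE; under eq_bigr do rewrite -IcE.
apply: H => // [u _|u v||].
- exact: (cell_sub_K nf).
- move=> x _ _ ux vx uv; apply: (cell_meet_Vinf nf hmu _ _ ux vx).
    by rewrite !size_tuple.
  by move=> E; apply: uv; exact: val_inj.
- by move=> u y _; rewrite lee_fin powR_ge0.
- by move=> y _; rewrite lee_fin powR_ge0.
Qed.

Lemma ball_integral_le_near_cells m x (w : m.-tuple 'I_M) : cell phi K w x ->
  I x (4 * A * L^-1 ^+ m) <= \sum_(u : m.-tuple 'I_M | near m w u) Ic u.
Proof.
move=> wx; have mc (u : m.-tuple 'I_M) := measurable_cell nf u.
have mB := measurable_eball nf x (4 * A * L^-1 ^+ m).
have H := @integral_le_sum _ _ _ nu _ _ _ _ mc mB mV nuV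
  [pred u : m.-tuple 'I_M | near m w u]
  (fun _ y => (g y `^ p)%:E) (fun y => (g y `^ p)%:E).
rewrite -lee_fin -sumEFin fineK; last by apply: gp_fin => // y [].
under eq_bigr do rewrite -IcE.
apply: H => // [y [Ky xy]|u y _|y _]; rewrite ?lee_fin ?powR_ge0 //.
have [u uy] := tuple_cell_ex nf m Ky; exists u => //=.
by apply/asboolP; exists x, y.
Qed.

Let q_exprn_powR m : (q ^+ m) `^ p = (L^-1 ^+ m) `^ (p * sigma) * M%:R ^+ m.
Proof.
rewrite !powR_exprn ?(scaleV_ge0 nf) ?(ltW q_gt0) // -exprMn; congr (_ ^+ m).
rewrite powRM ?powR_ge0 // -!powRrM mulVf ?gt_eqF // powRr1 //.
by rewrite [sigma * p]mulrC.
Qed.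

(** For eps between L^-(m+1) and L^-m the inner average is bounded on each cell of level m by the
    nu-integral of g^p over nearby cells. Summed over all cells, each of these integrals occurs a
    bounded number of times. *)
Lemma poincare_subset_KS : KS_space K mu p sigma f.
Proof.
split=> //; have [F [C [m0 [Z [C0 mZ Z0 fF HF]]]]] := poincare_holder.
have A0 : 0 <= 4 * A by exact: mulr_ge0 (ler0n _ 4) (le_trans ler01 A1).
have [n Hn] := near_cells_card nf hmu A0.
have ps0 := ltW (mulr_gt0 p0 sigma0); have p0' := ltW p0; have s0' := ltW sigma0.
(* Replacing eps by L^-(m+1) instead of L^-m costs the factor L^(p sigma). *)
pose C1 := C `^ p / (L^-1 `^ (p * sigma)).
have Lp0 : 0 < L^-1 `^ (p * sigma) by rewrite powR_gt0 // invr_gt0 (scale_gt0 nf).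
have C10 : 0 <= C1 by exact: divr_ge0 (powR_ge0 _ _) (ltW Lp0).
have Lk0 k : 0 < L^-1 ^+ k by rewrite exprn_gt0 // invr_gt0 (scale_gt0 nf).
have p00 : p != 0 by rewrite gt_eqF.
apply/limf_esup_at_right0; exists (L^-1 ^+ m0), (C1 * (n%:R * G)).
split=> // eps eps0 epsm.
have eps1 : eps <= 1.
  by rewrite (le_trans (ltW epsm)) // exprn_ile1 ?(scaleV_ge0 nf) // ltW // (scaleV_lt1 nf).
have [m [me em]] := scale_floor nf eps0 eps1.
have mm : (m0 <= m)%N.
  have := lt_trans me epsm; rewrite ltr_iXn2l ?invr_gt0 ?(scale_gt0 nf) ?(scaleV_lt1 nf) //.
have mc (u : m.-tuple 'I_M) := measurable_cell nf u.
(* In (q^m)^p = L^(-m p sigma) M^m the power of L is absorbed by eps^(p sigma); the factor M^m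
   cancels against the mass of the cell. *)
pose T (w : m.-tuple 'I_M) := C1 * M%:R ^+ m * \sum_(u : m.-tuple 'I_M | near m w u) Ic u.
have T0 w : 0 <= T w.
  by apply: mulr_ge0; [exact: mulr_ge0 C10 (exprn_ge0 _ (ler0n _ _))|exact: sumr_ge0].
pose Psi x := ((fine (mu (eball K x eps)))^-1%:E *
  \int[mu]_(y in eball K x eps) (`|f x - f y| `^ p / eps `^ (p * sigma))%:E)%E.
have Psi0 x : (0 <= Psi x)%E.
  rewrite mule_ge0 ?lee_fin ?invr_ge0 ?fine_ge0 //; apply: integral_ge0 => y _.
  by rewrite lee_fin divr_ge0 ?powR_ge0.
have PsiT (w : m.-tuple 'I_M) x : cell phi K w x -> K x -> ~ Z x -> (Psi x <= (T w)%:E)%E.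
  move=> wx Kx nZ; have mB := measurable_eball nf x eps.
  have B0 : 0 < fine (mu (eball K x eps)).
    apply: lt_le_trans (mu_eball_ge nf hmu Kx (ltW me)).
    by rewrite exprn_gt0 // invr_gt0 (card_gt0 nf).
  rewrite lee_pdivrMl //.
  apply: (@le_trans _ _ (\int[mu]_(y in eball K x eps) (T w)%:E)%E); last first.
    by rewrite integral_cst // muleC EFinM fineK //; exact: (mu_fin nf hmu).
  apply: (ge0_le_integral_ae mB mZ Z0) => // [y _|y _|y [Ky xy] nZy].
  - by rewrite lee_fin divr_ge0 ?powR_ge0.
  - by rewrite lee_fin.
  rewrite lee_fin (fF x Kx nZ) (fF y Ky nZy).
  have h1 := HF m x y mm Kx Ky (le_trans xy em).
  set J := I x _ in h1; have J0 : 0 <= J by exact: I_ge0.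
  have q0 := ltW q_gt0.
  have h2 : `|F x - F y| `^ p <= C `^ p * (q ^+ m) `^ p * J.
    have -> : C `^ p * (q ^+ m) `^ p * J = (C * q ^+ m * J `^ p^-1) `^ p.
      rewrite powRM ?powR_ge0 //; last exact: mulr_ge0 C0 (exprn_ge0 _ q0).
      rewrite [(C * _) `^ p]powRM //; last exact: exprn_ge0.
      by rewrite -[in RHS]powRrM mulVf // powRr1.
    apply: ge0_ler_powR; rewrite ?nnegrE //.
    exact: mulr_ge0 (mulr_ge0 C0 (exprn_ge0 _ q0)) (powR_ge0 _ _).
  have h3 : (L^-1 ^+ m.+1) `^ (p * sigma) <= eps `^ (p * sigma).
    by apply: (ge0_ler_powR ps0); rewrite ?nnegrE ?(ltW eps0) ?(ltW (Lk0 _)) // ltW.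
  have h4 := q_exprn_powR m.
  have h5 : (L^-1 ^+ m.+1) `^ (p * sigma) = L^-1 `^ (p * sigma) * (L^-1 ^+ m) `^ (p * sigma).
    by rewrite exprS powRM ?(scaleV_ge0 nf) // exprn_ge0 // (scaleV_ge0 nf).
  have P0 : 0 < (L^-1 ^+ m) `^ (p * sigma) by rewrite powR_gt0.
  have e0 : 0 < eps `^ (p * sigma) by rewrite powR_gt0.
  rewrite ler_pdivrMr //; apply: le_trans h2 _.
  apply: (@le_trans _ _ (T w * (L^-1 ^+ m.+1) `^ (p * sigma))); last exact: ler_wpM2l.
  rewrite h4 h5 /T /C1.
  have -> : C `^ p / L^-1 `^ (p * sigma) * M%:R ^+ m *
     (\sum_(u : m.-tuple 'I_M | near m w u) Ic u) *
     (L^-1 `^ (p * sigma) * (L^-1 ^+ m) `^ (p * sigma)) =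
     C `^ p * ((L^-1 ^+ m) `^ (p * sigma) * M%:R ^+ m) *
     (\sum_(u : m.-tuple 'I_M | near m w u) Ic u) by field; rewrite gt_eqF.
  apply: ler_wpM2l; last exact: ball_integral_le_near_cells.
  exact: mulr_ge0 (powR_ge0 _ _) (mulr_ge0 (ltW P0) (exprn_ge0 _ (ler0n _ _))).
have H := @integral_le_sum _ _ _ mu _ _ _ _ mc mK mZ Z0 predT
  (fun w _ => (T w)%:E) Psi.
apply: le_trans (H _ _ _ _ _) _ => //.
- by move=> x Kx; have [u] := tuple_cell_ex nf m Kx; exists u.
- by move=> w x _; rewrite lee_fin.
- by move=> w x _; exact: PsiT.
rewrite (eq_bigr (fun w : m.-tuple 'I_M => (C1 * \sum_(u : m.-tuple 'I_M | near m w u) Ic u)%:E)); last first.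
  move=> w _; rewrite integral_cst // (mu_cell nf hmu) size_tuple -EFinM /T.
  congr EFin; rewrite exprVn; field.
  by rewrite expf_neq0 // (card_neq0 nf).
rewrite sumEFin lee_fin -mulr_sumr; apply: ler_wpM2l => //.
(* After the exchange [Ic u] is counted once for each w near u; nearness is symmetric, so [Hn]
   bounds their number by n. *)
rewrite (exchange_big_dep predT) //=.
apply: (@le_trans _ _ (\sum_(u : m.-tuple 'I_M) n%:R * Ic u)); last first.
  by rewrite -mulr_sumr ler_wpM2l // sum_cell_integrals_le.
apply: ler_sum => u _; rewrite big_const iter_addr_0 -[leLHS]mulr_natl.
apply: ler_wpM2r => //; rewrite ler_nat; apply: leq_trans (Hn m u).
apply: subset_leq_card; apply/fintype.subsetP => w; rewrite !unfold_in => /asboolP[x [y [wx uy xy]]].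
by apply/asboolP; exists y, x; rewrite edistC.
Qed.

End PoincareToKS.

(** * Discrete and limit energies *)

Lemma cvg_le_bound (R : realType) (u : nat -> R) (l b : R) : u @ \oo --> l ->
  (exists m, forall k, (m <= k)%N -> u k <= b) -> l <= b.
Proof.
move=> ul [m H]; rewrite -(cvg_lim (@norm_hausdorff _ _) ul).
by apply: limr_le; [apply/cvg_ex; exists l|exists m].
Qed.

Lemma cvg_ge_bound (R : realType) (u : nat -> R) (l b : R) : u @ \oo --> l ->
  (exists m, forall k, (m <= k)%N -> b <= u k) -> b <= l.
Proof.
move=> ul [m H]; rewrite -(cvg_lim (@norm_hausdorff _ _) ul).
by apply: limr_ge; [apply/cvg_ex; exists l|exists m].
Qed.

(** * Sums over words of fixed length *)

Section WordSums.
Context {R : realType} {M : nat}.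
Implicit Types F : seq 'I_M -> R.

Lemma sum_tuple0 F : \sum_(w : 0.-tuple 'I_M) F w = F [::].
Proof.
rewrite (big_pred1 [tuple]) // => w; apply/esym/eqP; exact: tuple0.
Qed.

Lemma sum_tuple_cons m F : \sum_(w : m.+1.-tuple 'I_M) F w =
  \sum_(i < M) \sum_(w : m.-tuple 'I_M) F (i :: w).
Proof.
rewrite pair_big /= (reindex (fun p : 'I_M * m.-tuple 'I_M => [tuple of p.1 :: p.2])) //=.
exists (fun w => (thead w, [tuple of behead w])) => [[i w] _|w _] /=.
  by congr pair; apply: val_inj.
by rewrite -tuple_eta.
Qed.

Lemma sum_tuple_cat m k F : \sum_(w : (m + k).-tuple 'I_M) F w =
  \sum_(w : m.-tuple 'I_M) \sum_(u : k.-tuple 'I_M) F (w ++ u).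
Proof.
elim: m F => [|m IH] F.
  by rewrite (sum_tuple0 (fun w => \sum_(u : k.-tuple 'I_M) F (w ++ u))).
rewrite addSn sum_tuple_cons.
rewrite (sum_tuple_cons m (fun w => \sum_(u : k.-tuple 'I_M) F (w ++ u))).
by apply: eq_bigr => i _; exact: (IH (fun u => F (i :: u))).
Qed.

Lemma sum_tuple_rcons m F : \sum_(w : m.+1.-tuple 'I_M) F w =
  \sum_(w : m.-tuple 'I_M) \sum_(i < M) F (rcons w i).
Proof.
rewrite -addn1 sum_tuple_cat; apply: eq_bigr => w _.
rewrite (sum_tuple_cons 0 (fun u => F (w ++ u))); apply: eq_bigr => i _.
by rewrite (sum_tuple0 (fun u => F (w ++ i :: u))) cats1.
Qed.

End WordSums.

Section ConnectedOscillation.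
Context {R : realType} {X : choiceType}.

Lemma path_osc (adj : X -> X -> Prop) (f : X -> R) (delta : R) x (s : seq X) :
  (forall x y, adj x y -> `|f x - f y| <= delta) ->
  path (fun u v => `[< adj u v >]) x s -> `|f x - f (last x s)| <= (size s)%:R * delta.
Proof.
move=> H; elim: s x => [|y s IH] x /=; first by rewrite subrr normr0 mul0r.
move=> /andP[/asboolP xy /IH ys].
rewrite (le_trans (ler_distD (f y) _ _)) // -natr1 mulrDl mul1r addrC.
by rewrite lerD // H.
Qed.

End ConnectedOscillation.

Lemma finite_set_enum (X : choiceType) (V : set X) : finite_set V ->
  exists s : seq X, uniq s /\ V = [set` s].
Proof.
move=> /finite_seqP[s ->]; exists (undup s); rewrite undup_uniq; split=> //.
by apply/seteqP; split=> x /=; rewrite mem_undup.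
Qed.

Lemma connected_osc {R : realType} {N : nat} (V : set 'rV[R]_N)
    (adj : 'rV[R]_N -> 'rV[R]_N -> Prop) : finite_set V -> graph_connected V adj ->
  exists n : nat, forall (f : 'rV[R]_N -> R) delta, 0 <= delta ->
    (forall x y, adj x y -> `|f x - f y| <= delta) ->
    forall x y, V x -> V y -> `|f x - f y| <= n%:R * delta.
Proof.
move=> finV cV.
have /choice[s Hs] : forall p : 'rV[R]_N * 'rV[R]_N, exists s : seq 'rV[R]_N,
    V p.1 -> V p.2 -> path (fun u v => `[< adj u v >]) p.1 s /\ last p.1 s = p.2.
  move=> [x y] /=; have [[Vx Vy]|n] := pselect (V x /\ V y); last first.
    by exists [::] => Vx Vy; exfalso; apply: n.
  by have [s Hs] := cV x y Vx Vy; exists s.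
have [sV [uV VE]] := finite_set_enum finV.
(* The total length of all chosen paths bounds each of them, uniformly in f. *)
exists (\sum_(x <- sV) \sum_(y <- sV) size (s (x, y)))%N => f delta d0 H x y Vx Vy.
have [Hp Hl] := Hs (x, y) Vx Vy; rewrite /= in Hp Hl.
rewrite -{1}Hl; apply: le_trans (path_osc H Hp) _; apply: ler_wpM2r => //.
rewrite ler_nat.
have xV : x \in sV by move: Vx; rewrite VE.
have yV : y \in sV by move: Vy; rewrite VE.
rewrite (bigD1_seq x) //= (bigD1_seq y) //= -!addnA.
exact: leq_addr.
Qed.

(** * Energy forms of finite level and their limit *)

Section DiscreteEnergy.
Context {R : realType} {N M : nat} {L : R} {phi : 'I_M -> 'rV[R]_N -> 'rV[R]_N}
  {K : set 'rV[R]_N} {a : 'rV[R]_N -> 'rV[R]_N -> R} {varrho : R}.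
Hypothesis nf : nested_fractal phi L K.
Hypothesis hs : harmonic_structure phi a varrho.
Local Notation X := 'rV[R]_N.
Local Notation E0 := (energy0 phi a).
Implicit Types f g : X -> R.

Definition V0_enum := sval (cid (finite_set_enum (V0_finite nf))).
Local Notation sV := V0_enum.

Lemma V0_enum_uniq : uniq sV.
Proof. by rewrite /V0_enum; case: cid => s []. Qed.

Lemma mem_V0 x : x \in sV <-> V0 phi x.
Proof. by rewrite /V0_enum; case: cid => s [us VE] /=; rewrite VE. Qed.

Lemma sum_V0E (F : X -> R) : \sum_(x \in V0 phi) F x = \sum_(x <- sV) F x.
Proof.
by rewrite /V0_enum; case: cid => s [us VE] /=; rewrite VE -fsbig_seq.
Qed.

Lemma energy0E f : E0 f = 2^-1 * \sum_(x <- sV) \sum_(y <- sV) a x y * (f x - f y) ^+ 2.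
Proof.
by rewrite /energy0 sum_V0E; congr (_ * _); apply: eq_bigr => x _; rewrite sum_V0E.
Qed.

Lemma conductance_term_ge0 x y f : x \in sV -> y \in sV -> 0 <= a x y * (f x - f y) ^+ 2.
Proof.
move=> /mem_V0 Vx /mem_V0 Vy; have [->|xy] := pselect (x = y).
  by rewrite subrr expr0n mulr0.
by rewrite mulr_ge0 ?sqr_ge0 // (cm_ge0 (hs_conductivity hs)).
Qed.

Lemma energy0_ge0 f : 0 <= E0 f.
Proof.
rewrite energy0E mulr_ge0 ?invr_ge0 // big_seq; apply: sumr_ge0 => x xV.
by rewrite big_seq; apply: sumr_ge0 => y yV; exact: conductance_term_ge0.
Qed.

Lemma energy0_eq f g : (forall x, V0 phi x -> f x = g x) -> E0 f = E0 g.
Proof.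
move=> H; rewrite !energy0E; congr (_ * _); rewrite big_seq [RHS]big_seq.
apply: eq_bigr => x /mem_V0 Vx; rewrite big_seq [RHS]big_seq.
by apply: eq_bigr => y /mem_V0 Vy; rewrite !H.
Qed.

Lemma energy0_parallelogram f g :
  E0 (f \+ g) + E0 (f \- g) = 2 * E0 f + 2 * E0 g.
Proof.
rewrite !energy0E -mulrDr.
set A := \sum_(x <- sV) \sum_(y <- sV) a x y * (f x - f y) ^+ 2.
set B := \sum_(x <- sV) \sum_(y <- sV) a x y * (g x - g y) ^+ 2.
have -> : 2 * (2^-1 * A) + 2 * (2^-1 * B) = 2^-1 * (2 * A + 2 * B) by ring.
congr (_ * _); rewrite /A /B.
rewrite !mulr_sumr -!big_split /=; apply: eq_bigr => x _.
rewrite !mulr_sumr -!big_split /=; apply: eq_bigr => y _.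
by ring.
Qed.

Lemma energy0Z c f : E0 (fun x => c * f x) = c ^+ 2 * E0 f.
Proof.
rewrite !energy0E mulrCA; congr (_ * _); rewrite mulr_sumr; apply: eq_bigr => x _.
by rewrite mulr_sumr; apply: eq_bigr => y _; ring.
Qed.

Lemma energy0_shift c f : E0 (fun x => f x + c) = E0 f.
Proof.
rewrite !energy0E; congr (_ * _); apply: eq_bigr => x _; apply: eq_bigr => y _.
by congr (_ * _ ^+ 2); ring.
Qed.

Lemma energy0_osc : exists2 C, 0 <= C & forall f x y, V0 phi x -> V0 phi y ->
  (f x - f y) ^+ 2 <= C * E0 f.
Proof.
have [n Hn] := connected_osc (V0_finite nf) (hs_irreducible hs).
(* Dominates 2 / a x y for every positive conductance; zero entries contribute nothing, since 0^-1 =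
   0. *)
pose C1 := 2 * \sum_(x <- sV) \sum_(y <- sV) `|(a x y)^-1|.
have C10 : 0 <= C1.
  by rewrite mulr_ge0 // sumr_ge0 // => x _; rewrite sumr_ge0.
exists (n%:R ^+ 2 * C1) => [|f x y Vx Vy]; first by rewrite mulr_ge0 ?sqr_ge0.
have E0f := energy0_ge0 f.
have D0 : 0 <= C1 * E0 f by rewrite mulr_ge0.
have := Hn f (Num.sqrt (C1 * E0 f)) (sqrtr_ge0 _) _ x y Vx Vy.
have H : forall x y, [/\ V0 phi x, V0 phi y, x <> y & 0 < a x y] ->
    `|f x - f y| <= Num.sqrt (C1 * E0 f).
  move=> u v [Vu Vv uv auv]; rewrite -sqrtr_sqr ler_wsqrtr //.
  have uV := (mem_V0 u).2 Vu; have vV := (mem_V0 v).2 Vv.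
  have h1 : a u v * (f u - f v) ^+ 2 <= 2 * E0 f.
    rewrite energy0E mulVKf // (bigD1_seq u) ?V0_enum_uniq //= (bigD1_seq v) ?V0_enum_uniq //= -addrA.
    rewrite lerDl addr_ge0 //.
      rewrite big_seq_cond; apply: sumr_ge0 => y' /andP[y'V _].
      exact: conductance_term_ge0.
    rewrite big_seq_cond; apply: sumr_ge0 => x' /andP[x'V _].
    by rewrite big_seq; apply: sumr_ge0 => y' y'V; exact: conductance_term_ge0.
  have h2 : 2 * (a u v)^-1 <= C1.
    rewrite ler_pM2l // /C1 (bigD1_seq u) ?V0_enum_uniq //= (bigD1_seq v) ?V0_enum_uniq //= -addrA.
    rewrite (le_trans (ler_norm _)) // lerDl addr_ge0 // sumr_ge0 // => x' _.
    by rewrite sumr_ge0.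
  apply: le_trans (ler_wpM2r E0f h2).
  by rewrite mulrAC ler_pdivlMr // mulrC.
move=> /(_ H) Hxy; rewrite -real_normK ?num_real //.
apply: le_trans (lerXn2r 2 _ _ Hxy) _; rewrite ?nnegrE ?mulr_ge0 ?sqrtr_ge0 //.
by rewrite exprMn sqr_sqrtr // mulrA.
Qed.

Lemma energy0_le_dev : exists2 C, 0 <= C & forall f c,
  E0 f <= C * \sum_(x <- sV) (f x - c) ^+ 2.
Proof.
pose A := \sum_(x <- sV) \sum_(y <- sV) `|a x y|.
have A0 : 0 <= A by rewrite sumr_ge0 // => x _; rewrite sumr_ge0.
exists (2 * A * (size sV)%:R) => [|f c]; first by rewrite !mulr_ge0.
rewrite energy0E.
have sum_const (t : R) : \sum_(x <- sV) t = (size sV)%:R * t.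
  by rewrite big_const_seq count_predT iter_addr_0 mulr_natl.
have H x y : x \in sV -> y \in sV -> a x y * (f x - f y) ^+ 2 <=
    A * (2 * (f x - c) ^+ 2 + 2 * (f y - c) ^+ 2).
  move=> xV yV; have aA : a x y <= A.
    rewrite /A (bigD1_seq x) ?V0_enum_uniq //= (bigD1_seq y) ?V0_enum_uniq //= -addrA (le_trans (ler_norm _)) // lerDl.
    by rewrite addr_ge0 // sumr_ge0 // => x' _; rewrite sumr_ge0.
  apply: le_trans (ler_wpM2r (sqr_ge0 _) aA) _; apply: ler_wpM2l => //.
  rewrite -subr_ge0.
  have -> : 2 * (f x - c) ^+ 2 + 2 * (f y - c) ^+ 2 - (f x - f y) ^+ 2 =
    (f x + f y - 2 * c) ^+ 2 by ring.
  exact: sqr_ge0.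
have -> : 2 * A * (size sV)%:R * \sum_(x <- sV) (f x - c) ^+ 2 =
   2^-1 * \sum_(x <- sV) \sum_(y <- sV) A * (2 * (f x - c) ^+ 2 + 2 * (f y - c) ^+ 2).
  have -> : \sum_(x <- sV) \sum_(y <- sV) A * (2 * (f x - c) ^+ 2 + 2 * (f y - c) ^+ 2)
      = \sum_(x <- sV) (A * 2 * (size sV)%:R * (f x - c) ^+ 2
          + A * 2 * \sum_(y <- sV) (f y - c) ^+ 2).
    apply: eq_bigr => x _; rewrite -mulr_sumr big_split /= -!mulr_sumr.
    by rewrite sum_const; ring.
  by rewrite big_split /= -mulr_sumr sum_const; field.
rewrite ler_wpM2l ?invr_ge0 // big_seq [leRHS]big_seq; apply: ler_sum => x xV.
by rewrite big_seq [leRHS]big_seq; apply: ler_sum => y yV; exact: H.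
Qed.

Lemma energy0_cvg (u : nat -> X -> R) f :
  (forall x, V0 phi x -> (fun k => u k x) @ \oo --> f x) ->
  (fun k => E0 (u k)) @ \oo --> E0 f.
Proof.
move=> H; rewrite energy0E; under eq_cvg do rewrite energy0E.
apply: cvgMl_tmp.
rewrite big_seq; under eq_cvg do rewrite big_seq.
apply: cvg_sumR => x /mem_V0 Vx; rewrite big_seq; under eq_cvg do rewrite big_seq.
apply: cvg_sumR => y /mem_V0 Vy; apply: cvgMl_tmp.
by apply: cvgM; apply: cvgB; exact: H.
Qed.

Definition energy1 (f : X -> R) : R := \sum_(i < M) E0 (f \o phi i).

Lemma energy1_ge0 f : 0 <= energy1 f.
Proof. by apply: sumr_ge0 => i _; exact: energy0_ge0. Qed.

Lemma energy1_parallelogram f g :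
  energy1 (f \+ g) + energy1 (f \- g) = 2 * energy1 f + 2 * energy1 g.
Proof.
rewrite /energy1 !mulr_sumr -!big_split /=; apply: eq_bigr => i _.
exact: (energy0_parallelogram (f \o phi i) (g \o phi i)).
Qed.

Lemma energy1Z c f : energy1 (fun x => c * f x) = c ^+ 2 * energy1 f.
Proof.
by rewrite /energy1 mulr_sumr; apply: eq_bigr => i _; exact: (energy0Z c (f \o phi i)).
Qed.

Let extensions (f : X -> R) := [set energy1 g |
  g in [set g : X -> R | forall x, V0 phi x -> g x = f x]].

Let extensions_inf f : has_inf (extensions f).
Proof.
split; first by exists (energy1 f), f.
by exists 0 => _ [g _ <-]; exact: energy1_ge0.
Qed.

Let extensions_infE f : inf (extensions f) = varrho^-1 * E0 f.
Proof. exact: hs_renormalization hs f. Qed.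

Lemma varrho_gt0 : 0 < varrho.
Proof. exact: lt_trans ltr01 (hs_varrho hs). Qed.

Lemma energy0_renorm_le f g : (forall x, V0 phi x -> g x = f x) ->
  varrho^-1 * E0 f <= energy1 g.
Proof.
move=> gf; rewrite -extensions_infE; apply: ge_inf; last by exists g.
by case: (extensions_inf f).
Qed.

Lemma V0_V1 : V0 phi `<=` Vm phi 1.
Proof. by move=> v Vv; have [i Hi] := V0_fix Vv; exists i => //; exists v. Qed.

Lemma V1_finite : finite_set (Vm phi 1).
Proof.
apply: bigcup_finite => [|i _]; first exact: finite_finset.
by apply: finite_image; exact: V0_finite nf.
Qed.

Lemma energy1_osc : exists2 C, 0 <= C & forall f x y, Vm phi 1 x -> Vm phi 1 y ->
  (f x - f y) ^+ 2 <= C * energy1 f.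
Proof.
have [C C0 HC] := energy0_osc.
have [n Hn] := connected_osc V1_finite (nf_connectivity nf).
exists (n%:R ^+ 2 * C) => [|f x y Vx Vy]; first by rewrite mulr_ge0 ?sqr_ge0.
have D0 : 0 <= C * energy1 f by rewrite mulr_ge0 ?energy1_ge0.
have H : forall x y, (exists i, (phi i @` V0 phi) x /\ (phi i @` V0 phi) y) ->
    `|f x - f y| <= Num.sqrt (C * energy1 f).
  move=> _ _ [i [[u Vu <-] [v Vv <-]]]; rewrite -sqrtr_sqr ler_wsqrtr //.
  apply: le_trans (HC (f \o phi i) u v Vu Vv) _; apply: ler_wpM2l => //.
  rewrite /energy1 (bigD1 i) //= lerDl sumr_ge0 // => j _; exact: energy0_ge0.
have := Hn f (Num.sqrt (C * energy1 f)) (sqrtr_ge0 _) H x y Vx Vy.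
move=> Hxy; rewrite -real_normK ?num_real //.
apply: le_trans (lerXn2r 2 _ _ Hxy) _; rewrite ?nnegrE ?mulr_ge0 ?sqrtr_ge0 //.
by rewrite exprMn sqr_sqrtr // mulrA.
Qed.

(* Any minimizing sequence is Cauchy by the parallelogram identity. *)
Lemma energy1_minimizer f : exists g, (forall x, V0 phi x -> g x = f x) /\
  energy1 g = varrho^-1 * E0 f.
Proof.
have half0 : (0 : R) < 2^-1 by rewrite invr_gt0.
have half1 : 2^-1 < 1 :> R by rewrite invf_lt1 // ltr1n.
have e0 k : (0 : R) < (2^-1 ^+ k) ^+ 2 by rewrite !exprn_gt0.
have /choice[u Hu] : forall k, exists g, (forall x, V0 phi x -> g x = f x) /\
    energy1 g < varrho^-1 * E0 f + (2^-1 ^+ k) ^+ 2.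
  move=> k; have [_ [g gf <-] Hg] := inf_adherent (e0 k) (extensions_inf f).
  by exists g; split => //; rewrite -extensions_infE.
have [C C0 HC] := energy1_osc.
have [v [_ [Vv _ _]]] := nf_V0 nf.
(* The midpoint of two extensions of f is again an extension, so the energy of their sum is at least
   four times the infimum; the parallelogram identity leaves only the two excesses. *)
have inc k : energy1 (u k \- u k.+1) <= 4 * (2^-1 ^+ k) ^+ 2.
  have [uk Ek] := Hu k; have [uk1 Ek1] := Hu k.+1.
  have P := energy1_parallelogram (u k) (u k.+1).
  have Q : 4 * (varrho^-1 * E0 f) <= energy1 (u k \+ u k.+1).
    have -> : energy1 (u k \+ u k.+1) =
        4 * energy1 (fun x => 2^-1 * (u k \+ u k.+1) x).
      by rewrite energy1Z; field.
    rewrite ler_pM2l //; apply: energy0_renorm_le => x Vx /=.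
    by rewrite uk // uk1 //; field.
  have le1 : (2^-1 ^+ k.+1) ^+ 2 <= (2^-1 ^+ k) ^+ 2 :> R.
    rewrite ler_pXn2r ?nnegrE ?exprn_ge0 ?(ltW half0) // exprS.
    by rewrite ler_piMl ?exprn_ge0 ?(ltW half0) // ltW.
  lra.
(* All extensions agree at the boundary vertex v, which turns the oscillation bound into a bound on
   values. *)
have step z k : Vm phi 1 z -> `|u k z - u k.+1 z| <= 2 * Num.sqrt C * 2^-1 ^+ k.
  move=> Vz; have [uk Ek] := Hu k; have [uk1 Ek1] := Hu k.+1.
  have := HC (u k \- u k.+1) z v Vz (V0_V1 Vv).
  rewrite /= (uk _ Vv) (uk1 _ Vv) subrr subr0 => /le_trans/(_ (ler_wpM2l C0 (inc k))) H.
  rewrite -sqrtr_sqr; apply: le_trans (ler_wsqrtr H) _.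
  have -> : C * (4 * (2^-1 ^+ k) ^+ 2) = (2 * 2^-1 ^+ k) ^+ 2 * C by ring.
  rewrite sqrtrM ?sqr_ge0 // sqrtr_sqr ger0_norm ?mulr_ge0 ?exprn_ge0 ?(ltW half0) //.
  by rewrite mulrAC.
have /choice[l Hl] : forall z, exists l : R, Vm phi 1 z -> (fun k => u k z) @ \oo --> l.
  move=> z; have [Vz|nz] := pselect (Vm phi 1 z); last by exists 0.
  have D0 : 0 <= 2 * Num.sqrt C by rewrite mulr_ge0.
  have [l Hl] := @geometric_limit _ (u^~ z) _ _ 0 D0 (ltW half0) half1 (fun k _ => step z k Vz).
  exists l => _; apply/cvgrPdist_lt => e e1.
  have D1 : 0 < 1 + 2 * Num.sqrt C / (1 - 2^-1) by rewrite ltr_wpDr // divr_ge0 // subr_ge0 ltW.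
  have De : 0 < e / (1 + 2 * Num.sqrt C / (1 - 2^-1)) by rewrite divr_gt0.
  have [m Hm] := expr_arbitrarily_small (ltW half0) half1 De.
  exists m => // k /= mk; rewrite distrC; apply: le_lt_trans (Hl k isT) _.
  have := Hm k mk; rewrite ltr_pdivlMr // => /le_lt_trans; apply.
  by rewrite mulrC ler_wpM2l ?exprn_ge0 ?(ltW half0) // lerDr.
have lf x : V0 phi x -> l x = f x.
  move=> Vx; have := Hl x (V0_V1 Vx).
  under eq_cvg do rewrite (Hu _).1 //.
  by move=> /(@cvg_unique _ (@norm_hausdorff _ _)); apply; exact: cvg_cst.
exists l; split => //; apply/eqP; rewrite eq_le energy0_renorm_le // andbT.
have cv : (fun k => energy1 (u k)) @ \oo --> energy1 l.
  apply: cvg_sumR => i _; apply: energy0_cvg => x Vx; apply: Hl.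
  by exists i => //; exists x.
have half2 : (2^-1 ^+ 2 < 1 :> R) by rewrite expr_lt1 // ltW.
apply/ler_addgt0Pr => e e1.
apply: (cvg_le_bound cv).
have [m Hm] := expr_arbitrarily_small (sqr_ge0 _) half2 e1.
exists m => // k /= mk; apply: le_trans (ltW (Hu k).2) _; rewrite lerD2l ltW //.
by have := Hm k mk; rewrite exprAC.
Qed.

Local Notation Em := (energym phi a varrho).
Local Notation dom := (energy_domain phi K a varrho).
Local Notation En := (energy phi a varrho).

Lemma varrho_ge0 m : 0 <= varrho ^+ m.
Proof. exact: exprn_ge0 (ltW varrho_gt0). Qed.

Lemma energym_ge0 m f : 0 <= Em m f.
Proof.
by apply: mulr_ge0; [exact: varrho_ge0|apply: sumr_ge0 => w _; exact: energy0_ge0].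
Qed.

Lemma energym0 f : Em 0 f = E0 f.
Proof.
by rewrite /energym expr0 mul1r (sum_tuple0 (fun w => E0 (f \o phiw phi w))).
Qed.

Lemma energym_mono m f : Em m f <= Em m.+1 f.
Proof.
rewrite /energym exprSr -mulrA; apply: ler_wpM2l; first exact: varrho_ge0.
rewrite (sum_tuple_rcons m (fun w => E0 (f \o phiw phi w))) mulr_sumr.
apply: ler_sum => w _.
have -> : \sum_(i < M) E0 (f \o phiw phi (rcons w i)) = energy1 (f \o phiw phi w).
  by apply: eq_bigr => i _; apply: energy0_eq => x _; rewrite /= phiw_rcons.
have := @energy0_renorm_le (f \o phiw phi w) (f \o phiw phi w) (fun _ _ => erefl).
by rewrite ler_pdivrMl // varrho_gt0.
Qed.

Lemma energym_le m k f : (m <= k)%N -> Em m f <= Em k f.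
Proof.
move=> /subnK <-; elim: (k - m)%N => // n IH.
by apply: le_trans IH _; rewrite addSn energym_mono.
Qed.

Lemma energym_eqK m f g : (forall x, K x -> f x = g x) -> Em m f = Em m g.
Proof.
move=> H; congr (_ * _); apply: eq_bigr => w _; apply: energy0_eq => x Vx /=.
by apply: H; apply: (phiw_K nf); exact: (V0_K nf Vx).
Qed.

Lemma energy_eqK f g : (forall x, K x -> f x = g x) -> En f = En g.
Proof.
move=> H; rewrite /energy; congr (lim (_ @ \oo)).
by apply/funext => m; exact: energym_eqK.
Qed.

Lemma domain_bounded f : dom f -> exists B, forall m, Em m f <= B.
Proof. by move=> [_ [B HB]]; exists B => m; apply: HB; exists m. Qed.

Lemma domain_intro f B : {within K, continuous f} -> (forall m, Em m f <= B) -> dom f.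
Proof. by move=> cf H; split => //; exists B => _ [m _ <-]. Qed.

Lemma domain_eqK f g : (forall x, K x -> f x = g x) -> dom f -> dom g.
Proof.
move=> H df; have [B HB] := domain_bounded df; have [cf _] := df.
apply: (@domain_intro _ B); last by move=> m; rewrite -(energym_eqK _ H).
apply: subspace_eq_continuous cf => x; rewrite inE; exact: H.
Qed.

Lemma energy_cvg f : dom f -> (fun m => Em m f) @ \oo --> En f.
Proof.
move=> [_ Hf]; apply: nondecreasing_is_cvgn => //.
by move=> m k; exact: energym_le.
Qed.

Lemma energym_le_energy m f : dom f -> Em m f <= En f.
Proof.
move=> df; apply: (cvg_ge_bound (energy_cvg df)); exists m => k mk.
exact: energym_le.
Qed.

Lemma energy_le f B : dom f -> (forall m, Em m f <= B) -> En f <= B.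
Proof. by move=> df H; apply: (cvg_le_bound (energy_cvg df)); exists 0%N. Qed.

Lemma energy_ge0 f : dom f -> 0 <= En f.
Proof. by move=> /(energym_le_energy 0); apply: le_trans; exact: energym_ge0. Qed.

Lemma energy_unique f l : dom f -> (fun m => Em m f) @ \oo --> l -> En f = l.
Proof. by move=> _ H; exact: (cvg_lim (@norm_hausdorff _ _) H). Qed.

Lemma energym_parallelogram m f g :
  Em m (f \+ g) + Em m (f \- g) = 2 * Em m f + 2 * Em m g.
Proof.
rewrite /energym -mulrDr ![2 * (_ * _)]mulrCA -mulrDr; congr (_ * _).
rewrite !mulr_sumr -!big_split /=; apply: eq_bigr => w _.
exact: (energy0_parallelogram (f \o phiw phi w) (g \o phiw phi w)).
Qed.

Lemma energymZ m c f : Em m (fun x => c * f x) = c ^+ 2 * Em m f.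
Proof.
rewrite /energym mulrCA; congr (_ * _); rewrite mulr_sumr; apply: eq_bigr => w _.
exact: (energy0Z c (f \o phiw phi w)).
Qed.

Lemma energym_shift m c f : Em m (fun x => f x + c) = Em m f.
Proof.
congr (_ * _); apply: eq_bigr => w _; exact: (energy0_shift c (f \o phiw phi w)).
Qed.

Lemma domainD f g : dom f -> dom g -> dom (f \+ g).
Proof.
move=> df dg; have [Bf Hf] := domain_bounded df; have [Bg Hg] := domain_bounded dg.
apply: (@domain_intro _ (2 * Bf + 2 * Bg)) => [|m].
  by case: df; case: dg => cg _ cf _ x; apply: continuousD; [exact: cf|exact: cg].
have := energym_parallelogram m f g; have := energym_ge0 m (f \- g).
have := Hf m; have := Hg m; lra.
Qed.

Lemma domainZ c f : dom f -> dom (fun x => c * f x).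
Proof.
move=> df; have [B HB] := domain_bounded df.
apply: (@domain_intro _ (c ^+ 2 * B)) => [|m]; last first.
  by rewrite energymZ ler_wpM2l // sqr_ge0.
case: df => cf _ x; apply: continuousM; last exact: cf.
exact: cst_continuous.
Qed.

Lemma domainB f g : dom f -> dom g -> dom (f \- g).
Proof.
move=> df dg; have := domainD df (domainZ (-1) dg).
by apply: domain_eqK => x _ /=; rewrite mulN1r.
Qed.

Lemma domain_cst c : dom (fun=> c).
Proof.
apply: (@domain_intro _ 0) => [x|m]; first exact: cst_continuous.
rewrite /energym big1 ?mulr0 // => w _; rewrite energy0E.
rewrite big1 ?mulr0 // => x _; rewrite big1 // => y _.
by rewrite /= subrr expr0n mulr0.
Qed.

Lemma energy_parallelogram f g : dom f -> dom g ->
  En (f \+ g) + En (f \- g) = 2 * En f + 2 * En g.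
Proof.
move=> df dg.
have h1 : (fun m => Em m (f \+ g) + Em m (f \- g)) @ \oo --> En (f \+ g) + En (f \- g).
  by apply: cvgD; apply: energy_cvg; [exact: domainD|exact: domainB].
have h2 : (fun m => Em m (f \+ g) + Em m (f \- g)) @ \oo --> 2 * En f + 2 * En g.
  under eq_cvg do rewrite energym_parallelogram.
  by apply: cvgD; apply: cvgMl_tmp; exact: energy_cvg.
exact: (cvg_unique (@norm_hausdorff _ _) h1 h2).
Qed.

Lemma energyZ c f : dom f -> En (fun x => c * f x) = c ^+ 2 * En f.
Proof.
move=> df; apply: energy_unique; first exact: domainZ.
under eq_cvg do rewrite energymZ.
by apply: cvgMl_tmp; exact: energy_cvg.
Qed.

Lemma energy_shift c f : En (fun x => f x + c) = En f.
Proof.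
rewrite /energy; congr (lim (_ @ \oo)); apply/funext => m; exact: energym_shift.
Qed.

Lemma energym_cat m k f :
  Em (m + k) f = \sum_(w : m.-tuple 'I_M) varrho ^+ m * Em k (f \o phiw phi w).
Proof.
rewrite /energym (sum_tuple_cat m k (fun w => E0 (f \o phiw phi w))) exprD mulr_sumr.
apply: eq_bigr => w _; rewrite -mulrA; congr (_ * (_ * _)).
by apply: eq_bigr => u _; apply: energy0_eq => x _; rewrite /= phiw_cat.
Qed.

Lemma domain_phiw w f : dom f -> dom (f \o phiw phi w).
Proof.
move=> df; have [B HB] := domain_bounded df.
apply: (@domain_intro _ (varrho ^- size w * B)) => [|k].
  case: df => cf _; apply/edist_continuousP => x Kx A.
  move=> /((edist_continuousP _ _).1 cf _ (phiw_K nf w Kx))[e e0 He].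
  exists e => // y Ky xy; apply: He; first exact: (phiw_K nf).
  rewrite (edist_phiw nf) (le_lt_trans _ xy) // ler_piMl ?edist_ge0 //.
  by rewrite exprn_ile1 ?(scaleV_ge0 nf) // ltW // (scaleV_lt1 nf).
rewrite ler_pdivlMl ?exprn_gt0 ?varrho_gt0 //; apply: le_trans (HB (size w + k)%N).
rewrite energym_cat (bigD1 (in_tuple w)) //= lerDl sumr_ge0 // => u _.
by rewrite mulr_ge0 ?varrho_ge0 ?energym_ge0.
Qed.

Lemma energy_split m f : dom f ->
  En f = \sum_(w : m.-tuple 'I_M) varrho ^+ m * En (f \o phiw phi w).
Proof.
move=> df; apply: energy_unique => //.
rewrite -(cvg_shiftn m (fun k => Em k f)).
rewrite (_ : [sequence _]_n = fun k =>
    \sum_(w : m.-tuple 'I_M) varrho ^+ m * Em k (f \o phiw phi w)); last first.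
  by apply/funext => k /=; rewrite addnC energym_cat.
apply: cvg_sumR => w _; apply: cvgMl_tmp; apply: energy_cvg.
exact: domain_phiw.
Qed.

End DiscreteEnergy.

(** * Harmonic functions *)

Section HarmonicExtension.
Context {R : realType} {N M : nat} {L : R} {phi : 'I_M -> 'rV[R]_N -> 'rV[R]_N}
  {K : set 'rV[R]_N} {mu : {measure set (borel R N) -> \bar R}}
  {a : 'rV[R]_N -> 'rV[R]_N -> R} {varrho : R}.
Hypothesis nf : nested_fractal phi L K.
Hypothesis hmu : normalized_hausdorff (hausdorff_dim M L) K mu.
Hypothesis hs : harmonic_structure phi a varrho.
Local Notation X := 'rV[R]_N.
Local Notation E0 := (energy0 phi a).
Local Notation Em := (energym phi a varrho).
Local Notation dom := (energy_domain phi K a varrho).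
Local Notation En := (energy phi a varrho).
Implicit Types f g h : X -> R.

(** The images of a single point v under all words are dense in K, as they meet every cell. *)
Lemma continuous_eq_on_dense f g v : {within K, continuous f} -> {within K, continuous g} ->
  K v -> (forall w, f (phiw phi w v) = g (phiw phi w v)) -> forall x, K x -> f x = g x.
Proof.
have le f1 f2 : {within K, continuous f1} -> {within K, continuous f2} -> K v ->
    (forall w, f1 (phiw phi w v) = f2 (phiw phi w v)) -> forall x, K x -> f1 x <= f2 x.
  move=> /edist_continuousP c1 /edist_continuousP c2 Kv E x Kx.
  apply/ler_addgt0Pr => e e0; have e2 : 0 < e / 2 by rewrite divr_gt0.
  have [d1 d10 H1] := c1 x Kx _ (nbhsx_ballx (f1 x) _ e2).
  have [d2 d20 H2] := c2 x Kx _ (nbhsx_ballx (f2 x) _ e2).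
  have d0 : 0 < Num.min d1 d2 by rewrite lt_min d10.
  have [m Hm] := expr_arbitrarily_small (scaleV_ge0 nf) (scaleV_lt1 nf) d0.
  have [w sw wx] := cell_ex nf m Kx.
  have dw : edist x (phiw phi w v) < Num.min d1 d2.
    by rewrite (le_lt_trans _ (Hm m (leqnn m))) // -sw (cell_diam nf) //; exists v.
  move: dw; rewrite lt_min => /andP[a1 a2].
  have := H1 _ (phiw_K nf w Kv) a1; have := H2 _ (phiw_K nf w Kv) a2.
  rewrite -E /ball /= => /ltr_normlP[? ?] /ltr_normlP[? ?]; lra.
move=> cf cg Kv fg x Kx; apply/eqP; rewrite eq_le !le //.
Qed.

(** Encodes a function h on [Vinf] cell by cell: [G w] stands for h composed with phi_w, and matters
    on the vertices of level 1 only. *)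
Definition compatible (G : seq 'I_M -> X -> R) : Prop :=
  forall w i v, V0 phi v -> G (rcons w i) v = G w (phi i v).

(** The function encoded by G is well defined. If the parents of two cells sharing a vertex
    coincide, injectivity decides; if they differ, nesting makes the point a common vertex of the
    parents, and induction applies to them. *)
Lemma compatible_vertex G w w' v v' : compatible G -> V0 phi v -> V0 phi v' ->
  size w = size w' -> phiw phi w v = phiw phi w' v' -> G w v = G w' v'.
Proof.
move=> cG; elim/last_ind: w w' v v' => [|w i IH] w' v v' Vv Vv'.
  by move=> /esym/size0nil -> /= ->.
case/lastP: w' => [|w' j]; rewrite ?size_rcons // => -[sw].
rewrite !phiw_rcons => E; rewrite !cG //.
have [ww'|ww'] := pselect (w = w').
  by move: E; rewrite -ww' => /(phiw_inj nf) ->.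
have Kv := phi_K nf i (V0_K nf Vv); have Kv' := phi_K nf j (V0_K nf Vv').
have [b [b' [Vb Vb' E1 E2]]] := @cell_meet_vertex _ _ _ _ _ _ _ nf hmu w w'
  (phiw phi w (phi i v)) sw ww' (imageP _ Kv) (ex_intro2 _ _ _ Kv' (esym E)).
rewrite (phiw_inj nf E1).
move: E; rewrite {}E2 in E1 *; move=> /esym /(phiw_inj nf) ->.
by apply: IH.
Qed.

Lemma compatible_energy1 G w : compatible G -> energy1 (a := a) (phi := phi) (G w) = \sum_(i < M) E0 (G (rcons w i)).
Proof.
move=> cG; apply: eq_bigr => i _; apply: (energy0_eq nf) => v Vv.
by rewrite cG.
Qed.

Lemma compatible_osc : exists2 C, 0 <= C & forall G B, compatible G ->
  (forall m, varrho ^+ m * \sum_(w : m.-tuple 'I_M) E0 (G w) <= B) ->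
  forall w x y, Vm phi 1 x -> Vm phi 1 y ->
  (G w x - G w y) ^+ 2 <= C * B * varrho^-1 ^+ size w.
Proof.
have [C C0 HC] := energy1_osc nf hs; exists C => // G B cG HB w x y Vx Vy.
apply: le_trans (HC (G w) x y Vx Vy) _; rewrite -mulrA; apply: ler_wpM2l => //.
have v0 := varrho_gt0 hs; have v1 := ltW (hs_varrho hs).
rewrite exprVn ler_pdivlMr ?exprn_gt0 // mulrC.
apply: le_trans (HB (size w).+1).
rewrite (sum_tuple_rcons (size w) (fun w => E0 (G w))) exprSr -mulrA.
apply: ler_wpM2l; first exact: (varrho_ge0 hs).
have H0 (u : seq 'I_M) : 0 <= \sum_(i < M) E0 (G (rcons u i)).
  by apply: sumr_ge0 => i _; exact: (energy0_ge0 nf hs).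
rewrite (compatible_energy1 w cG).
rewrite (bigD1 (in_tuple w)) //=.
have S0 : 0 <= \sum_(u : (size w).-tuple 'I_M | u != in_tuple w)
     \sum_(i < M) E0 (G (rcons u i)) by apply: sumr_ge0 => u _; exact: H0.
have := H0 w; move: S0; set s := \sum_(u | _) _; set t := \sum_(i < M) _.
move=> s0 t0; rewrite -[leLHS]mul1r.
apply: ler_pM => //; lra.
Qed.

(** An energy bound B at all levels forces oscillation of order varrho^(-k/2) on cells of level k, a
    geometric rate, so [cell_limit] applies to the values at one fixed vertex z. *)
Lemma compatible_limit : exists2 C, 0 <= C & forall G B, compatible G ->
  (forall m, varrho ^+ m * \sum_(w : m.-tuple 'I_M) E0 (G w) <= B) ->
  exists F, [/\ {within K, continuous F},
    forall w v, V0 phi v -> F (phiw phi w v) = G w v &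
    forall w v x, V0 phi v -> cell phi K w x ->
      (G w v - F x) ^+ 2 <= C * B * varrho^-1 ^+ size w].
Proof.
have [C C0 HC] := compatible_osc.
have v0 := varrho_gt0 hs; have v1 := hs_varrho hs.
pose q := Num.sqrt varrho^-1.
have q0 : 0 <= q by exact: sqrtr_ge0.
have q2 : q ^+ 2 = varrho^-1 by rewrite sqr_sqrtr // invr_ge0 ltW.
have q1 : q < 1.
  by rewrite -(@ltr_pXn2r _ 2) ?nnegrE // expr1n q2 invf_lt1.
pose T := 1 + 2 / (1 - q); pose D := 1 + 2 * T.
have T0 : 0 <= T by rewrite addr_ge0 // divr_ge0 // subr_ge0 ltW.
have D0 : 0 <= D by rewrite addr_ge0 // mulr_ge0.
have [z [_ [Vz _ _]]] := nf_V0 nf.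
exists (C * D ^+ 2) => [|G B cG HB]; first by rewrite mulr_ge0 ?sqr_ge0.
have B0 : 0 <= B.
  apply: le_trans (HB 0%N); rewrite expr0 mul1r sumr_ge0 // => w _.
  exact: (energy0_ge0 nf hs).
pose S := Num.sqrt (C * B).
have S0 : 0 <= S by exact: sqrtr_ge0.
have CB0 : 0 <= C * B by rewrite mulr_ge0.
have S2 : S ^+ 2 = C * B by rewrite sqr_sqrtr.
have osc w x y : Vm phi 1 x -> Vm phi 1 y -> `|G w x - G w y| <= S * q ^+ size w.
  move=> Vx Vy; rewrite -(@ler_pXn2r _ 2) ?nnegrE ?mulr_ge0 ?exprn_ge0 //.
  rewrite real_normK ?num_real // exprMn S2 exprAC q2; exact: HC.
clearbody S.
have osc0 w x y : V0 phi x -> V0 phi y -> `|G w x - G w y| <= S * q ^+ size w.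
  by move=> /V0_V1 Vx /V0_V1 Vy; exact: osc.
have [F cF HF] : exists2 F : X -> R, {within K, continuous F} & forall w x, (0 <= size w)%N ->
    cell phi K w x -> `|G w z - F x| <= 2 * S * T * q ^+ size w.
  have S2' : 0 <= 2 * S by rewrite mulr_ge0.
  apply: (cell_limit nf (c := fun w => G w z) S2' q0 q1) => [w i _|w w' _ sw [x [wx w'x]]].
    rewrite cG //; apply: le_trans (osc w _ _ (V0_V1 Vz) _) _; first by exists i => //; exists z.
    by rewrite -mulrA mulr2n mulrDl mul1r lerDl mulr_ge0 // exprn_ge0.
  have [->|ww'] := pselect (w = w').
    by rewrite subrr normr0 mulr_ge0 ?exprn_ge0.
  have [b [b' [Vb Vb' E1 E2]]] := cell_meet_vertex nf hmu sw ww' wx w'x.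
  have E : G w b = G w' b' by apply: compatible_vertex => //; rewrite -E1.
  apply: le_trans (ler_distD (G w b) _ _) _; rewrite -mulrA mulr2n mulrDl mul1r.
  by apply: lerD; [exact: osc0|rewrite E sw; exact: osc0].
have est w v x : V0 phi v -> cell phi K w x -> `|G w v - F x| <= S * D * q ^+ size w.
  move=> Vv wx; apply: le_trans (ler_distD (G w z) _ _) _.
  have -> : S * D * q ^+ size w = S * q ^+ size w + 2 * S * T * q ^+ size w.
    by rewrite /D; ring.
  by apply: lerD; [exact: osc0|exact: HF].
exists F; split=> // [w v Vv|w v x Vv wx]; last first.
  have -> : C * D ^+ 2 * B * varrho^-1 ^+ size w = (S * D * q ^+ size w) ^+ 2.
    by rewrite !exprMn S2 exprAC q2; ring.
  rewrite -real_normK ?num_real // ler_pXn2r ?nnegrE ?mulr_ge0 ?exprn_ge0 //.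
  exact: est.
(* As v is the fixed point of phi_i, appending copies of i to w changes neither the vertex nor the
   value of G, while the error bound shrinks to 0. *)
have [i Hi] := V0_fix Vv.
apply/esym/eqP; rewrite -subr_eq0 -normr_eq0 eq_le normr_ge0 andbT.
apply: (@le_of_geometric_error _ _ _ (S * D * q ^+ size w) q 0) => // k _.
rewrite add0r -[leRHS]mulrA -exprD.
have -> : (size w + k)%N = size (w ++ nseq k i) by rewrite size_cat size_nseq.
have -> : G w v = G (w ++ nseq k i) v.
  elim: k => [|k IH]; first by rewrite cats0.
  by rewrite -addn1 nseqD /= catA cats1 cG // Hi.
apply: est => //; have -> : phiw phi w v = phiw phi (w ++ nseq k i) v.
  by rewrite phiw_cat phiw_nseq.
exact: (V0_cell nf).
Qed.

(** [compatible_limit] is applied to the family of f itself: its limit is f by density, and the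
    estimate for the empty word compares f with its value at one vertex. *)
Lemma domain_osc : exists2 C, 0 <= C & forall f x y, dom f -> K x -> K y ->
  (f x - f y) ^+ 2 <= C * En f.
Proof.
have [C C0 HC] := compatible_limit.
have [z [_ [Vz _ _]]] := nf_V0 nf.
exists (4 * C) => [|f x y df Kx Ky]; first by rewrite mulr_ge0.
have [F [cF VF HF]] := HC (fun w => f \o phiw phi w) (En f)
  (fun w i v _ => congr1 f (phiw_rcons w i v)) (fun m => energym_le_energy nf hs m df).
have fF : forall x, K x -> f x = F x.
  apply: (continuous_eq_on_dense (v := z)) => //; first by case: df.
    exact: (V0_K nf).
  by move=> w; rewrite VF.
have b u : K u -> (f z - f u) ^+ 2 <= C * En f.
  move=> Ku; have := HF [::] z u Vz; rewrite cell_nil => /(_ Ku).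
  by rewrite /= expr0 mulr1 (fF u Ku).
have -> : f x - f y = (f z - f y) - (f z - f x) by ring.
have := b x Kx; have := b y Ky.
have := sqr_ge0 ((f z - f y) + (f z - f x)).
set s := f z - f y; set t := f z - f x; rewrite -mulrA; nra.
Qed.

(* Unspecified outside the vertices of level 1. *)
Definition ext1 f : X -> R := sval (cid (energy1_minimizer nf hs f)).

Lemma ext1_V0 f v : V0 phi v -> ext1 f v = f v.
Proof. by rewrite /ext1; case: cid => g [H ?] /=; exact: H. Qed.

Lemma ext1_energy f : energy1 (a := a) (phi := phi) (ext1 f) = varrho^-1 * E0 f.
Proof. by rewrite /ext1; case: cid => g []. Qed.

(** Follows f up to the vertices of level n and then applies the energy minimizing extension once
    per level. A word of length n already carries one [ext1], because [G w] must provide the values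
    at the vertices of level 1 inside its cell. *)
Definition spline_family n f (w : seq 'I_M) : X -> R :=
  if (size w < n)%N then f \o phiw phi w
  else foldl (fun g i => ext1 (g \o phi i)) (ext1 (f \o phiw phi (take n w))) (drop n w).

Lemma spline_family_compatible n f : compatible (spline_family n f).
Proof.
move=> w i v Vv; rewrite /spline_family size_rcons.
have [wn|nw|wn] := ltngtP (size w) n.
- have [wn'|nw'] := ltnP (size w).+1 n; first by rewrite /= phiw_rcons.
  have E : n = size (rcons w i) by rewrite size_rcons; apply/eqP; rewrite eqn_leq nw'.
  by rewrite E take_size drop_size /= ext1_V0 //= phiw_rcons.
- rewrite ltnNge (leq_trans (ltnW nw) (leqnSn _)) /= drop_rcons ?(ltnW nw) //.
  by rewrite foldl_rcons /= ext1_V0 //= -cats1 takel_cat // ltnW.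
- rewrite -wn ltnNge leqnSn /= drop_rcons // foldl_rcons /= ext1_V0 //=.
  by rewrite -cats1 takel_cat.
Qed.

Lemma spline_family_energy n f m : (n <= m)%N ->
  varrho ^+ m * \sum_(w : m.-tuple 'I_M) E0 (spline_family n f w) = Em n f.
Proof.
move=> /subnK <-; elim: (m - n)%N => [|k IH].
  rewrite add0n; congr (_ * _); apply: eq_bigr => w _.
  have sw : size w = n by rewrite size_tuple.
  apply: (energy0_eq nf) => v Vv; rewrite /spline_family sw ltnn.
  by rewrite take_oversize ?drop_oversize ?sw //= ext1_V0.
rewrite -IH addSn exprSr -mulrA; congr (_ * _).
rewrite (sum_tuple_rcons _ (fun w => E0 (spline_family n f w))) mulr_sumr.
apply: eq_bigr => w _; rewrite -(compatible_energy1 w (@spline_family_compatible n f)).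
have v0 := varrho_gt0 hs.
have nw : (n <= size w)%N by rewrite size_tuple leq_addl.
have [g ->] : exists g, spline_family n f w = ext1 g.
  rewrite /spline_family ltnNge nw /=; case/lastP: (drop n w) => [|u i]; first by eexists.
  by rewrite foldl_rcons; eexists.
rewrite ext1_energy mulrA divff ?gt_eqF // mul1r.
by apply: (energy0_eq nf) => v Vv; rewrite ext1_V0.
Qed.

(* The harmonic functions, by [flat_harmonic]; unlike minimality, this equation
   passes to cells termwise. *)
Definition flat h : Prop := dom h /\ En h = E0 h.

Lemma energy0_le_energy f : dom f -> E0 f <= En f.
Proof. by move=> df; rewrite -(energym0 (varrho := varrho)); exact: (energym_le_energy nf hs 0 df). Qed.

(** From level n on every extension step preserves the renormalized energy, so the limit h has
    energy [Em n f]. Being already attained at level n, this energy equals E0 on each cell of that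
    level. *)
Lemma spline_ex n f : exists h, [/\ dom h,
  forall w v, size w = n -> V0 phi v -> h (phiw phi w v) = f (phiw phi w v),
  En h = Em n f & forall w, size w = n -> flat (h \o phiw phi w)].
Proof.
have [C C0 HC] := compatible_limit.
have cG := @spline_family_compatible n f.
have le m : varrho ^+ m * \sum_(w : m.-tuple 'I_M) E0 (spline_family n f w) <= Em n f.
  have [nm|/ltnW mn] := leqP n m; first by rewrite (spline_family_energy f nm).
  rewrite -(spline_family_energy f (leqnn n)).
  move: (spline_family n f) cG => G cG.
  rewrite -(subnK mn); elim: (n - m)%N => [|k IH]; first by rewrite add0n.
  apply: (le_trans IH).
  rewrite addSn exprSr -mulrA; apply: ler_wpM2l; first exact: (varrho_ge0 hs).
  rewrite (sum_tuple_rcons _ (fun w => E0 (G w))) mulr_sumr.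
  apply: ler_sum => w _; rewrite -(compatible_energy1 w cG).
  by rewrite -ler_pdivrMl ?(varrho_gt0 hs) // (energy0_renorm_le nf hs).
have [h [ch vh _]] := HC _ _ cG le.
have Emh m : Em m h = varrho ^+ m * \sum_(w : m.-tuple 'I_M) E0 (spline_family n f w).
  congr (_ * _); apply: eq_bigr => w _; apply: (energy0_eq nf) => v Vv.
  by rewrite /= vh.
have dh : dom h by apply: (@domain_intro _ _ _ _ _ _ _ _ (Em n f)) => // m; rewrite Emh.
have Eh : En h = Em n f.
  apply/eqP; rewrite eq_le (energy_le nf hs dh) /=; last by move=> m; rewrite Emh.
  by rewrite -(spline_family_energy f (leqnn n)) -Emh (energym_le_energy nf hs).
exists h; split=> // [w v sw Vv|w sw].
  rewrite vh // /spline_family -sw ltnn take_size drop_size /=.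
  by rewrite ext1_V0.
split; first exact: (domain_phiw nf hs).
have H : \sum_(u : n.-tuple 'I_M) varrho ^+ n * (En (h \o phiw phi u) - E0 (h \o phiw phi u)) = 0.
  rewrite -mulr_sumr sumrB mulrBr mulr_sumr -(energy_split nf hs n dh) Eh.
  by rewrite -[X in _ - X]/(Em n h) Emh (spline_family_energy f (leqnn n)) subrr.
move/eqP: H; rewrite psumr_eq0 => [/allP|u _]; last first.
  rewrite mulr_ge0 ?(varrho_ge0 hs) // subr_ge0; apply: energy0_le_energy.
  exact: (domain_phiw nf hs).
have sw' : size w == n by rewrite sw.
move=> /(_ (Tuple sw') (mem_index_enum _)); rewrite /= mulf_eq0 expf_eq0.
by rewrite (gt_eqF (varrho_gt0 hs)) andbF /= subr_eq0 => /eqP.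
Qed.

Lemma flat_eqK f g : (forall x, K x -> f x = g x) -> flat f -> flat g.
Proof.
move=> fg [df Ef]; split; first exact: (domain_eqK nf fg).
by rewrite -(energy_eqK nf fg) Ef; apply: (energy0_eq nf) => v /(V0_K nf) /fg.
Qed.

(** The parallelogram law holds for both forms, and En >= E0 at the sum gives En <= E0 at the
    difference. *)
Lemma flatB f g : flat f -> flat g -> flat (f \- g).
Proof.
move=> [df Ef] [dg Eg]; have dB := domainB nf hs df dg; have dD := domainD nf hs df dg.
split => //; apply/eqP; rewrite eq_le energy0_le_energy // andbT.
have := energy_parallelogram nf hs df dg; have := energy0_parallelogram (a := a) nf f g.
have := energy0_le_energy dD; rewrite Ef Eg; lra.
Qed.

(** The energies of all levels agree, so the nonnegative gaps En - E0 on the cells add up to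
    zero. *)
Lemma flat_phiw w f : flat f -> flat (f \o phiw phi w).
Proof.
move=> [df Ef]; split; first exact: (domain_phiw nf hs).
pose n := size w.
have H0 (u : n.-tuple 'I_M) : 0 <= varrho ^+ n * (En (f \o phiw phi u) - E0 (f \o phiw phi u)).
  rewrite mulr_ge0 ?(varrho_ge0 hs) // subr_ge0; apply: energy0_le_energy.
  exact: (domain_phiw nf hs).
have H : \sum_(u : n.-tuple 'I_M) varrho ^+ n * (En (f \o phiw phi u) - E0 (f \o phiw phi u)) = 0.
  apply/eqP; rewrite eq_le sumr_ge0 ?andbT => [|u _]; last exact: H0.
  rewrite -mulr_sumr sumrB mulrBr mulr_sumr -(energy_split nf hs n df) Ef.
  by rewrite subr_le0 -[X in _ <= X]/(Em n f) -(energym0 (varrho := varrho)) (energym_le nf hs).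
move/eqP: H; rewrite psumr_eq0 => [/allP|u _]; last exact: H0.
move=> /(_ (in_tuple w) (mem_index_enum _)); rewrite /= mulf_eq0 expf_eq0.
by rewrite (gt_eqF (varrho_gt0 hs)) andbF /= subr_eq0 => /eqP.
Qed.

Lemma flat_cst c : flat (fun=> c).
Proof.
have E f : (forall x y, f x = f y) -> E0 f = 0.
  move=> ff; rewrite (energy0E nf) big1 ?mulr0 // => x _; rewrite big1 // => y _.
  by rewrite (ff x y) subrr expr0n mulr0.
have dc : dom (fun=> c) := domain_cst nf c; split => //; rewrite E //.
apply/eqP; rewrite eq_le (energy_ge0 nf hs) // andbT.
apply: (energy_le nf hs) => // m; rewrite /energym big1 ?mulr0 // => w _; exact: E.
Qed.

Lemma flat_harmonic h : flat h <-> harmonic phi K a varrho h.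
Proof.
split=> [[dh Eh]|[dh Hh]].
  split => // g dg gh; rewrite Eh -(energy0_eq nf gh); exact: energy0_le_energy.
have [g [dg vg Eg _]] := spline_ex 0 h.
split => //; apply/eqP; rewrite eq_le energy0_le_energy // andbT.
rewrite -(energym0 (varrho := varrho)) -Eg; apply: Hh => // x Vx.
exact: (vg [::] x).
Qed.

Lemma energy_phiw_le w f : dom f -> varrho ^+ size w * En (f \o phiw phi w) <= En f.
Proof.
move=> df; rewrite (energy_split nf hs (size w) df) (bigD1 (in_tuple w)) //= lerDl.
apply: sumr_ge0 => u _; rewrite mulr_ge0 ?(varrho_ge0 hs) //.
by apply: (energy_ge0 nf hs); exact: (domain_phiw nf hs).
Qed.

Lemma energyD_le f g : dom f -> dom g -> En (f \+ g) <= 2 * En f + 2 * En g.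
Proof.
move=> df dg; rewrite -(energy_parallelogram nf hs df dg) lerDl.
by apply: (energy_ge0 nf hs); exact: (domainB nf hs).
Qed.

Lemma energyB_le f g : dom f -> dom g -> En (f \- g) <= 2 * En f + 2 * En g.
Proof.
move=> df dg; rewrite -(energy_parallelogram nf hs df dg) lerDr.
by apply: (energy_ge0 nf hs); exact: (domainD nf hs).
Qed.

Definition piecewise_flat n h := dom h /\ forall w, size w = n -> flat (h \o phiw phi w).

Lemma piecewise_flat_le m n h : (m <= n)%N -> piecewise_flat m h -> piecewise_flat n h.
Proof.
move=> mn [dh H]; split => // w sw; have sm : size (take m w) = m by rewrite size_takel ?sw.
have := flat_phiw (drop m w) (H _ sm); apply: flat_eqK => x _ /=.
by rewrite -phiw_cat cat_take_drop.
Qed.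

Lemma piecewise_flatB n f g : piecewise_flat n f -> piecewise_flat n g ->
  piecewise_flat n (f \- g).
Proof.
move=> [df Hf] [dg Hg]; split=> [|w sw]; first exact: (domainB nf hs).
exact: (flatB (Hf w sw) (Hg w sw)).
Qed.

Lemma piecewise_flat_dense f e : dom f -> 0 < e ->
  exists n h, piecewise_flat n h /\ En (f \- h) <= e.
Proof.
move=> df e0; have e2 : 0 < e / 2 by rewrite divr_gt0.
have /cvgrPdist_lt/(_ _ e2)[n _ Hn] := energy_cvg nf hs df.
have := Hn n (leqnn n); have [h [dh vh Eh Fh]] := spline_ex n f => /ltr_normlP[_ H].
exists n, h; split; first by split.
have P := energy_parallelogram nf hs df dh.
(* On the vertices of level n the sum is 2f. With the parallelogram law, En (f - h) is at most twice
   the gap En f - Em n f. *)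
have Q : 4 * Em n f <= En (f \+ h).
  apply: le_trans (energym_le_energy nf hs n (domainD nf hs df dh)).
  have := energymZ (varrho := varrho) nf n 2 f; rewrite (_ : 2 ^+ 2 = 4); last by ring.
  move=> <-; rewrite le_eqVlt; apply/orP; left; apply/eqP.
  congr (_ * _); apply: eq_bigr => w _; apply: (energy0_eq nf) => v Vv /=.
  by rewrite vh ?size_tuple //; ring.
rewrite Eh in P; lra.
Qed.

(** [telescope_sqr] with s = 2 puts the weight 2^j on the j-th increment; approximating at rate 4^-k
    keeps the weighted sum finite and makes the remainder of order 2^-k, on every cell at once. *)
Lemma piecewise_flat_series f : dom f -> exists (d : nat -> X -> R) (n : nat -> nat) (D : R),
  [/\ 0 <= D, forall k, piecewise_flat (n k) (d k), forall k, En (d k) <= D * 4^-1 ^+ k &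
    forall w k, varrho ^+ size w * En (f \o phiw phi w) <=
      2 * (\sum_(j < k) 2 ^+ j * (varrho ^+ size w * En (d j \o phiw phi w))) + D * 2^-1 ^+ k].
Proof.
move=> df.
have q4 k : (0 : R) < 4^-1 ^+ k by rewrite exprn_gt0.
have /choice[p Hp] : forall k, exists p : nat * (X -> R),
    piecewise_flat p.1 p.2 /\ En (f \- p.2) <= 4^-1 ^+ k.+1.
  by move=> k; have [n [h H]] := piecewise_flat_dense df (q4 k.+1); exists (n, h).
pose rest k := if k is k'.+1 then f \- (p k').2 else f.
pose d k := if k is k'.+1 then (p k'.+1).2 \- (p k').2 else (p 0%N).2.
pose n k := if k is k'.+1 then maxn (p k'.+1).1 (p k').1 else (p 0%N).1.
have E0f := energy_ge0 nf hs df.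
pose D := 4 * (En f + 1).
have restE k : rest k = d k \+ rest k.+1.
  by apply/funext => x; case: k => [|k] /=; ring.
have drest k : dom (rest k).
  by case: k => [//|k] /=; apply: (domainB nf hs) => //; case: (Hp k) => [[]].
have rest_le k : En (rest k) <= (En f + 1) * 4^-1 ^+ k.
  case: k => [|k] /=; first by rewrite expr0 mulr1 lerDl.
  by apply: le_trans (Hp k).2 _; apply: ler_peMl (ltW (q4 _)) _; rewrite lerDr.
have fd k : piecewise_flat (n k) (d k).
  case: k => [|k] /=; first exact: (Hp 0%N).1.
  apply: piecewise_flatB; last exact: piecewise_flat_le (leq_maxr _ _) (Hp k).1.
  exact: piecewise_flat_le (leq_maxl _ _) (Hp k.+1).1.
have D0 : 0 <= D by rewrite mulr_ge0 // addr_ge0.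
exists d, n, D; split => // [k|w k].
  have -> : d k = rest k \- rest k.+1.
    by apply/funext => x; rewrite /= {1}restE /=; ring.
  apply: le_trans (energyB_le (drest k) (drest k.+1)) _.
  have := rest_le k; have := rest_le k.+1; rewrite exprS /D.
  have := mulr_ge0 (addr_ge0 E0f ler01) (ltW (q4 k)); set t := _ ^+ k; nra.
have dw g : dom g -> 0 <= varrho ^+ size w * En (g \o phiw phi w).
  move=> dg; rewrite mulr_ge0 ?(varrho_ge0 hs) //; apply: (energy_ge0 nf hs).
  exact: (domain_phiw nf hs).
have H := @telescope_sqr R (X -> R) (fun g => varrho ^+ size w * En (g \o phiw phi w))
  rest d 2 k.
have s21 : 1 < 2 :> R by rewrite ltr1n.
have s22 : 2 / (2 - 1) = 2 :> R by field.
rewrite s22 in H; apply: (le_trans (H s21 _)) => [j|].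
  have -> : rest j \o phiw phi w = (d j \o phiw phi w) \+ (rest j.+1 \o phiw phi w).
    by rewrite {1}restE.
  rewrite ![2 * (_ * _)]mulrCA -mulrDr; apply: ler_wpM2l; first exact: (varrho_ge0 hs).
  apply: energyD_le; apply: (domain_phiw nf hs) => //.
  by case: (fd j).
rewrite lerD2l; apply: le_trans (ler_wpM2l _ (energy_phiw_le w (drest k))) _ => //.
apply: le_trans (ler_wpM2l _ (rest_le k)) _ => //.
rewrite mulrCA -exprMn (_ : 2 * 4^-1 = 2^-1); last by field.
apply: ler_wpM2r; first by rewrite exprn_ge0.
by rewrite /D; lra.
Qed.

End HarmonicExtension.

(** * Radon-Nikodym densities and Borel regularity *)

Section FiniteTotalMass.
Context d (T : measurableType d) (R : realType) (m : {measure set T -> \bar R}).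
Hypothesis mT : (m setT < +oo)%E.

(** A copy of m that carries the proof of finiteness as an argument, so that a finite measure
    structure can be attached to it. *)
Definition mfinite (_ : (m setT < +oo)%E) : set T -> \bar R := m.

HB.instance Definition _ := @isMeasure.Build d T R (mfinite mT) (measure0 m)
  (measure_ge0 m) (@measure_semi_sigma_additive _ _ _ m).

Let mfinite_fin : fin_num_fun (mfinite mT).
Proof.
move=> A mA; rewrite ge0_fin_numE ?measure_ge0 //.
by apply: le_lt_trans mT; apply: le_measure; rewrite ?inE //; exact: measurableT.
Qed.

HB.instance Definition _ := @Measure_isFinite.Build d T R (mfinite mT) mfinite_fin.
End FiniteTotalMass.

Lemma radon_nikodym_density d (T : measurableType d) (R : realType)
    (m1 m2 : {measure set T -> \bar R}) : (m1 setT < +oo)%E -> (m2 setT < +oo)%E ->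
  (forall A, measurable A -> m2 A = 0 -> m1 A = 0)%E ->
  exists U : T -> R, [/\ measurable_fun setT U, forall x, 0 <= U x &
    forall A, measurable A -> m1 A = (\int[m2]_(x in A) (U x)%:E)%E].
Proof.
move=> f1 f2 H.
have M12 : mfinite f1 `<< mfinite f2 by apply/null_content_dominatesP => A mA; exact: H.
have U0 := Radon_Nikodym_SigmaFinite.f_ge0 M12.
have Uf := Radon_Nikodym_SigmaFinite.f_fin_num M12.
have UI := Radon_Nikodym_SigmaFinite.f_integrable M12.
exists (fun x => fine (Radon_Nikodym_SigmaFinite.f (mfinite f1) (mfinite f2) x)); split.
- by apply: measurableT_comp => //; exact: measurable_int UI.
- by move=> x; exact: fine_ge0.
move=> A mA; rewrite -[LHS]/(mfinite f1 A) (Radon_Nikodym_SigmaFinite.f_integral M12 mA).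
transitivity (\int[mfinite f2]_(x in A)
  (fine (Radon_Nikodym_SigmaFinite.f (mfinite f1) (mfinite f2) x))%:E)%E => //.
  by apply: eq_integral => x _; rewrite fineK.
Qed.

(** * Approximation of Borel sets by closed and open sets *)

Section BorelRegularity.
Context {R : realType} {N : nat} (m : {measure set (borel R N) -> \bar R}).
Hypothesis mfin : (m setT < +oo)%E.
Local Notation X := (borel R N).

Lemma measure_lt_pinfty (A : set X) : measurable A -> (m A < +oo)%E.
Proof.
by move=> mA; apply: le_lt_trans mfin; apply: le_measure; rewrite ?inE //; exact: measurableT.
Qed.

Lemma measure_nonincreasing_lt (A : nat -> set X) (e : R) : (forall k, measurable (A k)) ->
  nonincreasing_seq A -> \bigcap_k A k = set0 -> 0 < e -> exists k, (m (A k) < e%:E)%E.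
Proof.
move=> mA nA A0 e0; have := @nonincreasing_cvg_mu _ _ _ m A.
rewrite A0 measure0 => /(_ (measure_lt_pinfty (mA 0%N)) mA measurable0 nA).
move=> /fine_cvg/cvgrPdist_lt/(_ _ e0)[k _ /(_ k (leqnn k))] /=.
rewrite sub0r normrN ger0_norm ?fine_ge0 // => H; exists k.
by rewrite -[m _]fineK ?lte_fin // ge0_fin_numE // measure_lt_pinfty.
Qed.

Lemma open_inner_closed (U : set X) (e : R) : open (U : set 'rV[R]_N) -> 0 < e ->
  exists F : set X, [/\ closed (F : set 'rV[R]_N), F `<=` U & (m (U `\` F) < e%:E)%E].
Proof.
move=> oU e0.
(* The points at distance at least 1/(k+1) from the complement: closed sets that exhaust the open
   set U. *)
pose F k : set X := [set x | forall y : 'rV[R]_N, edist x y < k.+1%:R^-1 -> U y].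
have cF k : closed (F k : set 'rV[R]_N).
  rewrite (_ : F k = \bigcap_(y in ~` U) ~` [set x | edist x y < k.+1%:R^-1]).
    apply: closed_bigI => y _; rewrite (_ : ~` _ =
        ((edist y : 'rV[R]_N -> R) @^-1` [set r | k.+1%:R^-1 <= r])).
      apply: (@preimage_closed _ _ (edist y : 'rV[R]_N -> R) [set r | k.+1%:R^-1 <= r]).
        by move=> x _; exact: continuous_edist.
      exact: closed_ge.
    by apply/seteqP; split=> x /=; rewrite edistC leNgt => /negP.
  apply/seteqP; split=> x /= H; first by move=> y nUy xy; apply: nUy; exact: H.
  by move=> y xy; apply: contrapT => nUy; exact: (H y nUy).
have mF k : measurable (F k) by exact: closed_borel.
have mU : measurable U by exact: open_borel.
have nF : nonincreasing_seq (fun k => U `\` F k).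
  move=> i j ij; apply/subsetPset => x [Ux nFx]; split => // Fx; apply: nFx => y xy.
  apply: Fx; apply: lt_le_trans xy _.
  by rewrite lef_pV2 ?posrE ?ltr0n // ler_nat.
have capF : \bigcap_k (U `\` F k) = set0.
  apply/seteqP; split=> // x H.
  have Ux : U x by have [] := H 0%N I.
  have /nbhs_edist[r r0 Hr] : nbhs (x : 'rV[R]_N) U by exact: open_nbhs_nbhs.
  have [k Hk] : exists k, k.+1%:R^-1 < r.
    exists (Num.truncn r^-1); rewrite invf_plt ?posrE // ?ltr0n //.
    exact: truncnS_gt.
  have [_] := H k I; apply => y xy; apply: Hr; exact: lt_trans xy Hk.
have [k Hk] : exists k, (m (U `\` F k) < e%:E)%E.
  by apply: (measure_nonincreasing_lt (A := fun k => U `\` F k)) => // k; exact: measurableD.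
exists (F k); split => // x Fx; apply: Fx; rewrite edistxx invr_gt0 ltr0n //.
Qed.

Definition sandwiched (B : set X) := forall e : R, 0 < e -> exists F O : set X,
  [/\ closed (F : set 'rV[R]_N), open (O : set 'rV[R]_N), F `<=` B, B `<=` O &
      (m (O `\` F) < e%:E)%E].

(** The sandwiched sets form a sigma-algebra containing the open sets. *)
Lemma measurable_sandwiched (B : set X) : measurable B -> sandwiched B.
Proof.
move: B; apply: smallest_sub => [|U oU e e0]; last first.
  have [F [cF FU mF]] := open_inner_closed oU e0; exists F, U; split => //.
split=> [e e0|A HA e e0|A HA e e0].
- exists set0, set0; split=> //; last by rewrite setD0 measure0 lte_fin.
  exact: closed0.
- have [F [V [cF oV FA AV mVF]]] := HA e e0; exists (~` V), (~` F); split.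
  + exact: open_closedC.
  + exact: closed_openC.
  + by move=> x nV; split => // /AV.
  + by move=> x [_ nA] /FA.
  + by rewrite setDE setCK setIC -setDE.
(* Half of e is spread over the sets A k. The other half pays for replacing the union of the F k,
   which need not be closed, by the finite union [G n]. *)
have e2 k : 0 < e / 2 / 2 ^+ k.+1 by rewrite !divr_gt0 // exprn_gt0.
have /choice[F HF] : forall k, exists F : set X, exists O : set X,
    [/\ closed (F : set 'rV[R]_N), open (O : set 'rV[R]_N), F `<=` A k, A k `<=` O &
        (m (O `\` F) < (e / 2 / 2 ^+ k.+1)%:E)%E].
  by move=> k; exact: HA.
have /choice[V HV] := HF.
have mF k : measurable (F k) by case: (HV k) => /closed_borel.
have mV k : measurable (V k) by case: (HV k) => _ /open_borel.
pose G n := \big[setU/set0]_(k < n) F k.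
have GE n x : G n x <-> exists2 k, (k < n)%N & F k x.
  by rewrite /G -(bigcup_mkord n F); split=> -[k kn Fk]; exists k.
have mG n : measurable (G n) by apply: bigsetU_measurable.
have mUF : measurable (\bigcup_k F k) by exact: bigcupT_measurable.
have mUV : measurable (\bigcup_k V k) by exact: bigcupT_measurable.
have [n Hn] : exists n, (m ((\bigcup_k F k) `\` G n) < (e / 2)%:E)%E.
  apply: (measure_nonincreasing_lt (A := fun n => (\bigcup_k F k) `\` G n)).
  - by move=> k; exact: measurableD.
  - move=> i j ij; apply/subsetPset => x [Ux nG]; split => // /GE[k ki Fk].
    by apply: nG; apply/GE; exists k => //; exact: leq_trans ki ij.
  - apply/seteqP; split => // x H; have [[k _ Fk] _] := H 0%N I.
    by have [_] := H k.+1 I; apply; apply/GE; exists k.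
  - by rewrite divr_gt0.
exists (G n), (\bigcup_k V k); split.
- by apply: closed_bigsetU => k _; case: (HV k).
- by apply: bigcup_open => k _; case: (HV k).
- by move=> x /GE[k _ Fk]; exists k => //; case: (HV k) => _ _ FA _ _; exact: FA.
- by move=> x [k _ Ak]; exists k => //; case: (HV k) => _ _ _ AV _; exact: AV.
have sub : (\bigcup_k V k) `\` G n `<=`
    (\bigcup_k (V k `\` F k)) `|` ((\bigcup_k F k) `\` G n).
  move=> x [[k _ Vk] nG]; have [Fx|nF] := pselect ((\bigcup_k F k) x); first by right.
  by left; exists k => //; split => // Fk; apply: nF; exists k.
have mVF : measurable (\bigcup_k (V k `\` F k)).
  by apply: bigcupT_measurable => k; exact: measurableD.
have mR : measurable ((\bigcup_k F k) `\` G n) by exact: measurableD.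
apply: (@le_lt_trans _ _ (m (\bigcup_k (V k `\` F k)) + m ((\bigcup_k F k) `\` G n))%E).
  apply: le_trans (measure_setU_le m mVF mR); apply: le_measure => //; rewrite inE.
    exact: measurableD.
  exact: measurableU.
have -> : e%:E = ((e / 2)%:E + (e / 2)%:E)%E by rewrite -EFinD; congr EFin; field.
apply: lee_ltD => //; first by rewrite ge0_fin_numE // measure_lt_pinfty.
apply: (@le_trans _ _ (\sum_(0 <= k <oo) m (V k `\` F k))%E).
  apply: measure_sigma_subadditive => // k; exact: measurableD.
apply: (@le_trans _ _ (\sum_(0 <= k <oo) (e / 2 / (2 ^ k.+1)%:R)%:E)%E).
  apply: lee_nneseries => // k _; rewrite natrX; apply: ltW.
  by case: (HV k).
by apply: epsilon_trick0; rewrite divr_ge0 // ltW.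
Qed.

End BorelRegularity.

(** * The Kusuoka measure *)

Lemma sum_cauchy_schwarz {R : realType} n (c g : 'I_n -> R) :
  (\sum_(i < n) c i * g i) ^+ 2 <= (\sum_(i < n) c i ^+ 2) * (\sum_(i < n) g i ^+ 2).
Proof.
have := dotp_cauchy_schwarz (\row_i c i) (\row_i g i); rewrite /dotp.
under eq_bigr do rewrite !mxE; under [X in _ <= X * _ -> _]eq_bigr do rewrite !mxE -expr2.
by under [X in _ <= _ * X -> _]eq_bigr do rewrite !mxE -expr2.
Qed.

Section EnergyForm.
Context {R : realType} {N M : nat} {L : R} {phi : 'I_M -> 'rV[R]_N -> 'rV[R]_N}
  {K : set 'rV[R]_N} {mu : {measure set (borel R N) -> \bar R}}
  {a : 'rV[R]_N -> 'rV[R]_N -> R} {varrho : R}.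
Hypothesis nf : nested_fractal phi L K.
Hypothesis hmu : normalized_hausdorff (hausdorff_dim M L) K mu.
Hypothesis hs : harmonic_structure phi a varrho.
Local Notation X := 'rV[R]_N.
Local Notation E0 := (energy0 phi a).
Local Notation Em := (energym phi a varrho).
Local Notation dom := (energy_domain phi K a varrho).
Local Notation En := (energy phi a varrho).
Local Notation form := (energy_form phi a varrho).
Local Notation flat := (flat (phi := phi) (K := K) (a := a) (varrho := varrho)).
Local Notation sV := (V0_enum nf).
Implicit Types f g h : X -> R.

(** An identity for each conductance term that passes to the limit. It gives homogeneity of the form
    for real scalars directly, where the parallelogram law alone gives rational ones. *)
Let En_quad c f g : dom f -> dom g ->
  En (fun x => c * f x + g x) =
  c ^+ 2 * En f + c * (En (f \+ g) - En f - En g) + En g.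
Proof.
move=> df dg; apply: (energy_unique (K := K)).
  exact: (domainD nf hs (domainZ nf c df) dg).
rewrite (_ : (fun m => _) = fun m => c ^+ 2 * Em m f +
    c * (Em m (f \+ g) - Em m f - Em m g) + Em m g); last first.
  apply/funext => m; rewrite /energym.
  set q := varrho ^+ m; set s1 := \sum_w _; set s2 := \sum_w _.
  set s3 := \sum_w _; set s4 := \sum_w _.
  suff -> : s1 = c ^+ 2 * s2 + c * (s3 - s2 - s4) + s4 by ring.
  rewrite /s1 /s2 /s3 /s4 -!sumrB !mulr_sumr -!big_split /=; apply: eq_bigr => w _.
  rewrite !(energy0E nf).
  set t1 := \sum_(x <- _) _; set t2 := \sum_(x <- _) _.
  set t3 := \sum_(x <- _) _; set t4 := \sum_(x <- _) _.
  suff -> : t1 = c ^+ 2 * t2 + c * (t3 - t2 - t4) + t4 by ring.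
  rewrite /t1 /t2 /t3 /t4 -!sumrB !mulr_sumr -!big_split /=; apply: eq_bigr => x _.
  rewrite -!sumrB !mulr_sumr -!big_split /=; apply: eq_bigr => y _.
  by ring.
apply: cvgD; last exact: (energy_cvg nf hs).
apply: cvgD; first by apply: cvgMl_tmp; exact: (energy_cvg nf hs).
apply: cvgMl_tmp; apply: cvgB; last exact: (energy_cvg nf hs).
by apply: cvgB; apply: (energy_cvg nf hs) => //; exact: (domainD nf hs).
Qed.

Lemma formC f g : form f g = form g f.
Proof.
rewrite /energy_form (_ : f \+ g = g \+ f); first by ring.
by apply/funext => x /=; rewrite addrC.
Qed.

Lemma formZl c f g : dom f -> dom g -> form (fun x => c * f x) g = c * form f g.
Proof.
move=> df dg; rewrite /energy_form (_ : _ \+ g = fun x => c * f x + g x) //.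
by rewrite En_quad // (energyZ nf hs) //; ring.
Qed.

(** The Jordan-von Neumann argument: a linear combination of four parallelogram identities. *)
Lemma formDl f g h : dom f -> dom g -> dom h -> form (f \+ g) h = form f h + form g h.
Proof.
move=> df dg dh; rewrite /energy_form.
have par u v := energy_parallelogram (K := K) nf hs (f := u) (g := v).
have dD u v := domainD nf hs (f := u) (g := v).
have dB u v := domainB nf hs (f := u) (g := v).
have h1 := par _ _ (dD _ _ df dh) dg; have h2 := par _ _ df (dB _ _ dh dg).
have h3 := par _ _ (dD _ _ df dg) dh; have h4 := par _ _ dh dg.
have e1 : (f \+ h) \+ g = (f \+ g) \+ h by apply/funext => x /=; ring.
have e2 : (f \+ h) \- g = f \+ (h \- g) by apply/funext => x /=; ring.
have e3 : (f \+ g) \- h = f \- (h \- g) by apply/funext => x /=; ring.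
have e4 : h \+ g = g \+ h by apply/funext => x /=; ring.
rewrite e1 e2 in h1; rewrite e3 in h3; rewrite e4 in h4; lra.
Qed.

Lemma formff f : dom f -> form f f = En f.
Proof.
move=> df; rewrite /energy_form (_ : f \+ f = fun x => 2 * f x); last first.
  by apply/funext => x /=; ring.
by rewrite (energyZ nf hs) //; field.
Qed.

Lemma form_eqK f g h : (forall x, K x -> f x = g x) -> form f h = form g h.
Proof.
move=> fg; rewrite /energy_form (energy_eqK nf fg); congr (_ * (_ - _ - _)).
by apply: (energy_eqK nf) => x /fg /= ->.
Qed.

Lemma domain_sum n (c : 'I_n -> R) (e : 'I_n -> X -> R) : (forall i, dom (e i)) ->
  dom (fun x => \sum_(i < n) c i * e i x).
Proof.
move=> de; elim: n c e de => [|n IH] c e de.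
  by apply: (domain_eqK nf (f := fun=> 0)) (domain_cst nf 0) => x _; rewrite big_ord0.
have := domainD nf hs (domainZ nf (c ord0) (de ord0))
  (IH (fun i => c (lift ord0 i)) (fun i => e (lift ord0 i)) (fun i => de _)).
by apply: (domain_eqK nf) => x _; rewrite big_ord_recl.
Qed.

Lemma form_sum n (c : 'I_n -> R) (e : 'I_n -> X -> R) g : (forall i, dom (e i)) -> dom g ->
  form (fun x => \sum_(i < n) c i * e i x) g = \sum_(i < n) c i * form (e i) g.
Proof.
move=> de dg; elim: n c e de => [|n IH] c e de.
  rewrite big_ord0 (form_eqK (g := fun x => 0 * g x)) => [|x _]; last first.
    by rewrite big_ord0 mul0r.
  by rewrite formZl // mul0r.
rewrite (form_eqK (g := (fun x => c ord0 * e ord0 x) \+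
   (fun x => \sum_(i < n) c (lift ord0 i) * e (lift ord0 i) x))) => [|x _]; last first.
  by rewrite big_ord_recl.
rewrite formDl ?IH //; last exact: domain_sum; last exact: (domainZ nf).
by rewrite formZl // big_ord_recl.
Qed.

(** The Cauchy-Schwarz inequality on each conductance term at each finite level. *)
Lemma energy_comb_le n (c : 'I_n -> R) (e : 'I_n -> X -> R) : (forall i, dom (e i)) ->
  En (fun x => \sum_(i < n) c i * e i x) <= (\sum_(i < n) c i ^+ 2) * \sum_(i < n) En (e i).
Proof.
move=> de; apply: (energy_le nf hs (domain_sum c de)) => m.
have c0 : 0 <= \sum_(i < n) c i ^+ 2 by apply: sumr_ge0 => i _; exact: sqr_ge0.
have H : \sum_(i < n) Em m (e i) <= \sum_(i < n) En (e i).
  by apply: ler_sum => i _; exact: (energym_le_energy nf hs).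
apply: le_trans (ler_wpM2l c0 H).
have -> : \sum_(i < n) Em m (e i) =
    varrho ^+ m * \sum_(i < n) \sum_(w : m.-tuple 'I_M) E0 (e i \o phiw phi w).
  by rewrite mulr_sumr.
rewrite mulrCA; apply: ler_wpM2l; first exact: (varrho_ge0 hs).
rewrite [X in _ <= _ * X]exchange_big [leRHS]mulr_sumr; apply: ler_sum => w _ /=.
rewrite (energy0E nf); under [X in _ <= _ * X]eq_bigr do rewrite (energy0E nf).
rewrite -[X in _ <= _ * X]mulr_sumr mulrCA; apply: ler_wpM2l; first by rewrite invr_ge0.
rewrite [X in _ <= _ * X]exchange_big [leRHS]mulr_sumr big_seq [leRHS]big_seq; apply: ler_sum => x xV /=.
rewrite [X in _ <= _ * X]exchange_big [leRHS]mulr_sumr big_seq [leRHS]big_seq; apply: ler_sum => y yV /=.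
rewrite -[X in _ <= _ * X]mulr_sumr -sumrB.
have [->|xy] := pselect (x = y).
  rewrite [X in X ^+ 2]big1 => [|i _]; last by rewrite subrr.
  by rewrite [X in _ <= _ * (_ * X)]big1 => [|i _]; rewrite ?subrr ?expr0n ?mulr0.
rewrite [leRHS]mulrCA; apply: ler_wpM2l.
  exact: cm_ge0 (hs_conductivity hs) _ _ ((mem_V0 nf x).1 xV) ((mem_V0 nf y).1 yV) xy.
apply: le_trans (sum_cauchy_schwarz c _); rewrite le_eqVlt; apply/orP; left; apply/eqP.
by congr (_ ^+ 2); apply: eq_bigr => i _; rewrite mulrBr.
Qed.

Local Notation Ht := (Htilde phi K a varrho).
Local Notation innerH := (innerH phi a varrho).

Lemma flatZ c f : flat f -> flat (fun x => c * f x).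
Proof.
move=> [df Ef]; split; first exact: (domainZ nf).
by rewrite (energyZ nf hs) // Ef (energy0Z nf).
Qed.

Lemma flatD f g : flat f -> flat g -> flat (f \+ g).
Proof.
move=> ff fg; have := flatB nf hs ff (flatZ (-1) fg).
by apply: (flat_eqK nf) => x _ /=; ring.
Qed.

Lemma flat_shift c f : flat f -> flat (fun x => f x + c).
Proof.
by move=> ff; have := flatD ff (flat_cst nf hs c); apply: (flat_eqK nf).
Qed.

Lemma flat_sum n (c : 'I_n -> R) (e : 'I_n -> X -> R) : (forall i, flat (e i)) ->
  flat (fun x => \sum_(i < n) c i * e i x).
Proof.
move=> de; elim: n c e de => [|n IH] c e de.
  by apply: (flat_eqK nf (f := fun=> 0)) (flat_cst nf hs 0) => x _; rewrite big_ord0.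
have := flatD (flatZ (c ord0) (de ord0))
  (IH (fun i => c (lift ord0 i)) (fun i => e (lift ord0 i)) (fun i => de _)).
by apply: (flat_eqK nf) => x _; rewrite big_ord_recl.
Qed.

Lemma V0_size_gt0 : 0 < (size sV)%:R :> R.
Proof.
have [z [_ [Vz _ _]]] := nf_V0 nf; rewrite ltr0n.
by have := (mem_V0 nf z).2 Vz; case: sV.
Qed.

Lemma energy_cst c : En (fun=> c) = 0.
Proof.
have [_ ->] := flat_cst (K := K) nf hs c; rewrite (energy0E nf) big1 ?mulr0 // => x _.
by rewrite big1 // => y _; rewrite subrr expr0n mulr0.
Qed.

Lemma innerH_cst f c : innerH f (cst c) = (\sum_(x <- sV) f x) * ((size sV)%:R * c).
Proof.
rewrite /Defs.innerH !(sum_V0E nf) /energy_form.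
rewrite (_ : f \+ cst c = fun x => f x + c) // (energy_shift nf) (energy_cst c).
rewrite subrr subr0 mulr0 add0r; congr (_ * _).
by rewrite big_const_seq count_predT iter_addr_0 mulr_natl.
Qed.

Lemma HtildeP h : Ht h <-> flat h /\ \sum_(x <- sV) h x = 0.
Proof.
split=> [[/(flat_harmonic nf hmu hs) fh H]|[/(flat_harmonic nf hmu hs) fh H]]; split=> //.
  have := H 1; rewrite innerH_cst mulr1 => /eqP; rewrite mulf_eq0 (gt_eqF V0_size_gt0) orbF.
  by move/eqP.
by move=> c; rewrite innerH_cst H mul0r.
Qed.

Lemma Ptilde_Htilde h : flat h -> Ht (Ptilde phi a varrho h).
Proof.
move=> fh; apply/HtildeP; split; first exact: flat_shift.
rewrite /Ptilde sumrB big_const_seq count_predT iter_addr_0 -mulr_natl !innerH_cst.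
have s0 := lt0r_neq0 V0_size_gt0.
by rewrite big_const_seq count_predT iter_addr_0 -mulr_natl; field.
Qed.

Lemma MtildewE w h : exists c, forall x, Mtildew phi a varrho w h x = h (phiw phi w x) + c.
Proof.
elim/last_ind: w => [|w i [c IH]]; first by exists 0 => x; rewrite addr0.
rewrite /Mtildew foldl_rcons -/(Mtildew phi a varrho w h) /Mtilde /Ptilde.
set t := _ / _; exists (c - t) => x; rewrite /= IH phiw_rcons; ring.
Qed.

Lemma Mtildew_Htilde w h : Ht h -> Ht (Mtildew phi a varrho w h).
Proof.
move=> Hh; elim/last_ind: w => [//|w i].
rewrite /Mtildew foldl_rcons -/(Mtildew phi a varrho w h) => /HtildeP[fw _].
by apply: Ptilde_Htilde; exact: (flat_phiw nf hs [:: i] fw).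
Qed.

Lemma energy_Mtildew w h : En (Mtildew phi a varrho w h) = En (h \o phiw phi w).
Proof.
have [c H] := MtildewE w h; rewrite -[RHS](energy_shift nf c).
by apply: (energy_eqK nf) => x _; exact: H.
Qed.

Section Basis.
Context {n : nat} {e : 'I_n -> X -> R}.
Hypothesis onb : orthonormal_basis phi K a varrho e.

Lemma onb_flat i : flat (e i).
Proof. by have [] := (HtildeP _).1 (onb_in onb i). Qed.

Lemma onb_dom i : dom (e i). Proof. by have [] := onb_flat i. Qed.

Lemma onb_energy i : En (e i) = 1.
Proof. by rewrite -(formff (onb_dom i)) (onb_orth onb) eqxx. Qed.

Lemma onb_expansion h : Ht h -> exists c : 'I_n -> R,
  [/\ forall x, K x -> h x = \sum_(i < n) c i * e i x,
      forall i, c i = form (e i) h & En h = \sum_(i < n) c i ^+ 2].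
Proof.
move=> Hh; have [[dh _] _] := (HtildeP _).1 Hh.
have [c Hc] := onb_span onb Hh; exists c.
have hK x : K x -> h x = \sum_(i < n) c i * e i x by move=> Kx; rewrite Hc ?inE.
have cE i : c i = form (e i) h.
  rewrite formC (form_eqK _ hK) (form_sum c onb_dom (onb_dom i)).
  rewrite (bigD1 i) //= (onb_orth onb) eqxx mulr1 big1 ?addr0 // => j ji.
  by rewrite (onb_orth onb) (negbTE ji) mulr0.
split=> //; rewrite -(formff dh) {1}(form_eqK _ hK) (form_sum c onb_dom dh).
by apply: eq_bigr => i _; rewrite -cE.
Qed.

Lemma onb_trace w : \tr ((op_mx phi a varrho e (Mtildew phi a varrho w))^T *m
    op_mx phi a varrho e (Mtildew phi a varrho w)) = \sum_(i < n) En (e i \o phiw phi w).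
Proof.
apply: eq_bigr => j _; rewrite !mxE -energy_Mtildew.
have [c [_ cE ->]] := onb_expansion (Mtildew_Htilde w (onb_in onb j)).
by apply: eq_bigr => i _; rewrite !mxE cE.
Qed.

(** The sum on the right is the squared Hilbert-Schmidt norm of Mtilde_w, by [onb_trace]; constants
    split off by the projection do not change energies. *)
Lemma onb_energy_phiw_le w h : flat h ->
  En (h \o phiw phi w) <= En h * \sum_(i < n) En (e i \o phiw phi w).
Proof.
move=> fh; have [c [hK _]] := onb_expansion (Ptilde_Htilde fh).
rewrite [En (Ptilde _ _ _ _)](energy_shift nf) => ->.
have -> : En (h \o phiw phi w) = En (fun x => \sum_(i < n) c i * (e i \o phiw phi w) x).
  rewrite -(energy_shift nf (- (innerH h (cst 1) / innerH (cst 1) (cst 1)))).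
  by apply: (energy_eqK nf) => x Kx; rewrite -hK //; exact: (phiw_K nf).
by apply: energy_comb_le => i; exact: (domain_phiw nf hs w (onb_dom i)).
Qed.

End Basis.

(** The squares of all form (e i) (e' j) sum to n' by Parseval in e, and to n by Parseval in e'. The
    comparison is needed because the trace of each word may be expressed in its own basis. *)
Lemma onb_card_le n n' (e : 'I_n -> X -> R) (e' : 'I_n' -> X -> R) :
  orthonormal_basis phi K a varrho e -> orthonormal_basis phi K a varrho e' ->
  n'%:R <= n%:R :> R.
Proof.
move=> o o'.
have -> : n'%:R = \sum_(j < n') \sum_(i < n) form (e i) (e' j) ^+ 2 :> R.
  transitivity (\sum_(j < n') (1 : R)).
    by rewrite sumr_const card_ord.
  apply: eq_bigr => j _; rewrite -(onb_energy o' j).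
  have [c [_ cE ->]] := onb_expansion o (onb_in o' j).
  by apply: eq_bigr => i _; rewrite cE.
have -> : n%:R = \sum_(i < n) (1 : R) by rewrite sumr_const card_ord.
rewrite exchange_big /=; apply: ler_sum => i _; rewrite -(onb_energy o i).
have [c [_ cE ->]] := onb_expansion o' (onb_in o i).
by apply: ler_sum => j _; rewrite cE formC.
Qed.

(** * The Kusuoka measure of cells and the energy of harmonic functions *)

Section Kusuoka.
Context {nu : {measure set (borel R N) -> \bar R}}.
Hypothesis nd : nondegenerate phi K a varrho.
Hypothesis kn : kusuoka_measure phi K a varrho nu.

Lemma flat_phiw_surj v k : Ht k -> exists h c, Ht h /\
  forall x, K x -> h (phiw phi v x) = k x + c.
Proof.
elim: v k => [|i v IH] k Hk; first by exists k, 0; split => // x _; rewrite addr0.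
have [h' [c [Hh' H']]] := IH _ Hk.
have [h Hh H] := (nd i).2 _ Hh'.
have [c' E] := MtildewE [:: i] h.
exists h, (c - c'); split => // x Kx.
have Kv := phiw_K nf v Kx.
have := H _ (mem_set Kv); rewrite H' // => Hk'.
have := E (phiw phi v x); rewrite [LHS]Hk' /=.
by move=> /eqP; rewrite -subr_eq => /eqP <-; ring.
Qed.

Lemma kusuoka_trace w : exists n (e : 'I_n -> X -> R), orthonormal_basis phi K a varrho e /\
  nu (cell phi K w) = (varrho ^+ size w * \sum_(i < n) En (e i \o phiw phi w))%:E.
Proof.
have [t [n [ e [ob tE]]] ->] := km_cell kn (in_tuple w).
by exists n, e; split => //; rewrite tE (onb_trace ob).
Qed.

Lemma kusuoka_cell_fin w : nu (cell phi K w) \is a fin_num.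
Proof. by have [n [ e [_ ->]]] := kusuoka_trace w. Qed.

Lemma kusuoka_energy_le w h : flat h ->
  varrho ^+ size w * En (h \o phiw phi w) <= En h * fine (nu (cell phi K w)).
Proof.
move=> fh; have [n [ e [ob ->]]] := kusuoka_trace w.
rewrite mulrCA; apply: ler_wpM2l; first exact: (varrho_ge0 hs).
exact: onb_energy_phiw_le.
Qed.

(* The inverses of the maps Mtilde are bounded, so that passing from K_u to its
   copy K_{vu} costs at most a factor depending on v. *)
Lemma kusuoka_cell_cat v : exists2 C, 0 <= C &
  forall u, fine (nu (cell phi K u)) <= C * fine (nu (cell phi K (v ++ u))).
Proof.
have [n [ e [ob _]]] := kusuoka_trace [::].
(* These preimages of the basis under Mtilde_v depend on v only, which makes the constant
   independent of u. *)
have /choice[h Hh] : forall i, exists h, exists c, Ht h /\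
    forall x, K x -> h (phiw phi v x) = e i x + c.
  by move=> i; exact: flat_phiw_surj (onb_in ob i).
have hflat i : flat (h i) by have [c [/HtildeP[]]] := Hh i.
have hdom i : dom (h i) by have [] := hflat i.
have H0 : 0 <= \sum_(i < n) En (h i).
  by apply: sumr_ge0 => i _; exact: (energy_ge0 nf hs).
have v0 := varrho_ge0 hs (size v).
have v1 : 1 <= varrho ^+ size v by rewrite exprn_ege1 // ltW // (hs_varrho hs).
exists (n%:R * \sum_(i < n) En (h i)); first by rewrite mulr_ge0.
move=> u; have [n' [ e' [ob' E']]] := kusuoka_trace u.
rewrite E' [fine _]/=.
have step j : varrho ^+ size u * En (e' j \o phiw phi u) <=
    (\sum_(i < n) En (h i)) * fine (nu (cell phi K (v ++ u))).
  have [c [hK cE Ec]] := onb_expansion ob (onb_in ob' j).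
  rewrite (onb_energy ob') in Ec.
  pose k x := \sum_(i < n) c i * h i x.
  have fk : flat k by exact: flat_sum.
  have Ek : En k <= \sum_(i < n) En (h i).
    by have := energy_comb_le c hdom; rewrite -Ec mul1r.
  have [b Hb] : exists b, forall x, K x -> k (phiw phi v x) = e' j x + b.
    have /choice[b Hb] : forall i, exists b, forall x, K x -> h i (phiw phi v x) = e i x + b.
      by move=> i; have [b [_ H]] := Hh i; exists b.
    exists (\sum_(i < n) c i * b i) => x Kx.
    rewrite /k hK // -big_split /=; apply: eq_bigr => i _.
    by rewrite Hb // mulrDr.
  have -> : En (e' j \o phiw phi u) = En (k \o phiw phi (v ++ u)).
    rewrite -(energy_shift nf b); apply: (energy_eqK nf) => x Kx /=.
    by rewrite phiw_cat Hb //; exact: (phiw_K nf).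
  have dk := domain_phiw nf hs (v ++ u) fk.1.
  have E0k := energy_ge0 nf hs dk.
  have f0 : 0 <= fine (nu (cell phi K (v ++ u))) by apply: fine_ge0.
  apply: le_trans (le_trans (kusuoka_energy_le (v ++ u) fk) _); last exact: ler_wpM2r.
  rewrite size_cat exprD -mulrA ler_peMl // mulr_ge0 //.
  exact: varrho_ge0 hs _.
rewrite mulr_sumr; apply: (le_trans (ler_sum _ (fun j _ => step j))).
rewrite sumr_const card_ord -[leLHS]mulr_natl mulrA; apply: ler_wpM2r.
  exact: fine_ge0.
by apply: ler_wpM2r => //; exact: (onb_card_le ob ob').
Qed.

Lemma kusuoka_fin : (nu setT < +oo)%E.
Proof.
have := kusuoka_cell_fin [::]; rewrite cell_nil => fK.
rewrite -(setvU (K : set (borel R N))); apply: le_lt_trans (measure_setU_le _ _ _) _.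
- exact: measurableC (measurable_K nf).
- exact: measurable_K nf.
by rewrite (km_support kn) add0e; rewrite ltey_eq fK.
Qed.

End Kusuoka.

End EnergyForm.

(** * Energy densities *)

Section KusuokaDensity.
Context {R : realType} {N M : nat} {L : R} {phi : 'I_M -> 'rV[R]_N -> 'rV[R]_N}
  {K : set 'rV[R]_N} {mu nu : {measure set (borel R N) -> \bar R}}
  {a : 'rV[R]_N -> 'rV[R]_N -> R} {varrho : R}.
Hypothesis nf : nested_fractal phi L K.
Hypothesis hmu : normalized_hausdorff (hausdorff_dim M L) K mu.
Hypothesis hs : harmonic_structure phi a varrho.
Hypothesis nd : nondegenerate phi K a varrho.
Hypothesis kn : kusuoka_measure phi K a varrho nu.
Local Notation X := 'rV[R]_N.
Local Notation dom := (energy_domain phi K a varrho).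
Local Notation En := (energy phi a varrho).
Let cell_fin := kusuoka_cell_fin nf hmu hs kn.
Let nu_fin := kusuoka_fin nf hmu hs kn.

Lemma kusuoka_Vinf_null : measurable (Vinf phi : set (borel R N)) /\ nu (Vinf phi) = 0%E.
Proof.
by have cV := Vinf_countable nf; split; [exact: countable_borel|exact: countable_null (km_atomless kn) cV].
Qed.

Lemma measurable_preimage_phiw v (B : set (borel R N)) : measurable B ->
  measurable (phiw phi v @^-1` B : set (borel R N)).
Proof.
move=> mB; rewrite -[X in measurable X]setTI.
exact: (continuous_borel (continuous_phiw nf (w := v))).
Qed.

(** Up to the complement of K, the open preimage D is the increasing union of the cells K_u
    contained in it. Their images K_vu lie in U and overlap in a null set, so [kusuoka_cell_cat] can
    be summed. *)
Lemma kusuoka_preimage_open v : exists2 C, 0 <= C & forall U : set 'rV[R]_N, open U ->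
  (nu (phiw phi v @^-1` U : set (borel R N)) <= C%:E * nu U)%E.
Proof.
have [C C0 HC] := kusuoka_cell_cat nf hmu hs nd kn v; exists C => // U oU.
set D : set (borel R N) := phiw phi v @^-1` U.
have oD : open (D : set 'rV[R]_N) by apply: open_comp => // x _; exact: (continuous_phiw nf (w := v)).
have mU : measurable (U : set (borel R N)) by exact: open_borel.
have mD : measurable D by exact: measurable_preimage_phiw.
have [mV V0] := kusuoka_Vinf_null.
pose P m (u : m.-tuple 'I_M) := `[< cell phi K u `<=` D >].
pose A m : set (borel R N) := \big[setU/set0]_(u : m.-tuple 'I_M | P m u) (cell phi K u : set (borel R N)).
have AE m x : A m x <-> exists u : m.-tuple 'I_M, cell phi K u `<=` D /\ cell phi K u x.
  rewrite /A -bigcup_seq_cond.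
  split=> [[u /= /andP[_ /asboolP uD] ux]|[u [uD ux]]]; first by exists u.
  by exists u => //=; rewrite mem_index_enum; apply/asboolP.
have mA m : measurable (A m).
  by apply: bigsetU_measurable => u _; exact: measurable_cell nf u.
have A_le m : (nu (A m) <= C%:E * nu U)%E.
  have h1 : (nu (A m) <= \sum_(u : m.-tuple 'I_M | P m u) nu (cell phi K u : set (borel R N)))%E.
    suff [] : measurable (A m) /\ (nu (A m) <= \sum_(u : m.-tuple 'I_M | P m u) nu (cell phi K u : set (borel R N)))%E by [].
    rewrite /A; apply: (big_ind2 (fun (B : set (borel R N)) t => measurable B /\ (nu B <= t)%E)).
    - by split; [exact: measurable0|rewrite measure0].
    - move=> B1 t1 B2 t2 [mB1 H1] [mB2 H2]; split; first exact: measurableU.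
      exact: le_trans (measure_setU_le nu mB1 mB2) (leeD H1 H2).
    - by move=> u _; split => //; exact: measurable_cell nf u.
  apply: (le_trans h1).
  have h2 : (\sum_(u : m.-tuple 'I_M | P m u) nu (cell phi K u : set (borel R N)) <=
      \sum_(u : m.-tuple 'I_M | P m u) (C%:E * nu (cell phi K (v ++ u) : set (borel R N))))%E.
    apply: lee_sum => u _; rewrite -[nu (cell phi K u)]fineK ?cell_fin //.
    by rewrite -[nu (cell _ _ (_ ++ _))]fineK ?cell_fin // -EFinM lee_fin.
  apply: (le_trans h2); rewrite -ge0_sume_distrr //; apply: lee_pmul => //.
    by apply: sume_ge0.
  have := @sum_integral_le _ _ _ nu _ (fun u : m.-tuple 'I_M => cell phi K (v ++ u) : set (borel R N))
    U (Vinf phi) (fun u => measurable_cell nf (v ++ u)) mU mV V0 (P m) (fun _ _ => 1%E) (fun _ => 1%E).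
  rewrite integral_cst // mul1e.
  have Ec (u : m.-tuple 'I_M) : (\int[nu]_(x in (cell phi K (v ++ u) : set (borel R N))) 1 =
      nu (cell phi K (v ++ u)))%E.
    by rewrite (integral_cst _ (measurable_cell nf (v ++ u))) mul1e.
  move=> H; rewrite -(eq_bigr _ (fun u _ => Ec u)); apply: H => //.
  - by move=> u /asboolP uD x [y Ky <-]; rewrite phiw_cat; apply: uD; exists y.
  - move=> u u' x _ _ ux u'x uu'; apply: (cell_meet_Vinf nf hmu _ _ ux u'x).
      by rewrite !size_cat !size_tuple.
    move=> E; apply: uu'; apply: val_inj; have := congr1 (drop (size v)) E.
    by rewrite !drop_size_cat.
have UA : D `&` K = \bigcup_m A m.
  apply/seteqP; split=> [x [Dx Kx]|x [m _ /AE[u [uD ux]]]]; last first.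
    by split; [exact: uD|exact: cell_sub_K nf u _ ux].
  have /nbhs_edist[r r0 Hr] : nbhs (x : 'rV[R]_N) D by exact: open_nbhs_nbhs.
  have [m Hm] := expr_arbitrarily_small (scaleV_ge0 nf) (scaleV_lt1 nf) r0.
  have [u ux] := tuple_cell_ex nf m Kx.
  exists m => //; apply/AE; exists u; split=> // y uy; apply: Hr.
  by apply: le_lt_trans (Hm m (leqnn m)); rewrite -[X in _ ^+ X](size_tuple u) (cell_diam nf).
have ndA : nondecreasing_seq A.
  apply/nondecreasing_seqP => m; apply/subsetPset => x /AE[u [uD [y Ky yx]]].
  apply/AE; have [i [z Kz zy]] : exists i, (phi i @` K) y.
    by move: Ky; rewrite {1}(nf_invariant nf) => -[i _ H]; exists i.
  exists [tuple of rcons u i]; split; last first.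
    by exists z => //; rewrite phiw_rcons zy.
  apply: subset_trans uD; exact: (cell_rcons_sub nf).
have -> : nu D = nu (D `&` K).
  have mK := measurable_K nf.
  apply/eqP; rewrite eq_le; apply/andP; split; last first.
    apply: le_measure; rewrite ?inE //; exact: measurableI.
  have -> : nu (D `&` K) = (nu (D `&` K) + nu (~` (K : set (borel R N))))%E.
    by rewrite (km_support kn) adde0.
  apply: le_trans (measure_setU_le nu _ _).
  + apply: le_measure; rewrite ?inE //.
      by apply: measurableU; [exact: measurableI|exact: measurableC].
    by move=> x Dx; have [Kx|nK] := pselect (K x); [left|right].
  + exact: measurableI.
  + exact: measurableC.
rewrite UA; have mUA : measurable (\bigcup_m A m) by exact: bigcupT_measurable.
have cv := nondecreasing_cvg_mu mA mUA ndA (mu := nu).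
rewrite -(cvg_lim (@ereal_hausdorff R) cv); apply: lime_le; first by apply/cvg_ex; eexists; exact: cv.
by apply: nearW => m; exact: A_le.
Qed.

(** By regularity B lies in an open set of small nu-measure, whose preimage is then small as
    well. *)
Lemma kusuoka_preimage_null v (B : set (borel R N)) : measurable B -> nu B = 0%E ->
  nu (phiw phi v @^-1` B : set (borel R N)) = 0%E.
Proof.
move=> mB B0; have [C C0 HC] := kusuoka_preimage_open v.
apply/eqP; rewrite eq_le measure_ge0 andbT; apply/lee_addgt0Pr => e e0; rewrite add0e.
have D0 : 0 < e / (C + 1) by rewrite divr_gt0 // ltr_wpDl.
have [F [U [cF oU FB BU mUF]]] := measurable_sandwiched nu_fin mB D0.
have mF : measurable F by exact: closed_borel.
have mU : measurable U by exact: open_borel.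
have F0 : nu F = 0%E.
  apply/eqP; rewrite eq_le measure_ge0 andbT -B0; apply: le_measure; rewrite ?inE //.
have U_le : (nu U <= (e / (C + 1))%:E)%E.
  apply: le_trans (ltW mUF); rewrite -[leRHS]adde0 -F0.
  apply: le_trans (measure_setU_le nu (measurableD mU mF) mF).
  apply: le_measure; rewrite ?inE //; first by apply: measurableU => //; exact: measurableD.
  by move=> x Ux; have [Fx|nF] := pselect (F x); [right|left].
apply: le_trans (_ : nu (phiw phi v @^-1` U) <= _)%E.
  apply: le_measure; rewrite ?inE; try exact: measurable_preimage_phiw.
  by move=> x; exact: BU.
apply: (le_trans (HC U oU)); apply: (le_trans (lee_pmul _ _ (lexx _) U_le)) => //.
rewrite -EFinM lee_fin mulrCA ler_piMr //; first exact: ltW.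
by rewrite ler_pdivrMr ?mul1r ?lerDl // ltr_wpDl.
Qed.

Lemma kusuoka_pushforward_density v : exists U : borel R N -> R,
  [/\ measurable_fun setT U, forall x, 0 <= U x &
    forall A : set (borel R N), measurable A ->
      nu (phiw phi v @^-1` A : set (borel R N)) = (\int[nu]_(x in A) (U x)%:E)%E].
Proof.
have mv : measurable_fun [set: borel R N] (phiw phi v : borel R N -> borel R N).
  exact: (continuous_borel (continuous_phiw nf (w := v))).
have := @radon_nikodym_density _ _ _ (pushforward nu (phiw phi v : borel R N -> borel R N)) nu.
move=> /(_ mv); apply=> //.
by move=> A mA A0; exact: kusuoka_preimage_null.
Qed.

Lemma preimage_cell_fin v (A : set (borel R N)) : measurable A ->
  nu (phiw phi v @^-1` A : set (borel R N)) \is a fin_num.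
Proof.
move=> mA; rewrite ge0_fin_numE //; apply: measure_lt_pinfty => //.
exact: measurable_preimage_phiw.
Qed.

(** The right side is the value on K_w of a measure: the images of nu under the maps phi_u, weighted
    by the energies of f on the cells of level n. *)
Lemma piecewise_flat_cell_le n f w : piecewise_flat (phi := phi) (K := K) (a := a) (varrho := varrho) n f ->
  varrho ^+ size w * En (f \o phiw phi w) <=
  \sum_(u : n.-tuple 'I_M) varrho ^+ n * En (f \o phiw phi u) *
     fine (nu (phiw phi u @^-1` (cell phi K w) : set (borel R N))).
Proof.
move=> [df ff]; have v0 := varrho_ge0 hs.
have mC := measurable_cell nf w.
have En0 u : 0 <= En (f \o phiw phi u).
  by apply: (energy_ge0 nf hs); exact: (domain_phiw nf hs).
have t0 k u : 0 <= varrho ^+ k * En (f \o phiw phi u) *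
     fine (nu (phiw phi u @^-1` (cell phi K w) : set (borel R N))).
  by rewrite !mulr_ge0 // fine_ge0.
have mono u (B : set (borel R N)) : measurable B -> (forall x, B x -> cell phi K w (phiw phi u x)) ->
    fine (nu B) <= fine (nu (phiw phi u @^-1` (cell phi K w) : set (borel R N))).
  move=> mB BC; apply: fine_le.
  - by rewrite ge0_fin_numE //; exact: (measure_lt_pinfty nu_fin).
  - exact: preimage_cell_fin.
  - apply: le_measure; rewrite ?inE //; exact: measurable_preimage_phiw.
(* If K_w lies inside a cell K_v of level n, the term of v suffices, f being flat there. Otherwise
   K_w is a union of cells of level n, and for each of them the preimage of K_w contains all of
   K. *)
have [nw|/ltnW wn] := leqP n (size w).
  pose v := take n w; pose u := drop n w.
  have wE : w = v ++ u by rewrite cat_take_drop.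
  have sv : size v == n by rewrite size_takel.
  rewrite (bigD1 (Tuple sv)) //= -[leLHS]addr0; apply: lerD; last first.
    by apply: sumr_ge0 => z _; exact: t0.
  have h1 := kusuoka_energy_le nf hmu hs kn u (ff v (eqP sv)).
  have h2 : fine (nu (cell phi K u)) <= fine (nu (phiw phi v @^-1` (cell phi K w) : set (borel R N))).
    apply: mono; first exact: measurable_cell nf u.
    by move=> x [y Ky <-]; exists y => //; rewrite wE phiw_cat.
  have -> : varrho ^+ size w * En (f \o phiw phi w) =
      varrho ^+ n * (varrho ^+ size u * En ((f \o phiw phi v) \o phiw phi u)).
    have -> : size w = (n + size u)%N by rewrite size_drop subnKC.
    rewrite exprD -mulrA; congr (_ * (_ * En _)).
    by apply/funext => x; rewrite /= -phiw_cat cat_take_drop.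
  rewrite -mulrA; apply: ler_wpM2l => //.
  by apply: le_trans h1 _; apply: ler_wpM2l.
move: ff t0; rewrite -(subnKC wn); move: (n - size w)%N => k ff t0.
rewrite (sum_tuple_cat (size w) k (fun u => varrho ^+ (size w + k) * En (f \o phiw phi u) *
     fine (nu (phiw phi u @^-1` (cell phi K w) : set (borel R N))))).
rewrite (bigD1 (in_tuple w)) //= -[leLHS]addr0; apply: lerD; last first.
  by apply: sumr_ge0 => z _; apply: sumr_ge0 => z' _; exact: t0.
rewrite (energy_split nf hs k (domain_phiw nf hs w df)) mulr_sumr; apply: ler_sum => u _.
have su : size (w ++ u) = (size w + k)%N by rewrite size_cat size_tuple.
have h1 := kusuoka_energy_le nf hmu hs kn [::] (ff _ su).
rewrite expr0 mul1r in h1.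
have h2 : fine (nu (cell phi K [::])) <=
    fine (nu (phiw phi (w ++ u) @^-1` (cell phi K w) : set (borel R N))).
  apply: mono; first exact: measurable_cell nf [::].
  rewrite cell_nil => x Kx; exists (phiw phi u x); last by rewrite phiw_cat.
  exact: (phiw_K nf).
have -> : (f \o phiw phi w) \o phiw phi u = f \o phiw phi (w ++ u).
  by apply/funext => x; rewrite /= phiw_cat.
rewrite mulrA -exprD -mulrA; apply: ler_wpM2l => //.
by apply: le_trans h1 _; apply: ler_wpM2l.
Qed.

(** Each increment of [piecewise_flat_series] has a density with respect to nu by the previous
    lemma; g^2 is the weighted sum of these densities. *)
Lemma energy_density f : dom f -> exists g : borel R N -> R,
  [/\ measurable_fun setT g, forall x, 0 <= g x,
    (\int[nu]_(x in setT) (g x ^+ 2)%:E < +oo)%E &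
    forall w, ((varrho ^+ size w * En (f \o phiw phi w))%:E <=
      \int[nu]_(x in (cell phi K w : set (borel R N))) (g x ^+ 2)%:E)%E].
Proof.
move=> df; have [d [n [D [D0 fd Ed Hsum]]]] := piecewise_flat_series nf hmu hs df.
have /choice[U HU] := kusuoka_pushforward_density.
have mU v : measurable_fun setT (U v) by case: (HU v).
have U0 v x : 0 <= U v x by case: (HU v).
have UI v (A : set (borel R N)) : measurable A ->
   (\int[nu]_(x in A) (U v x)%:E = nu (phiw phi v @^-1` A : set (borel R N)))%E.
  by move=> mA; case: (HU v) => _ _ ->.
(* The weight 2 * 2^j is that of [Hsum]; against an energy of order 4^-j it leaves a total integral
   of order 2^-j. *)
pose c j u := 2 * 2 ^+ j * (varrho ^+ n j * En (d j \o phiw phi u)).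
have c0 j u : 0 <= c j u.
  rewrite !mulr_ge0 ?exprn_ge0 //; first exact: ltW (varrho_gt0 hs).
  by apply: (energy_ge0 nf hs); apply: (domain_phiw nf hs); case: (fd j).
pose h j x : \bar R := (\sum_(u : (n j).-tuple 'I_M) (c j u)%:E * (U u x)%:E)%E.
have cU0 j (u : seq 'I_M) x : (0 <= (c j u)%:E * (U u x)%:E)%E.
  by rewrite -EFinM lee_fin mulr_ge0.
have mcU j (u : seq 'I_M) (A : set (borel R N)) : measurable_fun A (fun x => (c j u)%:E * (U u x)%:E)%E.
  apply: measurable_funTS; under eq_fun do rewrite -EFinM.
  by apply/measurable_EFinP; exact: measurable_funM.
have h0 j x : (0 <= h j x)%E by apply: sume_ge0 => u _; exact: cU0.
have mh j (A : set (borel R N)) : measurable_fun A (h j).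
  by apply: emeasurable_sum => u; exact: mcU.
have hI j (A : set (borel R N)) : measurable A -> (\int[nu]_(x in A) h j x =
   \sum_(u : (n j).-tuple 'I_M) (c j u)%:E * nu (phiw phi u @^-1` A : set (borel R N)))%E.
  move=> mA; rewrite (ge0_integral_sum _ mA) => [|u|u x _]; [|exact: mcU|exact: cU0].
  apply: eq_bigr => u _; rewrite ge0_integralZl_EFin ?UI // => [x _|].
    by rewrite lee_fin.
  by apply/measurable_EFinP; exact: measurable_funTS.
pose H x := (\sum_(0 <= j <oo) h j x)%E.
have H0 x : (0 <= H x)%E by apply: nneseries_ge0 => j _ _; exact: h0.
have mH (A : set (borel R N)) : measurable_fun A H.
  by apply: ge0_emeasurable_sum => [j x _ _|j _]; [exact: h0|exact: mh].
have HI (A : set (borel R N)) : measurable A ->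
    (\int[nu]_(x in A) H x = \sum_(0 <= j <oo) \int[nu]_(x in A) h j x)%E.
  by move=> mA; rewrite integral_nneseries.
have nuT : nu setT \is a fin_num by rewrite ge0_fin_numE.
have Hfin : (\int[nu]_(x in setT) H x < +oo)%E.
  rewrite (HI _ measurableT).
  apply: (@le_lt_trans _ _ (\sum_(0 <= j <oo) ((4 * D * fine (nu setT)) / (2 ^ j.+1)%:R)%:E)%E).
    apply: lee_nneseries => [j _ _|j _].
      by apply: integral_ge0 => x _; exact: h0.
    rewrite hI //; set t := fine (nu setT).
    have -> : (\sum_(u : (n j).-tuple 'I_M) (c j u)%:E *
        nu (phiw phi u @^-1` setT : set (borel R N)) =
        (\sum_(u : (n j).-tuple 'I_M) c j u * t)%:E)%E.
      rewrite -sumEFin; apply: eq_bigr => u _; rewrite (EFinM (c j u) t); congr (_ * _)%E.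
      by rewrite /t fineK.
    rewrite lee_fin -mulr_suml -mulr_sumr -(energy_split nf hs (n j)); last by case: (fd j).
    rewrite natrX exprS; have q0 : (0 : R) < 2 ^+ j by rewrite exprn_gt0.
    have t0 : 0 <= t by rewrite fine_ge0.
    have -> : 4 * D * t / (2 * 2 ^+ j) = 2 * 2 ^+ j * (D * 4^-1 ^+ j) * t.
      have -> : 4^-1 ^+ j = (2 ^+ j)^-1 * (2 ^+ j)^-1 :> R.
        by rewrite -invfM -exprMn exprVn; congr (_ ^- _); ring.
      by field; rewrite gt_eqF.
    apply: ler_wpM2r => //; apply: ler_wpM2l; last exact: Ed.
    by rewrite mulr_ge0 // ltW.
  apply: (le_lt_trans (epsilon_trick0 _ _)); last exact: ltry.
  by rewrite !mulr_ge0 // fine_ge0.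
have intH : nu.-integrable setT H.
  apply/integrableP; split => //.
  by under eq_integral do rewrite gee0_abs ?H0 //.
have aeH := integrable_ae measurableT intH.
(* H has a finite integral and is thus finite nu-almost everywhere; [fine] alters it on a null set
   only. *)
pose g x := Num.sqrt (fine (H x)).
have g2 x : g x ^+ 2 = fine (H x) by rewrite sqr_sqrtr // fine_ge0.
have mg : measurable_fun setT g.
  apply: (measurableT_comp (f := @Num.sqrt R)); last exact: measurableT_comp.
  exact: continuous_measurable_fun (@sqrt_continuous R).
have gI (A : set (borel R N)) : measurable A ->
    (\int[nu]_(x in A) (g x ^+ 2)%:E = \int[nu]_(x in A) H x)%E.
  move=> mA; apply: ae_eq_integral => //.
    by apply/measurable_EFinP; apply: measurable_funTS; exact: measurable_funX.
  by apply: filterS aeH => x Hx _; rewrite g2 fineK // Hx.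
exists g; split => //.
- by move=> x; exact: sqrtr_ge0.
- by rewrite gI.
move=> w; have mC := measurable_cell nf w; rewrite gI //.
have IC : (\int[nu]_(x in (cell phi K w : set (borel R N))) H x)%E \is a fin_num.
  rewrite ge0_fin_numE; last by apply: integral_ge0 => x _; exact: H0.
  by apply: le_lt_trans Hfin; apply: ge0_subset_integral.
rewrite -(fineK IC) lee_fin.
have half0 : (0 : R) <= 2^-1 by [].
have half1 : 2^-1 < 1 :> R by rewrite invf_lt1 // ltr1n.
apply: (@le_of_geometric_error _ _ _ D 2^-1 0) => // k _.
apply: (le_trans (Hsum w k)); rewrite lerD2r -lee_fin fineK // HI //.
apply: le_trans (nneseries_lim_ge k _); last first.
  by move=> j _ _; apply: integral_ge0 => x _; exact: h0.
rewrite big_mkord mulr_sumr -sumEFin; apply: lee_sum => j _; rewrite hI //.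
have -> : (\sum_(u : (n j).-tuple 'I_M) (c j u)%:E *
    nu (phiw phi u @^-1` (cell phi K w) : set (borel R N)) =
    (\sum_(u : (n j).-tuple 'I_M) c j u *
       fine (nu (phiw phi u @^-1` (cell phi K w) : set (borel R N))))%:E)%E.
  rewrite -sumEFin; apply: eq_bigr => u _; rewrite (EFinM (c j u)) fineK //.
  exact: preimage_cell_fin.
rewrite lee_fin mulrA.
have -> : \sum_(u : (n j).-tuple 'I_M) c j u *
       fine (nu (phiw phi u @^-1` (cell phi K w) : set (borel R N))) =
    2 * 2 ^+ j * \sum_(u : (n j).-tuple 'I_M) varrho ^+ n j * En (d j \o phiw phi u) *
       fine (nu (phiw phi u @^-1` (cell phi K w) : set (borel R N))).
  by rewrite mulr_sumr; apply: eq_bigr => u _; rewrite /c -!mulrA.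
apply: ler_wpM2l; first by rewrite mulr_ge0 // exprn_ge0.
exact: piecewise_flat_cell_le.
Qed.

End KusuokaDensity.

(** * From the Korevaar-Schoen condition to finite energy *)

Section WalkDimension.
Context {R : realType} {N M : nat} {L : R} {phi : 'I_M -> 'rV[R]_N -> 'rV[R]_N}
  {K : set 'rV[R]_N} {a : 'rV[R]_N -> 'rV[R]_N -> R} {varrho : R}.
Hypothesis nf : nested_fractal phi L K.
Hypothesis hs : harmonic_structure phi a varrho.
Local Notation dw := (walk_dim M L varrho).

Lemma mass_resistance_gt0 : 0 < M%:R * varrho.
Proof. by rewrite mulr_gt0 ?(card_gt0 nf) ?(varrho_gt0 hs). Qed.

Lemma scale_powR_walk (c : R) m : 0 <= c ->
  (c * L^-1 ^+ m) `^ dw = c `^ dw * (M%:R * varrho)^-1 ^+ m.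
Proof.
move=> c0; rewrite powRM ?exprn_ge0 ?(scaleV_ge0 nf) //; congr (_ * _).
have k0 := mass_resistance_gt0.
rewrite -!powR_mulrn ?(scaleV_ge0 nf) ?invr_ge0 ?(ltW k0) // powRAC; congr (_ `^ _).
rewrite (powR_scale nf) /walk_dim divfK; last by rewrite gt_eqF // (lnL_gt0 nf).
by rewrite expRN lnK.
Qed.

(** Places sigma = d_w/2 with p = 2 in the range of part (1). *)
Lemma walk_dim_gt : hausdorff_dim M L / 2 < dw / 2.
Proof.
rewrite ltr_pM2r // ltr_pM2r ?invr_gt0 ?(lnL_gt0 nf) //.
rewrite ltr_ln ?posrE ?mass_resistance_gt0 ?(card_gt0 nf) //.
by rewrite ltr_pMr ?(card_gt0 nf) // (hs_varrho hs).
Qed.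

Lemma walk_dim_half_gt0 : 0 < dw / 2.
Proof.
by apply: lt_trans walk_dim_gt; rewrite divr_gt0 // (hausdorff_dim_gt0 nf).
Qed.

End WalkDimension.

Section KSToEnergy.
Context {R : realType} {N M : nat} {L : R} {phi : 'I_M -> 'rV[R]_N -> 'rV[R]_N}
  {K : set 'rV[R]_N} {mu : {measure set (borel R N) -> \bar R}}
  {a : 'rV[R]_N -> 'rV[R]_N -> R} {varrho : R}.
Hypothesis nf : nested_fractal phi L K.
Hypothesis hmu : normalized_hausdorff (hausdorff_dim M L) K mu.
Hypothesis hs : harmonic_structure phi a varrho.
Local Notation X := 'rV[R]_N.
Local Notation dw := (walk_dim M L varrho).
Local Notation dom := (energy_domain phi K a varrho).
Local Notation cellB w := (cell phi K w : set (borel R N)).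
Local Notation kappa := (M%:R * varrho)^-1.
Context {f : borel R N -> R}.
Hypothesis fKS : KS_space K mu 2 (dw / 2) f.
Let mK : measurable (K : set (borel R N)) := measurable_K nf.
Let mc w : measurable (cellB w) := measurable_cell nf w.

Let intf : mu.-integrable K (EFin \o f).
Proof.
by have [fLp _] := fKS; apply: Lp_integrable fLp; rewrite ?(mu_K hmu) ?ltry ?ler1n.
Qed.

Let intfB (B : set (borel R N)) : measurable B -> B `<=` K -> mu.-integrable B (EFin \o f).
Proof. by move=> mB BK; apply: integrableS intf. Qed.

Let mf_sqr (B : set (borel R N)) c : measurable B -> B `<=` K ->
  measurable_fun B (fun x => ((f x - c) ^+ 2)%:E).
Proof.
move=> mB BK; apply/measurable_EFinP; apply: measurable_funX; apply: measurable_funB => //.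
by have /integrableP[/measurable_EFinP] := intfB mB BK.
Qed.

Let cellK w : cellB w `<=` K.
Proof. exact: cell_sub_K nf w. Qed.

Let Vnull : measurable (Vinf phi : set (borel R N)) /\ mu (Vinf phi) = 0%E.
Proof.
have cV := Vinf_countable nf; split; first exact: countable_borel.
by apply: countable_null cV; exact: (mu_point nf hmu).
Qed.

Let avg w := meanval mu f (cellB w).

Let muc w : mu (cellB w) = (M%:R^-1 ^+ size w)%:E.
Proof. exact: (mu_cell nf hmu w). Qed.

Let bV0 m : 0 < M%:R^-1 ^+ m :> R.
Proof. by rewrite exprn_gt0 // invr_gt0 (card_gt0 nf). Qed.

Let avg_dist w c : (((avg w - c) ^+ 2)%:E <=
  (M%:R ^+ size w)%:E * \int[mu]_(y in cellB w) ((f y - c) ^+ 2)%:E)%E.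
Proof.
have := mean_dist_sqr_le (mc w) (muc w) (bV0 _) (intfB (mc w) (@cellK w)) c.
by rewrite exprVn invrK.
Qed.

Let kappa_gt0 : 0 < kappa.
Proof. by rewrite invr_gt0 (mass_resistance_gt0 nf hs). Qed.

(* Fubini is not needed: for x in the cell of u the inner integral of the
   Korevaar-Schoen functional at scale 2L^-m dominates the distance of f x to
   the mean over any neighbouring cell. *)
Let neighbour_energy : exists (m0 : nat) (C : R), 0 <= C /\ forall m (p : m.-tuple 'I_M -> m.-tuple 'I_M) (P : pred (m.-tuple 'I_M)),
  (m0 <= m)%N -> (forall u, P u -> cellB u `&` cellB (p u) !=set0) ->
  (\sum_(u : m.-tuple 'I_M | P u) \int[mu]_(x in cellB u) ((f x - avg (p u)) ^+ 2)%:E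
    <= (C * kappa ^+ m)%:E)%E.
Proof.
have [_ /limf_esup_at_right0[e [C1 [e0 HC1]]]] := fKS.
have [C2 C20 HC2] := mu_eball_le nf hmu.
have two0 : (0 : R) < 2 by [].
have d0 := hausdorff_dim_gt0 nf.
have e2 : 0 < e / 2 by rewrite divr_gt0.
have [m0 Hm0] := expr_arbitrarily_small (scaleV_ge0 nf) (scaleV_lt1 nf) e2.
(* At radius eps = 2 L^-m, the ball has mass at most c1 M^-m, and eps^d_w = 2^d_w kappa^m because
   kappa = L^-d_w. *)
pose c1 := C2 * 2 `^ hausdorff_dim M L; pose c2 := c1 * 2 `^ dw.
have c1_gt0 : 0 < c1 by rewrite mulr_gt0 // powR_gt0.
have c2_gt0 : 0 < c2 by rewrite mulr_gt0 // powR_gt0.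
exists m0, (c2 * `|C1|); split=> [|m p P mm HP]; first by rewrite mulr_ge0 // ltW.
(* Two diameters: the ball of this radius around any x in the cell of u contains the whole cell of p
   u. *)
pose eps := 2 * L^-1 ^+ m.
have Lm : 0 < L^-1 ^+ m by rewrite exprn_gt0 // invr_gt0 (scale_gt0 nf).
have eps0 : 0 < eps by rewrite mulr_gt0.
have epse : eps < e by have := Hm0 m mm; rewrite ltr_pdivlMr // mulrC.
have := HC1 eps eps0 epse.
set I := fun x => (_ * _)%E; move=> HI.
have epsw : eps `^ (2 * (dw / 2)) = 2 `^ dw * kappa ^+ m.
  by rewrite mulrCA divff // mulr1 (scale_powR_walk nf hs).
have km : 0 < kappa ^+ m by rewrite exprn_gt0.
have ck : 0 < (c2 * kappa ^+ m)^-1 by rewrite invr_gt0 mulr_gt0.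
have I0 x : (0 <= I x)%E.
  rewrite /I; apply: mule_ge0; first by rewrite lee_fin invr_ge0 fine_ge0.
  by apply: integral_ge0 => y _; rewrite lee_fin divr_ge0 // powR_ge0.
have point u x : P u -> cellB u x ->
    (((c2 * kappa ^+ m)^-1 * (f x - avg (p u)) ^+ 2)%:E <= I x)%E.
  move=> Pu ux; have Kx := cellK ux.
  have [z [uz pz]] := HP u Pu.
  have sub : cellB (p u) `<=` eball K x eps.
    move=> y py; split; first exact: cellK py.
    apply: le_trans (edist_triangle z _ _) _.
    have -> : eps = L^-1 ^+ m + L^-1 ^+ m by rewrite /eps; ring.
    apply: lerD; first by rewrite -[X in _ ^+ X](size_tuple u) (cell_diam nf).
    by rewrite -[X in _ ^+ X](size_tuple (p u)) (cell_diam nf).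
  have mB : measurable (eball K x eps : set (borel R N)) by exact: (measurable_eball nf).
  have BK : eball K x eps `<=` K by move=> y [].
  pose b := fine (mu (eball K x eps : set (borel R N))).
  have b_le : b <= c1 * M%:R^-1 ^+ m by apply: HC2.
  have b_gt0 : 0 < b.
    apply: lt_le_trans (bV0 m) _; apply: (mu_eball_ge nf hmu) => //.
    by rewrite /eps ler_peMl ?(ltW Lm) // ler1n.
  have J0 : (0 <= \int[mu]_(y in eball K x eps) ((f y - f x) ^+ 2)%:E)%E.
    by apply: integral_ge0 => y _; rewrite lee_fin sqr_ge0.
  have h1 := avg_dist (p u) (f x); rewrite size_tuple in h1.
  have h2 : (\int[mu]_(y in cellB (p u)) ((f y - f x) ^+ 2)%:E <=
      \int[mu]_(y in eball K x eps) ((f y - f x) ^+ 2)%:E)%E.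
    apply: ge0_subset_integral => //; first exact: mf_sqr.
    by move=> y _; rewrite lee_fin sqr_ge0.
  have IE : I x = ((b * (2 `^ dw * kappa ^+ m))^-1%:E *
      \int[mu]_(y in eball K x eps) ((f y - f x) ^+ 2)%:E)%E.
    rewrite /I invfM EFinM -muleA; congr (_ * _)%E.
    rewrite -ge0_integralZl_EFin //.
    - apply: eq_integral => y _; rewrite epsw -EFinM mulrC; congr (_ * _)%:E.
      by rewrite (powR_mulrn 2) // real_normK ?num_real // -sqrrN opprB.
    - by move=> y _; rewrite lee_fin sqr_ge0.
    - exact: mf_sqr.
    - by rewrite invr_ge0 mulr_ge0 ?powR_ge0 // ltW.
  rewrite IE -sqrrN opprB EFinM.
  apply: (@le_trans _ _ ((c2 * kappa ^+ m)^-1%:E * ((M%:R ^+ m)%:E *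
      \int[mu]_(y in eball K x eps) ((f y - f x) ^+ 2)%:E))%E).
    apply: lee_pmul => //; rewrite ?lee_fin ?sqr_ge0 ?(ltW ck) //.
    apply: (le_trans h1); apply: lee_pmul => //.
    by apply: integral_ge0 => y _; rewrite lee_fin sqr_ge0.
  rewrite muleA -EFinM; apply: lee_pmul => //.
    by rewrite lee_fin mulr_ge0 ?(ltW ck) // exprn_ge0.
  rewrite lee_fin -[M%:R ^+ m]invrK -invfM lef_pV2 ?posrE; first last.
  - exact: mulr_gt0 b_gt0 (mulr_gt0 (powR_gt0 dw two0) km).
  - by apply: mulr_gt0 (mulr_gt0 c2_gt0 km) _; rewrite invr_gt0 exprn_gt0 // (card_gt0 nf).
  rewrite -exprVn /c2; have := ler_wpM2r (ltW (mulr_gt0 (powR_gt0 dw two0) km)) b_le.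
  move=> /le_trans; apply; rewrite le_eqVlt; apply/orP; left; apply/eqP; ring.
have [mV V0] := Vnull.
have := @sum_integral_le _ _ _ mu _ (fun u : m.-tuple 'I_M => cellB u) K (Vinf phi)
  (fun u => mc u) mK mV V0 P (fun u x => ((c2 * kappa ^+ m)^-1 * (f x - avg (p u)) ^+ 2)%:E) I.
move=> H.
have {H} H : (\sum_(u : m.-tuple 'I_M | P u) \int[mu]_(x in cellB u)
   ((c2 * kappa ^+ m)^-1 * (f x - avg (p u)) ^+ 2)%:E <= C1%:E)%E.
  apply: le_trans HI; apply: H => //.
  - move=> u u' x _ _ ux u'x uu'; apply: (cell_meet_Vinf nf hmu _ _ ux u'x).
      by rewrite !size_tuple.
    by move=> E; apply: uu'; exact: val_inj.
  - move=> u; under eq_fun do rewrite EFinM.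
    by apply: measurable_funeM; exact: mf_sqr.
  - by move=> u x _; rewrite lee_fin mulr_ge0 ?sqr_ge0 ?(ltW ck).
  - by move=> u x Pu ux _; exact: point.
have E (u : m.-tuple 'I_M) : (\int[mu]_(x in cellB u) ((c2 * kappa ^+ m)^-1 * (f x - avg (p u)) ^+ 2)%:E =
   (c2 * kappa ^+ m)^-1%:E * \int[mu]_(x in cellB u) ((f x - avg (p u)) ^+ 2)%:E)%E.
  under eq_integral do rewrite EFinM.
  rewrite ge0_integralZl_EFin ?(ltW ck) //; last exact: mf_sqr.
  by move=> x _; rewrite lee_fin sqr_ge0.
rewrite (eq_bigr _ (fun u _ => E u)) -ge0_sume_distrr in H; last first.
  by move=> u _; apply: integral_ge0 => x _; rewrite lee_fin sqr_ge0.
have ck' : 0 < c2 * kappa ^+ m by rewrite mulr_gt0.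
have {}H := lee_pmul _ _ (lexx (c2 * kappa ^+ m)%:E) H.
rewrite muleA -EFinM divff ?gt_eqF // mul1e in H.
apply: le_trans (H _ _) _.
- by rewrite lee_fin ltW.
- apply: mule_ge0; first by rewrite lee_fin ltW.
  by apply: sume_ge0 => u _; apply: integral_ge0 => x _; rewrite lee_fin sqr_ge0.
rewrite -EFinM lee_fin [leRHS]mulrAC; apply: ler_wpM2l; first exact: ltW.
exact: ler_norm.
Qed.

(** * Averages over cells and their continuous limit *)

Section CellAverages.
Variables (m0 : nat) (C : R).
Hypothesis C0 : 0 <= C.
Hypothesis energy_le : forall m (p : m.-tuple 'I_M -> m.-tuple 'I_M) (P : pred (m.-tuple 'I_M)),
  (m0 <= m)%N -> (forall u, P u -> cellB u `&` cellB (p u) !=set0) ->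
  (\sum_(u : m.-tuple 'I_M | P u) \int[mu]_(x in cellB u) ((f x - avg (p u)) ^+ 2)%:E
    <= (C * kappa ^+ m)%:E)%E.
Let q := Num.sqrt varrho^-1.

Let q0 : 0 <= q. Proof. exact: sqrtr_ge0. Qed.

Let q2 : q ^+ 2 = varrho^-1.
Proof. by rewrite sqr_sqrtr // invr_ge0 ltW // (varrho_gt0 hs). Qed.

Let q1 : q < 1.
Proof.
by rewrite -(@ltr_pXn2r _ 2) ?nnegrE // expr1n q2 invf_lt1 ?(varrho_gt0 hs) ?(hs_varrho hs).
Qed.

Let int_ge0 (B : set (borel R N)) c : (0 <= \int[mu]_(x in B) ((f x - c) ^+ 2)%:E)%E.
Proof. by apply: integral_ge0 => x _; rewrite lee_fin sqr_ge0. Qed.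

Let cell_neq0 w : cellB w !=set0.
Proof. by have [z Kz] := nf_nonempty nf; exists (phiw phi w z), z. Qed.

Let Mkappa m : M%:R ^+ m * kappa ^+ m = varrho^-1 ^+ m.
Proof.
by rewrite -exprMn invfM mulrA divff ?mul1r // (card_neq0 nf).
Qed.

Let self_energy m : (m0 <= m)%N ->
  (\sum_(u : m.-tuple 'I_M) \int[mu]_(x in cellB u) ((f x - avg u) ^+ 2)%:E
    <= (C * kappa ^+ m)%:E)%E.
Proof.
move=> mm; apply: (energy_le (p := id) (P := predT)) => // u _; rewrite setIid.
exact: cell_neq0.
Qed.

Let avg_neighbour w w' : (m0 <= size w)%N -> size w = size w' ->
  cellB w `&` cellB w' !=set0 -> (avg w - avg w') ^+ 2 <= C * varrho^-1 ^+ size w.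
Proof.
move=> mw ww' H; rewrite -sqrrN opprB -lee_fin.
apply: (le_trans (avg_dist w' (avg w))); rewrite -ww'.
have sw' : size w' == size w by rewrite ww'.
(* The sum is reduced to the single index w', with w as its neighbour. *)
have := energy_le (p := fun _ => in_tuple w) (P := pred1 (Tuple sw')) mw.
rewrite big_pred1_eq /= => /(_ _)/= Hle.
have {}Hle := lee_pmul _ _ (lexx (M%:R ^+ size w)%:E) (Hle _).
apply: (le_trans (Hle _ _ _)) => //.
  by move=> u /eqP ->; rewrite setIC.
by rewrite -EFinM lee_fin mulrCA Mkappa.
Qed.

Let avg_child m : (m0 <= m)%N -> \sum_(w : m.-tuple 'I_M)
   \sum_(i < M) (avg (rcons w i) - avg w) ^+ 2 <= M%:R * C * varrho^-1 ^+ m.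
Proof.
move=> mm; rewrite -lee_fin -sumEFin.
have [mV V0] := Vnull.
have step (w : m.-tuple 'I_M) : ((\sum_(i < M) (avg (rcons w i) - avg w) ^+ 2)%:E <=
    (M%:R ^+ m.+1)%:E * \int[mu]_(x in cellB w) ((f x - avg w) ^+ 2)%:E)%E.
  rewrite -sumEFin.
  apply: (@le_trans _ _ (\sum_(i < M) ((M%:R ^+ m.+1)%:E *
      \int[mu]_(x in cellB (rcons w i)) ((f x - avg w) ^+ 2)%:E))%E).
    apply: lee_sum => i _; have := avg_dist (rcons w i) (avg w).
    by rewrite size_rcons size_tuple.
  rewrite -ge0_sume_distrr => [|i _]; last exact: int_ge0.
  apply: lee_pmul => //; first by apply: sume_ge0 => i _; exact: int_ge0.
  apply: (@sum_integral_le _ _ _ mu _ (fun i : 'I_M => cellB (rcons w i)) (cellB w) (Vinf phi)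
    (fun i => mc _) (mc w) mV V0 predT (fun _ x => ((f x - avg w) ^+ 2)%:E)) => //.
  - by move=> i _; exact: (cell_rcons_sub nf).
  - move=> i j x _ _ ix jx ij; apply: (cell_meet_Vinf nf hmu _ _ ix jx).
      by rewrite !size_rcons.
    by move=> /rcons_inj[].
  - by move=> i; apply: mf_sqr => //; exact: cellK.
  - by move=> i x _; rewrite lee_fin sqr_ge0.
  - by move=> x _; rewrite lee_fin sqr_ge0.
apply: (le_trans (lee_sum _ (fun w _ => step w))).
rewrite -ge0_sume_distrr => [|w _]; last exact: int_ge0.
have H := lee_pmul _ _ (lexx (M%:R ^+ m.+1)%:E) (self_energy mm).
apply: (le_trans (H _ _)) => //.
  by apply: sume_ge0 => i _; exact: int_ge0.
by rewrite -EFinM lee_fin exprS -mulrA (mulrCA (M%:R ^+ m)) Mkappa -mulrA.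
Qed.

(** The factor 1 + M serves both comparisons: C for neighbours and M C for children. *)
Let S := Num.sqrt (C * (1 + M%:R)).

Let S0 : 0 <= S. Proof. exact: sqrtr_ge0. Qed.

Let sqr_le_abs (t : R) m : t ^+ 2 <= C * (1 + M%:R) * varrho^-1 ^+ m -> `|t| <= S * q ^+ m.
Proof.
move=> H; have C1 : 0 <= C * (1 + M%:R) by rewrite mulr_ge0 // addr_ge0.
rewrite -(@ler_pXn2r _ 2) ?nnegrE ?mulr_ge0 ?exprn_ge0 //.
by rewrite real_normK ?num_real // exprMn sqr_sqrtr // exprAC q2.
Qed.

Let rho_ge0 m : 0 <= varrho^-1 ^+ m.
Proof. by rewrite exprn_ge0 // invr_ge0 ltW // (varrho_gt0 hs). Qed.

Let extension_ex : exists2 F : X -> R, {within K, continuous F} &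
  forall w x, (m0 <= size w)%N -> cell phi K w x ->
    `|avg w - F x| <= S * (1 + 2 / (1 - q)) * q ^+ size w.
Proof.
apply: (cell_limit nf S0 q0 q1) => [w i mw|w w' mw sw ww'].
  apply: sqr_le_abs; rewrite -sqrrN opprB.
  apply: le_trans (_ : M%:R * C * varrho^-1 ^+ size w <= _); last first.
    by apply: ler_wpM2r => //; rewrite mulrC ler_wpM2l // lerDr.
  apply: le_trans (avg_child mw); rewrite (bigD1 (in_tuple w)) //= (bigD1 i) //= -addrA lerDl.
  rewrite addr_ge0 //; first by apply: sumr_ge0 => j _; exact: sqr_ge0.
  by apply: sumr_ge0 => u _; apply: sumr_ge0 => j _; exact: sqr_ge0.
apply: sqr_le_abs; apply: le_trans (avg_neighbour mw sw ww') _.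
by apply: ler_wpM2r => //; rewrite ler_peMr // lerDl.
Qed.

Section Extension.
Variable F : X -> R.
Hypothesis cF : {within K, continuous F}.
Hypothesis FE : forall w x, (m0 <= size w)%N -> cell phi K w x ->
    `|avg w - F x| <= S * (1 + 2 / (1 - q)) * q ^+ size w.
Let T := S * (1 + 2 / (1 - q)).

Let T0 : 0 <= T.
Proof. by rewrite mulr_ge0 // addr_ge0 // divr_ge0 // subr_ge0 ltW. Qed.

Let F_dist w x : (m0 <= size w)%N -> cell phi K w x ->
  (F x - avg w) ^+ 2 <= T ^+ 2 * varrho^-1 ^+ size w.
Proof.
move=> mw wx; have H := FE mw wx; rewrite -sqrrN opprB -real_normK ?num_real //.
have qm : 0 <= q ^+ size w by rewrite exprn_ge0.
have := @lerXn2r _ 2 _ _ (normr_ge0 _) (mulr_ge0 T0 qm) H.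
by rewrite exprMn exprAC q2.
Qed.

Let F_ae : exists Z : set (borel R N),
  [/\ measurable Z, mu Z = 0%E & forall x, K x -> ~ Z x -> f x = F x].
Proof.
have mFK : measurable_fun (K : set (borel R N)) (F : borel R N -> R).
  exact: (continuous_within_measurable (K_closed nf) cF).
have mfK : measurable_fun (K : set (borel R N)) f.
  by have /integrableP[/measurable_EFinP] := intf.
have I0 : (\int[mu]_(x in K) ((f x - F x) ^+ 2)%:E = 0)%E.
  have J0 : (0 <= \int[mu]_(x in K) ((f x - F x) ^+ 2)%:E)%E.
    by apply: integral_ge0 => x _; rewrite lee_fin sqr_ge0.
  have bound m : (m0 <= m)%N -> (\int[mu]_(x in K) ((f x - F x) ^+ 2)%:E <=
      ((2 * C + 2 * T ^+ 2) * varrho^-1 ^+ m)%:E)%E.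
    move=> mm; have [mV V0] := Vnull.
    have r0 : 0 <= 2 * (T ^+ 2 * varrho^-1 ^+ m) by exact: mulr_ge0 (ler0n R 2) (mulr_ge0 (sqr_ge0 T) (rho_ge0 m)).
    have mF (w : m.-tuple 'I_M) : measurable_fun (cellB w) (fun x => 2%:E * ((f x - avg w) ^+ 2)%:E)%E.
      by apply: measurable_funeM; apply: mf_sqr => //; exact: cellK.
    have H := @integral_le_sum _ _ _ mu _ (fun w : m.-tuple 'I_M => cellB w) K (Vinf phi)
      (fun w => mc w) mK mV V0 predT
      (fun w x => 2%:E * ((f x - avg w) ^+ 2)%:E + (2 * (T ^+ 2 * varrho^-1 ^+ m))%:E)%E
      (fun x => ((f x - F x) ^+ 2)%:E).
    apply: (le_trans (H _ _ _ _ _)) => {H}.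
    - by move=> x Kx; have [w wx] := tuple_cell_ex nf m Kx; exists w.
    - by move=> w; apply: emeasurable_funD => //; exact: measurable_cst.
    - by move=> w x _; rewrite -EFinM -EFinD lee_fin addr_ge0 // mulr_ge0 // sqr_ge0.
    - by move=> x _; rewrite lee_fin sqr_ge0.
    - move=> w x _ wx _ _; rewrite -EFinM -EFinD lee_fin.
      have mw : (m0 <= size w)%N by rewrite size_tuple.
      have := F_dist mw wx; rewrite size_tuple.
      have := sqr_ge0 ((f x - avg w) + (F x - avg w)).
      set s := f x - avg w; set t := F x - avg w.
      have -> : f x - F x = s - t by rewrite /s /t; ring.
      move: (T ^+ 2 * _) => c; nra.
    have E (w : m.-tuple 'I_M) : (\int[mu]_(x in cellB w)
        (2%:E * ((f x - avg w) ^+ 2)%:E + (2 * (T ^+ 2 * varrho^-1 ^+ m))%:E) =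
        2%:E * (\int[mu]_(x in cellB w) ((f x - avg w) ^+ 2)%:E) +
        ((2 * (T ^+ 2 * varrho^-1 ^+ m)) * M%:R^-1 ^+ m)%:E)%E.
      rewrite ge0_integralD //.
      - congr (_ + _)%E; first rewrite ge0_integralZl_EFin //.
        + by move=> x _; rewrite lee_fin sqr_ge0.
        + by apply: mf_sqr => //; exact: cellK.
        by rewrite integral_cst // muc size_tuple -EFinM.
      - by move=> x _; rewrite -EFinM lee_fin mulr_ge0 // sqr_ge0.
    rewrite (eq_bigr _ (fun w _ => E w)) big_split /= -ge0_sume_distrr; last first.
      by move=> w _; exact: int_ge0.
    rewrite sumEFin sumr_const card_tuple card_ord.
    have H1 := lee_pmul _ _ (lexx 2%:E) (self_energy mm).
    have {H1} H1 : (2%:E * \sum_(w : m.-tuple 'I_M) \int[mu]_(x in cellB w) ((f x - avg w) ^+ 2)%:E <=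
        2%:E * (C * kappa ^+ m)%:E)%E.
      by apply: H1 => //; apply: sume_ge0 => w _; exact: int_ge0.
    apply: (le_trans (leeD H1 (lexx _))); rewrite -EFinM -EFinD lee_fin.
    have E2 (t : R) : t * M%:R^-1 ^+ m *+ (M ^ m) = t.
      by rewrite -[LHS]mulr_natr natrX -mulrA -exprMn mulVf ?(card_neq0 nf) // expr1n mulr1.
    rewrite E2.
    have k1 : kappa ^+ m <= varrho^-1 ^+ m.
      rewrite -Mkappa ler_peMl ?exprn_ge0 ?(ltW kappa_gt0) //.
      by rewrite exprn_ege1 // ler1n (leq_trans _ (nf_card nf)).
    have := ler_wpM2l C0 k1; move: (kappa ^+ m) (varrho^-1 ^+ m) => k r; lra.
  have I_fin : (\int[mu]_(x in K) ((f x - F x) ^+ 2)%:E)%E \is a fin_num.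
    by rewrite ge0_fin_numE //; apply: le_lt_trans (bound m0 (leqnn _)) _; exact: ltry.
  rewrite -(fineK I_fin); congr EFin; apply/eqP; rewrite eq_le fine_ge0 // andbT.
  have v1 : varrho^-1 < 1 by rewrite invf_lt1 ?(varrho_gt0 hs) ?(hs_varrho hs).
  have v0 : 0 <= varrho^-1 by rewrite invr_ge0 ltW ?(varrho_gt0 hs).
  apply: (le_of_geometric_error (C := 2 * C + 2 * T ^+ 2) (m := m0) v0 v1) => m mm.
  by rewrite add0r -lee_fin fineK //; exact: bound.
have mD : measurable_fun (K : set (borel R N)) (fun x => ((f x - F x) ^+ 2)%:E).
  by apply/measurable_EFinP; apply: measurable_funX; exact: measurable_funB.
have := (ae_eq_integral_abs mu mK mD).1.
under eq_integral do rewrite gee0_abs ?lee_fin ?sqr_ge0 //.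
move=> /(_ I0)[Z [mZ Z0 HZ]]; exists Z; split=> // x Kx nZ.
apply: contrapT => nfF; apply: nZ; apply: HZ => /= /(_ Kx) [].
by move/eqP; rewrite sqrf_eq0 subr_eq0 => /eqP.
Qed.

(** Summing the pointwise bound [F_dist] over the M^m cells would lose a factor M^m. Instead each
    vertex is approached through the words w i^k, where phi_i fixes v: the squared increments of the
    averages, already summed over cells, are of order varrho^-(m+k). With weights s^k, s = 1/q, they
    sum to order varrho^-m, and the pointwise bound enters only in a remainder that tends to 0. *)
Let vertex_dev v m : V0 phi v -> (m0 <= m)%N ->
  \sum_(w : m.-tuple 'I_M) (F (phiw phi w v) - avg w) ^+ 2 <=
    (q^-1 / (q^-1 - 1) * (M%:R * C / (1 - q))) * varrho^-1 ^+ m.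
Proof.
move=> Vv mm; have [i Hi] := V0_fix Vv.
have q_gt0 : 0 < q by rewrite sqrtr_gt0 invr_gt0 (varrho_gt0 hs).
have s1 : 1 < q^-1 by rewrite invf_gt1.
pose Nq (g : m.-tuple 'I_M -> R) := \sum_(w : m.-tuple 'I_M) g w ^+ 2.
pose rest k (w : m.-tuple 'I_M) := F (phiw phi w v) - avg (w ++ nseq k i).
pose inc k (w : m.-tuple 'I_M) := avg (w ++ nseq k.+1 i) - avg (w ++ nseq k i).
have H k : Nq (rest k) <= q^-1 / (q^-1 - 1) * Nq (inc k) + q^-1 * Nq (rest k.+1).
  rewrite /Nq !mulr_sumr -big_split /=; apply: ler_sum => w _.
  have -> : rest k w = inc k w + rest k.+1 w by rewrite /rest /inc; ring.
  exact: sqr_addr_le.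
have inc_le k : Nq (inc k) <= M%:R * C * varrho^-1 ^+ (m + k).
  apply: le_trans (avg_child (leq_trans mm (leq_addr k m))).
  rewrite (sum_tuple_cat m k (fun w => \sum_(i < M) (avg (rcons w i) - avg w) ^+ 2)).
  apply: ler_sum => w _; rewrite (bigD1 [tuple of nseq k i]) //= (bigD1 i) //= -addrA.
  have -> : rcons (w ++ nseq k i) i = w ++ nseq k.+1 i.
    by rewrite -(addn1 k) nseqD /= -cats1 catA.
  rewrite lerDl addr_ge0 //.
    by apply: sumr_ge0 => j _; exact: sqr_ge0.
  by apply: sumr_ge0 => u _; apply: sumr_ge0 => j _; exact: sqr_ge0.
have rest_le k : Nq (rest k) <= (M ^ m)%:R * (T ^+ 2 * varrho^-1 ^+ (m + k)).
  have -> : (M ^ m)%:R * (T ^+ 2 * varrho^-1 ^+ (m + k)) =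
      \sum_(w : m.-tuple 'I_M) (T ^+ 2 * varrho^-1 ^+ (m + k)).
    by rewrite sumr_const card_tuple card_ord mulr_natl.
  apply: ler_sum => w _.
  have sw : size (w ++ nseq k i) = (m + k)%N by rewrite size_cat size_nseq size_tuple.
  rewrite -sw; apply: F_dist; first by rewrite sw (leq_trans mm) // leq_addr.
  have -> : phiw phi w v = phiw phi (w ++ nseq k i) v by rewrite phiw_cat phiw_nseq.
  exact: (V0_cell nf).
have sk k : q^-1 ^+ k * varrho^-1 ^+ (m + k) = varrho^-1 ^+ m * q ^+ k.
  have -> : varrho^-1 ^+ (m + k) = varrho^-1 ^+ m * (q ^+ k * q ^+ k).
    by rewrite exprD; congr (_ * _); rewrite -q2 -exprMn expr2.
  by rewrite mulrCA (exprVn q k) mulKf // gt_eqF // exprn_gt0.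
have A0 : 0 <= q^-1 / (q^-1 - 1) by rewrite divr_ge0 ?invr_ge0 // subr_ge0 ltW.
have -> : \sum_(w : m.-tuple 'I_M) (F (phiw phi w v) - avg w) ^+ 2 = Nq (rest 0%N).
  by apply: eq_bigr => w _; rewrite /rest cats0.
apply: (le_of_geometric_error (C := (M ^ m)%:R * T ^+ 2 * varrho^-1 ^+ m) (m := 0) q0 q1) => n _.
apply: (le_trans (telescope_sqr n s1 H)); apply: lerD.
  rewrite -[leRHS]mulrA; apply: ler_wpM2l => //.
  apply: (@le_trans _ _ (M%:R * C * varrho^-1 ^+ m * \sum_(k < n) q ^+ k)).
    rewrite mulr_sumr; apply: ler_sum => k _.
    rewrite -mulrA -sk mulrCA; apply: ler_wpM2l; last exact: inc_le.
    by rewrite exprn_ge0 // invr_ge0.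
  rewrite [leRHS]mulrAC; apply: ler_wpM2l.
    by rewrite !mulr_ge0.
  have d0 : 0 < 1 - q by rewrite subr_gt0.
  rewrite -[leRHS]mul1r ler_pdivlMr //.
  have := subrX1 q n; have := exprn_ge0 n q0; set t := q ^+ n; set s := \sum_(k < n) _.
  move=> t0 E; have -> : s * (1 - q) = 1 - t by rewrite -[1 - t]opprB E; ring.
  by rewrite gerDl oppr_le0.
apply: le_trans (ler_wpM2l _ (rest_le n)) _; first by rewrite exprn_ge0 // invr_ge0.
rewrite -[leRHS]mulrA -sk le_eqVlt; apply/orP; left; apply/eqP.
by move: (q^-1 ^+ n) (varrho^-1 ^+ _) (_%:R) => t1 t2 t3; ring.
Qed.

Let F_domain : dom F.
Proof.
have [C1 C10 HC1] := energy0_le_dev (a := a) nf.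
pose c5 := (q^-1 / (q^-1 - 1) * (M%:R * C / (1 - q))).
have bound m : (m0 <= m)%N -> energym phi a varrho m F <= C1 * (size (V0_enum nf))%:R * c5.
  move=> mm; have v0 := varrho_ge0 hs m.
  apply: (@le_trans _ _ (varrho ^+ m * \sum_(w : m.-tuple 'I_M)
     (C1 * \sum_(x <- V0_enum nf) (F (phiw phi w x) - avg w) ^+ 2))).
    by apply: ler_wpM2l => //; apply: ler_sum => w _; exact: HC1.
  rewrite -mulr_sumr exchange_big /= mulrCA -mulrA; apply: ler_wpM2l => //.
  apply: (@le_trans _ _ (varrho ^+ m * \sum_(x <- V0_enum nf) (c5 * varrho^-1 ^+ m))).
    apply: ler_wpM2l => //; rewrite big_seq [leRHS]big_seq; apply: ler_sum => x /(mem_V0 nf) Vx.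
    exact: vertex_dev.
  rewrite big_const_seq count_predT iter_addr_0 mulrnAr mulrCA -exprMn divff; last first.
    by rewrite gt_eqF // (varrho_gt0 hs).
  by rewrite expr1n mulr1 mulr_natl.
apply: (@domain_intro _ _ _ _ _ _ _ _ (C1 * (size (V0_enum nf))%:R * c5)) => // m.
have [mm|/ltnW mm] := leqP m0 m; first exact: bound.
exact: le_trans (energym_le nf hs _ mm) (bound m0 (leqnn _)).
Qed.

Lemma averages_extension0 : dom F /\ exists Z : set (borel R N),
  [/\ measurable Z, mu Z = 0%E & forall x, K x -> ~ Z x -> f x = F x].
Proof. by split. Qed.

End Extension.

Lemma averages_extension : exists F, dom F /\ exists Z : set (borel R N),
  [/\ measurable Z, mu Z = 0%E & forall x, K x -> ~ Z x -> f x = F x].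
Proof. by have [F cF FE] := extension_ex; exists F; exact: averages_extension0. Qed.

End CellAverages.

Lemma KS_domain : exists F, dom F /\ exists Z : set (borel R N),
  [/\ measurable Z, mu Z = 0%E & forall x, K x -> ~ Z x -> f x = F x].
Proof.
have [m0 [C [C0 H]]] := neighbour_energy; exact: averages_extension C0 H.
Qed.

End KSToEnergy.

(** * Property (P) and the Poincare inequality *)

Section PropertyP.
Context {R : realType} {N M : nat} {L : R} {phi : 'I_M -> 'rV[R]_N -> 'rV[R]_N}
  {K : set 'rV[R]_N}.
Hypothesis nf : nested_fractal phi L K.
Hypothesis PP : property_P phi L K.
Local Notation X := 'rV[R]_N.

(** The set of differences is compact, hence closed, and does not contain 0. *)
Lemma disjoint_compact_dist (A B : set X) : compact A -> compact B -> A `&` B = set0 ->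
  exists2 e, 0 < e & forall y z, A y -> B z -> e <= edist y z.
Proof.
move=> cA cB AB0.
have cAB : compact ((fun p : X * X => p.1 - p.2) @` (A `*` B)).
  apply: continuous_compact; last exact: compact_setX.
  apply: continuous_subspaceT => p.
  by apply: (@continuousB _ _ _ fst snd); [exact: cvg_fst|exact: cvg_snd].
have clAB := compact_closed (@norm_hausdorff _ _) cAB.
have n0 : (~` ((fun p : X * X => p.1 - p.2) @` (A `*` B))) (0 : X).
  move=> [[y z] /= [Ay Bz] /eqP]; rewrite subr_eq0 => /eqP yz.
  by rewrite -yz in Bz; have : (A `&` B) y by []; rewrite AB0.
have /nbhs_edist[e e0 He] := open_nbhs_nbhs (conj (closed_openC clAB) n0).
exists e => // y z Ay Bz; rewrite leNgt; apply/negP => yz.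
have /He : edist 0 (y - z) < e by move: yz; rewrite edistC /edist opprB add0r.
by apply; exists (y, z).
Qed.

Lemma simplexP m S : simplices phi K m S <-> exists2 w, size w = m & S = cell phi K w.
Proof.
split=> [[w _ <-]|[w sw ->]]; first by exists w; rewrite ?size_tuple.
by have /eqP sw' := sw; exists (Tuple sw').
Qed.

Lemma Delta_cell m y : K y -> exists w, [/\ size w = m, cell phi K w y & Delta phi K m y = cell phi K w].
Proof.
move=> Ky; have [w sw wy] := cell_ex nf m Ky.
have : exists S, (simplices phi K m S /\ S y).
  by exists (cell phi K w); split => //; apply/simplexP; exists w.
move=> /(xgetPex set0)[/simplexP[w' sw' E] Sy]; rewrite -/(Delta phi K m y) in E Sy.
by exists w'; split => //; rewrite -E.
Qed.

Lemma Deltastar_cells m y z : K y -> Deltastar phi K m y z -> exists w w',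
  [/\ size w = m, size w' = m, cell phi K w y, cell phi K w' z &
      cell phi K w `&` cell phi K w' !=set0].
Proof.
move=> Ky; rewrite /Deltastar; have [w [sw wy ->]] := Delta_cell m Ky.
move=> [wz|[S [/simplexP[w' sw' ->] [t [w't wt]]] w'z]].
  by exists w, w; split => //; exists y.
by exists w, w'; split => //; exists t.
Qed.

Lemma Deltastar_intro m y z : K y -> K z -> (forall w w', size w = m -> size w' = m ->
   cell phi K w y -> cell phi K w' z -> cell phi K w `&` cell phi K w' !=set0) ->
  Deltastar phi K m y z.
Proof.
move=> Ky Kz H; rewrite /Deltastar; have [w [sw wy ->]] := Delta_cell m Ky.
have [w' sw' w'z] := cell_ex nf m Kz; right; exists (cell phi K w') => //=.
by split; [apply/simplexP; exists w'|rewrite setIC; exact: H].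
Qed.

(** The start of the descent through levels: Property (P) begins at n = 1, so adjacency at level 1
    comes from compactness and finiteness of the cells. *)
Lemma first_cells_separated : exists2 e, 0 < e & forall y z, K y -> K z ->
  edist y z < e -> Deltastar phi K 1 y z.
Proof.
have /choice[e He] : forall p : 1.-tuple 'I_M * 1.-tuple 'I_M, exists e : R, 0 < e /\
    (cell phi K p.1 `&` cell phi K p.2 = set0 ->
     forall y z, cell phi K p.1 y -> cell phi K p.2 z -> e <= edist y z).
  move=> [w w'] /=; have [E|nE] := pselect (cell phi K w `&` cell phi K w' = set0); last first.
    by exists 1.
  have [e e0 H] := disjoint_compact_dist (cell_compact nf (w := w)) (cell_compact nf (w := w')) E.
  by exists e.
have [e0 e00 He0] : exists2 e0, 0 < e0 & forall p, e0 <= e p.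
  exists (\big[Num.min/1]_p e p).
    apply: (big_ind (fun t => 0 < t)) => // [s t s0 t0|p _]; first by rewrite lt_min s0.
    by case: (He p).
  by move=> p; exact: bigmin_le_cond.
exists e0 => // y z Ky Kz yz; apply: Deltastar_intro => // w w' /eqP sw /eqP sw' wy w'z.
apply/set0P/eqP => E; have [_ H] := He (Tuple sw, Tuple sw').
have := H E y z wy w'z; rewrite leNgt => /negP; apply.
by apply: lt_le_trans yz (He0 _).
Qed.

(** If y and z are in adjacent cells of level k + 1 but not of level k + 2, Property (P) keeps them
    at least alpha L^-(k+1) apart. Points closer than alpha L^-n therefore remain adjacent down to
    level n + 1. *)
Lemma near_points_adjacent_cells : exists2 b, 0 < b & forall n y z,
  (K `\` Vinf phi) y -> (K `\` Vinf phi) z -> edist y z < b * L^-1 ^+ n ->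
  exists w w', [/\ size w = n.+1, size w' = n.+1, cell phi K w y, cell phi K w' z &
      cell phi K w `&` cell phi K w' !=set0].
Proof.
have [al al0 Hal] := PP; have [c c0 Hc] := first_cells_separated.
have q0 := scaleV_ge0 nf; have q1 := scaleV_lt1 nf.
exists (Num.min al c) => [|n y z Ky Kz yz]; first by rewrite lt_min al0.
have qn : 0 < L^-1 ^+ n by rewrite exprn_gt0 // invr_gt0 (scale_gt0 nf).
have yal : edist y z < al * L^-1 ^+ n.
  by apply: lt_le_trans yz _; rewrite ler_wpM2r ?(ltW qn) // ge_min lexx.
have yc : edist y z < c.
  apply: lt_le_trans yz _; apply: (@le_trans _ _ (c * L^-1 ^+ n)).
    by rewrite ler_wpM2r ?(ltW qn) // ge_min lexx orbT.
  by rewrite ler_piMr ?(ltW c0) // exprn_ile1 // ltW.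
suff H k : (k <= n)%N -> Deltastar phi K k.+1 y z by apply: Deltastar_cells (H n _) => //; case: Ky.
elim: k => [_|k IH kn]; first by apply: Hc => //; [case: Ky|case: Kz].
apply: contrapT => nD.
have := Hal k.+1 y z isT Ky Kz (conj (IH (ltnW kn)) nD).
rewrite leNgt => /negP; apply; apply: lt_le_trans yal _.
by rewrite -exprVn; apply: ler_wpM2l; [exact: ltW|apply: ler_wiXn2l => //; exact: ltW].
Qed.

End PropertyP.

(** * Oscillation over balls and the Poincare inequality *)

Section EnergyToPoincare.
Context {R : realType} {N M : nat} {L : R} {phi : 'I_M -> 'rV[R]_N -> 'rV[R]_N}
  {K : set 'rV[R]_N} {mu nu : {measure set (borel R N) -> \bar R}}
  {a : 'rV[R]_N -> 'rV[R]_N -> R} {varrho : R}.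
Hypothesis nf : nested_fractal phi L K.
Hypothesis hmu : normalized_hausdorff (hausdorff_dim M L) K mu.
Hypothesis hs : harmonic_structure phi a varrho.
Hypothesis nd : nondegenerate phi K a varrho.
Hypothesis kn : kusuoka_measure phi K a varrho nu.
Hypothesis PP : property_P phi L K.
Local Notation X := 'rV[R]_N.
Local Notation dw := (walk_dim M L varrho).
Local Notation d := (hausdorff_dim M L).
Local Notation dom := (energy_domain phi K a varrho).
Local Notation En := (energy phi a varrho).
Local Notation cellB w := (cell phi K w : set (borel R N)).
Let mK : measurable (K : set (borel R N)) := measurable_K nf.

(** Here b is the adjacency constant of Property (P). For r comparable to L^-m the ball has mass of
    order M^-m, and M^-m varrho^-m = L^(-m d_w) is of order r^d_w. *)
Let scale_bound : exists2 C, 0 <= C & exists2 b, 0 < b &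
  (forall n y z, (K `\` Vinf phi) y -> (K `\` Vinf phi) z -> edist y z < b * L^-1 ^+ n ->
    exists w w', [/\ size w = n.+1, size w' = n.+1, cell phi K w y, cell phi K w' z &
      cell phi K w `&` cell phi K w' !=set0]) /\
  forall x (r : R) m, 0 < r -> b / 4 * L^-1 ^+ m <= r -> r <= b * L / 4 * L^-1 ^+ m ->
    varrho^-1 ^+ m * fine (mu (eball K x ((1 + 4 / b + 4 * L / b) * r))) <= C * r `^ dw.
Proof.
have [b b0 Hb] := near_points_adjacent_cells nf PP.
have [c c0 Hc] := mu_ball_le nf hmu.
have L0 := scale_gt0 nf; have d0 := hausdorff_dim_gt0 nf.
have dw0 : 0 < dw by have := walk_dim_half_gt0 nf hs; rewrite pmulr_lgt0 // invr_gt0.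
(* With 1 + 4/b the enlarged ball contains the adjacent cells used for small r; with 4L/b it
   contains K as soon as r >= b/(4L). *)
pose A := 1 + 4 / b + 4 * L / b.
have A0 : 0 <= A by rewrite !addr_ge0 // divr_ge0 // ?mulr_ge0 // ltW.
have b4 : 0 < b / 4 by rewrite divr_gt0.
have bL : 0 <= b * L / 4 by rewrite !mulr_ge0 // ltW.
exists (c * (A * (b * L / 4)) `^ d / (b / 4) `^ dw).
  by rewrite !mulr_ge0 ?invr_ge0 ?powR_ge0 // ltW.
exists b => //; split => // x r m r0 r1 r2.
have Lm : 0 <= L^-1 ^+ m by rewrite exprn_ge0 // invr_ge0 ltW.
have mB := measurable_eball nf x (A * r).
have h1 : fine (mu (eball K x (A * r))) <= c * ((A * (b * L / 4)) `^ d * M%:R^-1 ^+ m).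
  rewrite -lee_fin fineK; last exact: (mu_fin nf hmu).
  apply: le_trans (Hc x _ _) _; first by rewrite mulr_ge0 // ltW.
  rewrite lee_fin; apply: ler_wpM2l; first exact: ltW.
  rewrite -(scale_powR_dim nf m (mulr_ge0 A0 bL)).
  rewrite -(mulrA A).
  apply: ge0_ler_powR; rewrite ?nnegrE.
  - exact: ltW.
  - exact: mulr_ge0 A0 (ltW r0).
  - exact: mulr_ge0 A0 (mulr_ge0 bL Lm).
  - exact: ler_wpM2l.
have h2 : (b / 4) `^ dw * (M%:R * varrho)^-1 ^+ m <= r `^ dw.
  rewrite -(scale_powR_walk nf hs m (ltW b4)).
  apply: ge0_ler_powR; rewrite ?nnegrE.
  - exact: ltW.
  - exact: mulr_ge0 (ltW b4) Lm.
  - exact: ltW.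
  - exact: r1.
have v0 : 0 <= varrho^-1 ^+ m by rewrite exprn_ge0 // invr_ge0 ltW // (varrho_gt0 hs).
apply: le_trans (ler_wpM2l v0 h1) _.
have bw : 0 < (b / 4) `^ dw by rewrite powR_gt0.
rewrite [leRHS]mulrAC ler_pdivlMr //.
have -> : varrho^-1 ^+ m * (c * ((A * (b * L / 4)) `^ d * M%:R^-1 ^+ m)) * (b / 4) `^ dw =
  c * (A * (b * L / 4)) `^ d * ((b / 4) `^ dw * (M%:R * varrho)^-1 ^+ m).
  by rewrite invfM exprMn; ring.
by apply: ler_wpM2l => //; rewrite mulr_ge0 ?powR_ge0 // ltW.
Qed.

Lemma energy_osc_ball F : dom F -> exists (g : borel R N -> R) (A D : R),
  [/\ measurable_fun setT g, forall x, 0 <= g x, (\int[nu]_(x in setT) (g x ^+ 2)%:E < +oo)%E,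
      1 <= A /\ 0 <= D &
  forall x r y z, K x -> 0 < r -> r < 1 -> eball K x r y -> eball K x r z ->
    ~ Vinf phi y -> ~ Vinf phi z ->
    (F y - F z) ^+ 2 * fine (mu (eball K x (A * r))) <=
      D * r `^ dw * fine (\int[nu]_(t in eball K x (A * r)) (g t ^+ 2)%:E)%E].
Proof.
move=> dF; have [C C0 HC] := domain_osc nf hmu hs.
have [g [mg g0 gfin Hg]] := energy_density nf hmu hs nd kn dF.
have [C1 C10 [b b0 [Hb HC1]]] := scale_bound.
have L0 := scale_gt0 nf.
pose A := 1 + 4 / b + 4 * L / b.
have b40 : 0 <= 4 / b by exact: divr_ge0 (ler0n R 4) (ltW b0).
have bL0 : 0 <= 4 * L / b by exact: divr_ge0 (mulr_ge0 (ler0n R 4) (ltW L0)) (ltW b0).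
have A1 : 1 <= A by rewrite /A -addrA lerDl; exact: addr_ge0.
pose r0 := b / (4 * L).
have r00 : 0 < r0 by rewrite divr_gt0 // mulr_gt0.
have rw0 : 0 < r0 `^ dw by rewrite powR_gt0.
have D10 : 0 <= 4 * C * C1 by rewrite !mulr_ge0.
have D20 : 0 <= C / r0 `^ dw by rewrite divr_ge0 // ltW.
exists g, A, (4 * C * C1 + C / r0 `^ dw); split => //; first by split; [|exact: addr_ge0].
move=> x r y z Kx r_gt0 r_lt1 [Ky xy] [Kz xz] ny nz.
pose AB : set (borel R N) := eball K x (A * r).
have mAB : measurable AB by exact: measurable_eball nf x _.
have g20 (t : borel R N) : (0 <= (g t ^+ 2)%:E)%E by rewrite lee_fin sqr_ge0.
have mg2 (B : set (borel R N)) : measurable_fun B (fun t => (g t ^+ 2)%:E).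
  by apply/measurable_EFinP; apply: measurable_funTS; exact: measurable_funX.
have Ifin (B : set (borel R N)) : measurable B -> (\int[nu]_(t in B) (g t ^+ 2)%:E)%E \is a fin_num.
  move=> mB; rewrite ge0_fin_numE; last by apply: integral_ge0.
  by apply: le_lt_trans gfin; apply: ge0_subset_integral.
pose J := fine (\int[nu]_(t in AB) (g t ^+ 2)%:E)%E.
have J0 : 0 <= J by apply: fine_ge0; exact: integral_ge0.
have cell_le w : cell phi K w `<=` AB -> varrho ^+ size w * En (F \o phiw phi w) <= J.
  move=> wAB; rewrite -lee_fin fineK ?Ifin //; apply: le_trans (Hg w) _.
  by apply: ge0_subset_integral => //; exact: (measurable_cell nf w).
pose m_ := fine (mu AB).
have m0 : 0 <= m_ by apply: fine_ge0.
have rdw : 0 <= r `^ dw by exact: powR_ge0.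
suff [H|H] : (F y - F z) ^+ 2 * m_ <= 4 * C * C1 * r `^ dw * J \/
    (F y - F z) ^+ 2 * m_ <= C / r0 `^ dw * r `^ dw * J.
- apply: le_trans H _; apply: ler_wpM2r => //; apply: ler_wpM2r => //.
  by rewrite lerDl.
- apply: le_trans H _; apply: ler_wpM2r => //; apply: ler_wpM2r => //.
  by rewrite lerDr.
(* For small r take n with L^-(n+1) < 4r/b <= L^-n: the points y and z, at most 2r apart, lie in
   adjacent cells of level n + 1. For large r the enlarged ball is all of K, and the total energy
   bounds the oscillation. *)
have [small|large] := leP (4 * r / b) L^-1.
  left; have e0 : 0 < 4 * r / b by rewrite divr_gt0 // mulr_gt0.
  have L1 : L^-1 <= 1 by apply: ltW; exact: scaleV_lt1 nf.
  have [n [n1 n2]] := scale_floor nf e0 (le_trans small L1).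
  have rn : 4 * r <= b * L^-1 ^+ n by move: n2; rewrite ler_pdivrMr // (mulrC _ b).
  have yz : edist y z < b * L^-1 ^+ n.
    apply: lt_le_trans rn; apply: le_lt_trans (edist_triangle x _ _) _.
    rewrite (edistC y x); lra.
  have [w [w' [sw sw' wy w'z [t [wt w't]]]]] := Hb n y z (conj Ky ny) (conj Kz nz) yz.
  have inAB u (v : X) : size u = n.+1 -> edist x v <= r -> cell phi K u v -> cell phi K u `<=` AB.
    move=> su xv uv; apply: subset_trans (cell_sub_eball nf (m := n.+1) uv _ (ltW n1)) _.
      by rewrite su.
    apply: eball_shift xv _; have -> : A * r = r + 4 * r / b + 4 * L / b * r.
      by rewrite /A; field; rewrite gt_eqF.
    by rewrite lerDl; exact: mulr_ge0 bL0 (ltW r_gt0).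
  have osc u (v : X) : size u = n.+1 -> cell phi K u `<=` AB -> cell phi K u v ->
      cell phi K u t -> (F v - F t) ^+ 2 <= C * (varrho^-1 ^+ n.+1 * J).
    move=> su uAB [v' Kv' <-] [t' Kt' <-].
    have dFu := domain_phiw nf hs u dF.
    apply: le_trans (HC (F \o phiw phi u) v' t' dFu Kv' Kt') _; apply: ler_wpM2l => //.
    rewrite exprVn ler_pdivlMl ?exprn_gt0 ?(varrho_gt0 hs) // -su.
    exact: cell_le.
  have o1 := osc w y sw (inAB w y sw xy wy) wy wt.
  have o2 := osc w' z sw' (inAB w' z sw' xz w'z) w'z w't.
  have o : (F y - F z) ^+ 2 <= 4 * C * (varrho^-1 ^+ n.+1 * J).
    have := sqr_ge0 ((F y - F t) + (F z - F t)); move: o1 o2.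
    have -> : F y - F z = (F y - F t) - (F z - F t) by ring.
    rewrite -mulrA; move: (C * _) (F y - F t) (F z - F t) => c s1 s2; nra.
  apply: le_trans (ler_wpM2r m0 o) _.
  have h1 : b / 4 * L^-1 ^+ n.+1 <= r.
    move: n1 => /ltW; rewrite ler_pdivlMr // => H.
    by rewrite mulrAC ler_pdivrMr // mulrC [leRHS]mulrC.
  have h2 : r <= b * L / 4 * L^-1 ^+ n.+1.
    rewrite exprS; have -> : b * L / 4 * (L^-1 * L^-1 ^+ n) = b * L^-1 ^+ n / 4.
      by field; rewrite gt_eqF.
    by rewrite ler_pdivlMr // mulrC.
  have H := HC1 x r n.+1 r_gt0 h1 h2; rewrite -/A -/AB -/m_ in H.
  have C4 : 0 <= 4 * C * J by rewrite !mulr_ge0.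
  have := ler_wpM2l C4 H; congr (_ <= _); ring.
right.
have rr0 : r0 <= r.
  move: large => /ltW; rewrite ler_pdivlMr // /r0 ler_pdivrMr ?mulr_gt0 // => H.
  have := ler_wpM2l (ltW L0) H; rewrite mulrA divff ?gt_eqF // mul1r.
  by congr (_ <= _); ring.
have KAB : K `<=` AB.
  move=> u Ku; split => //; apply: le_trans (_ : 1 <= _).
    have := cell_diam nf (w := [::]) (x := x) (y := u); rewrite cell_nil expr0; exact.
  apply: (@le_trans _ _ (4 * L / b * r)); last first.
    by apply: ler_wpM2r; [exact: ltW|rewrite /A lerDr addr_ge0 // divr_ge0 // ltW].
  apply: le_trans (ler_wpM2l _ rr0); last by rewrite !mulr_ge0 ?invr_ge0 // ltW.
  rewrite le_eqVlt; apply/orP; left; apply/eqP; rewrite /r0; field.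
  by rewrite !gt_eqF.
have o1 : (F y - F z) ^+ 2 <= C * J.
  apply: le_trans (HC F y z dF Ky Kz) _; apply: ler_wpM2l => //.
  have := cell_le [::]; rewrite cell_nil expr0 mul1r; exact.
have m1 : m_ <= 1.
  by rewrite -lee_fin fineK ?(mu_fin nf hmu) //; exact: (mu_le1 nf hmu).
have dw0 : 0 <= dw by have := walk_dim_half_gt0 nf hs; rewrite pmulr_lgt0 ?invr_gt0 // => /ltW.
have h1 : r0 `^ dw <= r `^ dw by apply: ge0_ler_powR; rewrite ?nnegrE ?(ltW r00) ?(ltW r_gt0).
apply: (@le_trans _ _ (C * J)).
  by apply: le_trans o1; rewrite ler_piMr // sqr_ge0.
have -> : C / r0 `^ dw * r `^ dw * J = C * J * (r `^ dw / r0 `^ dw).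
  by field; rewrite gt_eqF.
by apply: ler_peMr; [exact: mulr_ge0|rewrite ler_pdivlMr // mul1r].
Qed.

Lemma KS_poincare f : KS_space K mu 2 (dw / 2) f -> poincare_space K mu nu 2 (dw / 2) f.
Proof.
move=> fKS; have [fLp _] := fKS; split => //.
have [F [dF [Z0 [mZ0 Z00 fF]]]] := KS_domain nf hmu hs fKS.
have [g [A [D [mg g0 gfin [A1 D0] osc]]]] := energy_osc_ball dF.
(* The factor 2 comes from replacing F z by the mean over the ball, sqrt D from the oscillation
   bound. *)
pose s := 2 * Num.sqrt D.
have s0 : 0 <= s by rewrite mulr_ge0.
have g2E x : `|s * g x| `^ 2 = s ^+ 2 * g x ^+ 2.
  by rewrite (powR_mulrn 2) // real_normK ?num_real // exprMn.
have g2E' x : (s * g x) `^ 2 = s ^+ 2 * g x ^+ 2.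
  by rewrite -g2E ger0_norm // mulr_ge0.
have gsq0 (t : borel R N) : (0 <= (g t ^+ 2)%:E)%E by rewrite lee_fin sqr_ge0.
have mg2 (B : set (borel R N)) : measurable_fun B (fun t => (g t ^+ 2)%:E).
  by apply/measurable_EFinP; apply: measurable_funTS; exact: measurable_funX.
have Ifin (B : set (borel R N)) : measurable B -> (\int[nu]_(t in B) (g t ^+ 2)%:E)%E \is a fin_num.
  move=> mB; rewrite ge0_fin_numE; last by apply: integral_ge0.
  by apply: le_lt_trans gfin; apply: ge0_subset_integral.
have IsE (B : set (borel R N)) : measurable B -> (\int[nu]_(t in B) (s ^+ 2 * g t ^+ 2)%:E =
    (s ^+ 2 * fine (\int[nu]_(t in B) (g t ^+ 2)%:E))%:E)%E.
  move=> mB; rewrite EFinM fineK ?Ifin // -ge0_integralZl_EFin ?sqr_ge0 //.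
exists (fun x => s * g x), A; split => //.
- by move=> x _; exact: mulr_ge0.
- split; first by apply: measurable_funTS; exact: measurable_funM.
  under eq_integral do rewrite g2E.
  by rewrite IsE // ltry.
move=> x r Kx r0; rewrite (nf_diam nf) lte_fin => r1 /=.
pose B : set (borel R N) := eball K x r; pose AB : set (borel R N) := eball K x (A * r).
rewrite -/B -/AB.
have mB : measurable B by exact: measurable_eball nf x r.
have mAB : measurable AB by exact: measurable_eball nf x (A * r).
have BK : B `<=` K by move=> y [].
pose b := fine (mu B); pose ab := fine (mu AB).
have muB : mu B = b%:E by rewrite fineK // (mu_fin nf hmu).
have b_gt0 : 0 < b.
  have [m Hm] := expr_arbitrarily_small (scaleV_ge0 nf) (scaleV_lt1 nf) r0.
  apply: lt_le_trans (mu_eball_ge nf hmu Kx (ltW (Hm m (leqnn m)))).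
  by rewrite exprn_gt0 // invr_gt0 (card_gt0 nf).
have ab_gt0 : 0 < ab.
  apply: (lt_le_trans b_gt0); apply: fine_le; rewrite ?(mu_fin nf hmu) //.
  apply: le_measure; rewrite ?inE // => y [Ky xy]; split => //; apply: le_trans xy _.
  by rewrite ler_peMl // ltW.
have intfB : mu.-integrable B (EFin \o f).
  apply: (integrableS mK) => //.
  by apply: Lp_integrable fLp; rewrite ?(mu_K hmu) ?ltry ?ler1n.
have cV := Vinf_countable nf.
have mV : measurable (Vinf phi : set (borel R N)) by exact: countable_borel.
have V0 : mu (Vinf phi) = 0%E by apply: countable_null cV; exact: (mu_point nf hmu).
pose Z := Z0 `|` (Vinf phi : set (borel R N)).
have mZ : measurable Z by exact: measurableU.
have Z_null : mu Z = 0%E.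
  apply/eqP; rewrite eq_le measure_ge0 andbT.
  by apply: le_trans (measure_setU_le mu mZ0 mV) _; rewrite Z00 V0 adde0.
(* A reference point at which f = F and the oscillation bound applies; it exists because the ball
   has positive mass. *)
have [z [Bz nz]] : exists z, B z /\ ~ Z z.
  apply: contrapT => H; have BZ : B `<=` Z.
    by move=> z Bz; apply: contrapT => nz; apply: H; exists z.
  have : (mu B <= mu Z)%E by apply: le_measure; rewrite ?inE.
  by rewrite Z_null muB lee_fin leNgt b_gt0.
pose J := fine (\int[nu]_(t in AB) (g t ^+ 2)%:E)%E.
have J0 : 0 <= J by apply: fine_ge0; exact: integral_ge0.
have rw0 : 0 <= r `^ dw by exact: powR_ge0.
pose Q := r `^ dw * (ab^-1 * J).
have Q0 : 0 <= Q by rewrite !mulr_ge0 // invr_ge0 ltW.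
pose S := Num.sqrt (D * Q).
have S_le y : B y -> ~ Z y -> `|f y - F z| <= S.
  move=> By nZ; have [Ky _] := By.
  rewrite (fF y Ky) => [|Zy]; last by apply: nZ; left.
  have nV u : ~ Z u -> ~ Vinf phi u by move=> nZu Vu; apply: nZu; right.
  have H := osc x r y z Kx r0 r1 By Bz (nV _ nZ) (nV _ nz).
  rewrite -sqrtr_sqr; apply: ler_wsqrtr.
  rewrite /Q -(ler_pM2r ab_gt0); apply: le_trans H _.
  rewrite -/AB -/J le_eqVlt; apply/orP; left; apply/eqP.
  by move: (r `^ dw) => w; field; rewrite gt_eqF.
have [_ H] := mean_dist_sup mB muB b_gt0 intfB mZ Z_null (sqrtr_ge0 _) S_le.
apply: (le_trans H).
under eq_integral do rewrite g2E'.
rewrite (IsE _ mAB) -/ab -/J.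
have -> : (ab^-1%:E * (s ^+ 2 * J)%:E)%E = (ab^-1 * (s ^+ 2 * J))%:E by [].
rewrite poweR_EFin.
have ab'0 : 0 <= ab^-1 by rewrite invr_ge0 ltW.
have i0 : 0 <= ab^-1 * (s ^+ 2 * J) by exact: mulr_ge0 ab'0 (mulr_ge0 (sqr_ge0 s) J0).
have -> : r `^ (dw / 2) = Num.sqrt (r `^ dw) by rewrite powRrM powR12_sqrt.
rewrite powR12_sqrt // -EFinM lee_fin -sqrtrM //.
have -> : r `^ dw * (ab^-1 * (s ^+ 2 * J)) = 2 ^+ 2 * (D * Q).
  by rewrite /s exprMn sqr_sqrtr // /Q; ring.
by rewrite [leRHS]sqrtrM ?sqr_ge0 // sqrtr_sqr ger0_norm.
Qed.

End EnergyToPoincare.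

Theorem proposition4p2 (R : realType) (N M : nat) (L : R)
    (phi : 'I_M -> 'rV[R]_N -> 'rV[R]_N) (K : set 'rV[R]_N)
    (mu nu : {measure set (borel R N) -> \bar R})
    (a : 'rV[R]_N -> 'rV[R]_N -> R) (varrho : R) (p sigma : R) :
  nested_fractal phi L K ->
  normalized_hausdorff (hausdorff_dim M L) K mu ->
  harmonic_structure phi a varrho ->
  nondegenerate phi K a varrho ->
  kusuoka_measure phi K a varrho nu ->
  property_P phi L K ->
  1 <= p -> 0 < sigma ->
  (hausdorff_dim M L / p < sigma ->
     poincare_space K mu nu p sigma `<=` KS_space K mu p sigma) /\
  (sigma = walk_dim M L varrho / 2 ->
     poincare_space K mu nu 2 sigma = KS_space K mu 2 sigma).
Proof.
move=> nf hmu hs nd kn PP p1 sigma0.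
have nu1 := km_atomless kn.
split=> [sp f [fLp [g [A [g0 gLp A1 H]]]]|->].
  exact: (poincare_subset_KS nf hmu nu1 p1 sigma0 sp fLp g0 gLp A1 H).
apply/seteqP; split=> f; last exact: (KS_poincare nf hmu hs nd kn PP).
move=> [fLp [g [A [g0 gLp A1 H]]]].
by apply: (poincare_subset_KS nf hmu nu1 _ (walk_dim_half_gt0 nf hs)
  (walk_dim_gt nf hs) fLp g0 gLp A1 H); rewrite ler1n.
Qed.
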